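(* Let $\mathbf K$ be $\mathbf H$ or $\mathbf O$, let $n\in\mathbf N$, and let $U$ be a domain in $\mathbf K^n$ satisfying the standing domain condition (D). Let $\mathcal F$ be a family of $\mathbf K$-valued functions $\mathbf K$-holomorphic on $U$ such that each $f\in\mathcal F$, at each $\xi\in\mathrm{Int}(U)$ and by each variable ${}_jz$, is either pseudoconformal or satisfies $(\partial f(z)/\partial\,{}_jz)|_{z=\xi}=0$. If $$\mathrm{Int}\Big(\mathbf K\setminus\bigcup_{f\in\mathcal F}f(U)\Big)\neq\emptyset,$$ then $\mathcal F$ is normal.
   Context: Notation. $\mathbf K$ is the quaternion skew field $\mathbf H$ ($r=2$) or the octonion algebra $\mathbf O$ ($r=3$), with standard generators $i_0=1,i_1,\dots,i_{2^r-1}$; $\tilde z=z^*$ is the conjugate, $|z|^2=z\tilde z$, $\mathrm{Re}(z)=(z+\tilde z)/2$. Functions of $z$ are represented by phrases (finite or convergent infinite sums of bracketed words in $z$, $\tilde z$ and constants of $\mathbf K$); $\partial f/\partial z$ and $\partial f/\partial\tilde z$ are the partial (super)derivatives, $\mathbf R$-linear operators whose sum is the Fréchet derivative. $f$ is ($\mathbf K$-)holomorphic if it is differentiable with $\partial f/\partial\tilde z=0$ (by each variable); such $f$ is locally given by convergent power series in $z-z_0$ with coefficients in $\mathbf K$ interlaced between powers (with prescribed brackets), and $f'(z)=\partial f/\partial z$. Pseudoconformal. A differentiable $f:U\to\mathbf K$, $U$ open in $\mathbf K$, is pseudoconformal at $\xi$ if (1) $\partial f(z)/\partial\tilde z=0$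 at $z=\xi$; (2) $\mathrm{Re}\{[f'(\xi).h_1][f'(\xi).h_2]^*\}|h_1||h_2|=|f'(\xi).h_1||f'(\xi).h_2|\,\mathrm{Re}(h_1\tilde h_2)$ for all $h_1,h_2\in\mathbf K$; (3) $f'(\xi)\neq0$; where nonproper rotations of the underlying space $\mathbf R^{2^r}$ associated with $f'$ are excluded. Pseudoconformal by ${}_jz$ means this holds for $f$ as a function of ${}_jz$, where $z=({}_1z,\dots,{}_nz)\in\mathbf K^n$. Domain condition (D). For a subset $W\subset\mathbf K$ and distinct generators $s,p$, let $\mathbf C_{s,p}=\{as+bp:a,b\in\mathbf R\}$, let $\mathbf K_{r,s,p}$ be the set of $z\in\mathbf K$ whose coordinates along $s$ and $p$ vanish, and for $t\in\mathbf K_{r,s,p}$ let $\pi_{s,p,t}(W)=\{u\in\mathbf C_{s,p}:u+t\in W\}$. Condition (D) on $U\subset\mathbf K^n$: each coordinate projection $U_j=\{{}_jz:z\in U\}$ is $(2^r-1)$-connected (arcwise connected with trivial homotopy groups $\pi_k$ for $1\le k\le 2^r-1$), and $\pi_{s,p,t}(U_j)$ is simply connected in $\mathbf C$ for each $k=0,1,\dots,2^{r-1}-1$, $s=i_{2k}$, $p=i_{2k+1}$, $t\in\mathbf K_{r,s,p}$ and $u\in\mathbf C_{s,p}$ for which there exists $z=u+t\in U_j$. Normal family. For $V=\mathrm{cl}(\mathrm{Int}(V))$ closed bounded let $\rho_V(f,g)=\max_{z\in V}\big[|f(z)-g(z)|+\max_{|h|=1}|f'(z).h-g'(z).h|\big]$.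 A family $\mathcal F$ on $U$ is normal if each $f\in\mathcal F$ is holomorphic, at each $\xi\in U$ by each ${}_jz$ either pseudoconformal or with $\partial f/\partial\,{}_jz=0$, and for each infinite sequence in $\mathcal F$ and each closed bounded $V=\mathrm{cl}(\mathrm{Int}(V))\subset U$ there is a subsequence converging uniformly relative to $\rho_V$ to some limit function, which may also be a finite or infinite constant. *)

(* Defs.v *)
From HB Require Import structures.
From mathcomp Require Export all_boot all_order all_algebra.
From mathcomp Require Export all_classical all_reals all_analysis.
Export Order.TTheory GRing.Theory Num.Theory.
Export numFieldNormedType.Exports.

Set Implicit Arguments.
Unset Strict Implicit.
Unset Printing Implicit Defensive.

Local Open Scope classical_set_scope.
Local Open Scope ring_scope.

(* The r-th Cayley-Dickson algebra over R (r = 2: quaternions, r = 3: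
   octonions) has carrier 'rV[R]_(cdim r), so that it and its powers inherit
   the library's finite-dimensional topology. The dimension is 2 ^ r, written
   as a fixpoint so that the doubled space is convertible to a row of blocks. *)
Fixpoint cdim (r : nat) : nat := if r is s.+1 then (cdim s + cdim s)%N else 1%N.

Lemma cdimE (r : nat) : cdim r = (2 ^ r)%N.
Proof. by elim: r => // r IH; rewrite /= IH expnS mul2n addnn. Qed.

Notation cd R r := 'rV[R]_(cdim r).

(* K^n: row j is the j-th coordinate; K itself is definitionally K^1. *)
Notation cdn R r n := 'M[R]_(n, cdim r).

Section CayleyDickson.
Variable R : realType.

Fixpoint cd_conj (r : nat) : cd R r -> cd R r :=
  match r with
  | 0%N => fun z => z
  | s.+1 => fun z : 'rV[R]_(cdim s + cdim s) =>
      row_mx (cd_conj (lsubmx z)) (- rsubmx z)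
  end.

(* (a, b) (c, d) = (a c - d~ b, d a + b c~) *)
Fixpoint cd_mul (r : nat) : cd R r -> cd R r -> cd R r :=
  match r with
  | 0%N => fun x y => \row_j (x 0 j * y 0 j)
  | s.+1 => fun x y : 'rV[R]_(cdim s + cdim s) =>
      let a := lsubmx x in let b := rsubmx x in
      let c := lsubmx y in let d := rsubmx y in
      row_mx (cd_mul a c - cd_mul (cd_conj d) b)
             (cd_mul d a + cd_mul b (cd_conj c))
  end.

(* The coordinate along i_0 = 1, as a real number. *)
Fixpoint cd_re (r : nat) : cd R r -> R :=
  match r with
  | 0%N => fun z => z 0 0
  | s.+1 => fun z : 'rV[R]_(cdim s + cdim s) => cd_re (lsubmx z)
  end.

Definition cd_gen (r : nat) (k : 'I_(cdim r)) : cd R r := delta_mx 0 k.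

(* |z|^2 = z z~. The library norm `|z| is the (equivalent) sup norm. *)
Definition cd_abs (r : nat) (z : cd R r) : R :=
  Num.sqrt (cd_re (cd_mul z (cd_conj z))).

Definition cdn_abs (r n : nat) (z : cdn R r n) : R :=
  Num.sqrt (\sum_j cd_abs (row j z) ^+ 2).

Definition cd_inv (r : nat) (z : cd R r) : cd R r :=
  (cd_abs z ^+ 2)^-1 *: cd_conj z.

End CayleyDickson.

Section Phrases.
Variables (R : realType) (r n : nat).
Local Notation K := (cd R r).
Local Notation Kn := (cdn R r n).

(* Bracketed words in the variables, their conjugates and constants; the
   brackets are recorded by the tree. The letters _jz and _jz~ are kept apart:
   z~ is also the value of a finite sum of words in z alone, so superderivatives
   belong to phrases and not to functions. *)
Inductive word : Type :=
  | WConst of K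
  | WVar of 'I_n
  | WConj of 'I_n
  | WMul of word & word.

Fixpoint word_val (w : word) (z : Kn) : K :=
  match w with
  | WConst c => c
  | WVar j => row j z
  | WConj j => cd_conj (row j z)
  | WMul u v => cd_mul (word_val u z) (word_val v z)
  end.

(* (d w / d _jz)(z).h *)
Fixpoint word_dz (w : word) (j : 'I_n) (z : Kn) (h : K) : K :=
  match w with
  | WConst _ => 0
  | WVar i => if i == j then h else 0
  | WConj _ => 0
  | WMul u v => cd_mul (word_dz u j z h) (word_val v z)
                + cd_mul (word_val u z) (word_dz v j z h)
  end.

(* (d w / d _jz~)(z).h, with (d z~ / d z~).h = h~, so that the two
   superderivatives add up to the Frechet derivative. *)
Fixpoint word_dzc (w : word) (j : 'I_n) (z : Kn) (h : K) : K :=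
  match w with
  | WConst _ => 0
  | WVar _ => 0
  | WConj i => if i == j then cd_conj h else 0
  | WMul u v => cd_mul (word_dzc u j z h) (word_val v z)
                + cd_mul (word_val u z) (word_dzc v j z h)
  end.

(* The sum of the words p 0, p 1, ...; finite sums are padded by the word 0. *)
Definition phrase : Type := nat -> word.

(* In represents below the words are absolutely summable on an open ball; as |.|
   is multiplicative for r <= 3, the differentiated series converge there too. *)
Definition phrase_dz (p : phrase) (j : 'I_n) (z : Kn) (h : K) : K :=
  limn (series (fun k => word_dz (p k) j z h)).

Definition phrase_dzc (p : phrase) (j : 'I_n) (z : Kn) (h : K) : K :=
  limn (series (fun k => word_dzc (p k) j z h)).

(* On the ball of centre z0 and radius e, f is the sum of the absolutely
   convergent phrase p in z - z0 and its conjugate, and the superderivatives of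
   p add up to the Frechet derivative of f. *)
Definition represents (p : phrase) (z0 : Kn) (e : R) (f : Kn -> K) : Prop :=
  0 < e /\
  forall z, cdn_abs (z - z0) < e ->
    [/\ cvgn (series (fun k => cd_abs (word_val (p k) (z - z0)))),
        series (fun k => word_val (p k) (z - z0)) @ \oo --> f z,
        differentiable f z
      & forall h : Kn, 'd f z h =
          \sum_j (phrase_dz p j (z - z0) (row j h)
                  + phrase_dzc p j (z - z0) (row j h))].

Definition holomorphic (U : set Kn) (f : Kn -> K) : Prop :=
  forall z0, U z0 -> exists (p : phrase) (e : R),
    represents p z0 e f /\
    forall z j h, cdn_abs (z - z0) < e -> phrase_dzc p j (z - z0) h = 0.

End Phrases.

Section Pseudoconformal.
Variables (R : realType) (r : nat).
Local Notation K := (cd R r).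

(* For f of one variable: (d f / d z~)(xi) = 0 and f'(xi) = (d f / d z)(xi) = A.
   Such an A is the Frechet derivative, hence independent of the phrase. *)
Definition has_superderiv (f : K -> K) (xi : K) (A : K -> K) : Prop :=
  exists (p : phrase R r 1) (e : R),
    [/\ represents p xi e f,
        forall h, phrase_dzc p ord0 0 h = 0
      & forall h, phrase_dz p ord0 0 h = A h].

(* The determinant excludes nonproper rotations. *)
Definition pseudoconformal (f : K -> K) (xi : K) : Prop :=
  exists A : K -> K,
    [/\ has_superderiv f xi A,
        forall h1 h2 : K,
          cd_re (cd_mul (A h1) (cd_conj (A h2))) * (cd_abs h1 * cd_abs h2) =
          cd_abs (A h1) * cd_abs (A h2) * cd_re (cd_mul h1 (cd_conj h2)),
        (exists h, A h <> 0)
      & 0 < \det (lin1_mx A)].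

Definition critical (f : K -> K) (xi : K) : Prop :=
  has_superderiv f xi (fun=> 0).

(* f as a function of _jz, the other variables being those of xi. *)
Definition slice (n : nat) (f : cdn R r n -> K) (xi : cdn R r n) (j : 'I_n) :
    K -> K :=
  fun w => f (\matrix_i (if i == j then w else row i xi)).

Definition pseudoconformal_or_critical (n : nat) (f : cdn R r n -> K)
    (xi : cdn R r n) (j : 'I_n) : Prop :=
  pseudoconformal (slice f xi j) (row j xi) \/
  critical (slice f xi j) (row j xi).

End Pseudoconformal.

Section Connectivity.
Variables (R : realType) (T : topologicalType).

Definition arcwise_connected (A : set T) : Prop :=
  forall x y, A x -> A y -> exists c : R -> T,
    [/\ {within `[0, 1], continuous c}, c 0 = x, c 1 = y
      & forall t, 0 <= t <= 1 -> A (c t)].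

Definition cube (k : nat) : set 'rV[R]_k :=
  [set v | forall i, 0 <= v 0 i <= 1].

Definition cube_boundary (k : nat) : set 'rV[R]_k :=
  [set v | cube v /\ exists i, v 0 i = 0 \/ v 0 i = 1].

(* pi_k(A, x) = 0 for every base point x, elements of pi_k being classes of
   maps (I^k, boundary of I^k) -> (A, x). *)
Definition trivial_homotopy_group (k : nat) (A : set T) : Prop :=
  forall (x : T) (c : 'rV[R]_k -> T), A x ->
    {within @cube k, continuous c} ->
    (forall v, cube v -> A (c v)) ->
    (forall v, cube_boundary v -> c v = x) ->
    exists H : R * 'rV[R]_k -> T,
      [/\ {within [set q | 0 <= q.1 <= 1 /\ cube q.2], continuous H},
          forall t v, 0 <= t <= 1 -> cube v -> A (H (t, v)),
          forall v, cube v -> H (0, v) = c v /\ H (1, v) = x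
        & forall t v, 0 <= t <= 1 -> cube_boundary v -> H (t, v) = x].

Definition highly_connected (m : nat) (A : set T) : Prop :=
  arcwise_connected A /\
  forall k, (1 <= k <= m)%N -> trivial_homotopy_group k A.

Definition simply_connected (A : set T) : Prop := highly_connected 1 A.

End Connectivity.

Section DomainCondition.
Variables (R : realType) (r : nat).
Local Notation K := (cd R r).

Definition cd_plane (a b : 'I_(cdim r)) : set K :=
  [set u | exists x y : R, u = x *: cd_gen R a + y *: cd_gen R b].

Definition cd_coplane (a b : 'I_(cdim r)) : set K :=
  [set t | t 0 a = 0 /\ t 0 b = 0].

Definition cd_section (a b : 'I_(cdim r)) (t : K) (W : set K) : set K :=
  [set u | cd_plane a b u /\ W (u + t)].

Definition cdn_proj (n : nat) (U : set (cdn R r n)) (j : 'I_n) : set K :=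
  row j @` U.

Definition domain_condition (n : nat) (U : set (cdn R r n)) : Prop :=
  forall j : 'I_n,
    highly_connected R (2 ^ r - 1) (cdn_proj U j) /\
    forall (k : nat) (a b : 'I_(cdim r)) (t : K),
      (k <= 2 ^ r.-1 - 1)%N -> a = k.*2 :> nat -> b = k.*2.+1 :> nat ->
      cd_coplane a b t ->
      (exists u, cd_plane a b u /\ cdn_proj U j (u + t)) ->
      simply_connected R (cd_section a b t (cdn_proj U j)).

End DomainCondition.

Section Normal.
Variables (R : realType) (r n : nat).
Local Notation K := (cd R r).
Local Notation Kn := (cdn R r n).

(* f' is the Frechet derivative, i.e. d f / d z when d f / d z~ = 0; the
   suprema are maxima for C^1 functions on a nonempty compact V. *)
Definition rho (V : set Kn) (f g : Kn -> K) : \bar R :=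
  ereal_sup [set ((cd_abs (f z - g z))%:E +
    ereal_sup [set (cd_abs ('d f z h - 'd g z h))%:E
              | h in [set h : Kn | cdn_abs h = 1%R]])%E | z in V].

Definition rho_cvg (V : set Kn) (u : nat -> Kn -> K) (g : Kn -> K) : Prop :=
  (forall z, V z -> differentiable g z) /\
  rho V (u k) g @[k --> \oo] --> 0%E.

(* Convergence to the constant infinity: uniform on V, and relative to rho in
   the chart w |-> 1 / w at infinity. *)
Definition rho_cvg_infty (V : set Kn) (u : nat -> Kn -> K) : Prop :=
  (forall M : R, \forall k \near \oo, forall z, V z -> M < cd_abs (u k z)) /\
  rho_cvg V (fun k z => cd_inv (u k z)) (fun=> 0).

Definition normal_family (U : set Kn) (F : set (Kn -> K)) : Prop :=
  [/\ forall f, F f -> holomorphic U f,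
      forall f xi j, F f -> U xi -> pseudoconformal_or_critical f xi j
    & forall u : nat -> Kn -> K, (forall k, F (u k)) ->
      forall V : set Kn, V !=set0 -> closed V -> bounded_set V ->
        V = closure (interior V) -> V `<=` U ->
      exists2 s : nat -> nat, {homo s : k l / (k < l)%N} &
        (exists g : Kn -> K, rho_cvg V (fun k => u (s k)) g) \/
        rho_cvg_infty V (fun k => u (s k))].

End Normal.

(* Main.v *)
Require Import Defs.
From mathcomp Require Import ring lra.

Set Implicit Arguments.
Unset Strict Implicit.
Unset Printing Implicit Defensive.

(** Why the family is normal.

Absolutely convergent sums of words are real analytic, and the derivative of a
function of the family in the direction of one of its variables is at every
point a similarity or zero. Hence along each slice one has a smooth map between
domains of Euclidean 4-space or 8-space whose partial derivatives satisfy
<f_i, f_j> = mu delta_ij for a smooth factor mu >= 0 (holomorphic_Ck,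
pseudoconformal_dot).

The rigidity of such maps in dimension at least three is used in the form of a
differential equation for mu. The symmetry of the third derivatives forces
4 mu mu_bc = 6 mu_b mu_c - delta_bc |grad mu|^2 wherever mu > 0
(conformal_hess); it says that mu^(-1/2) is a quadratic polynomial with a double
root. Followed in the direction of its gradient, mu becomes infinite after the
length 4 mu / |grad mu| (ray_blow_up): this is the pole of the Moebius map that
Liouville's theorem would produce. So r |grad mu| <= 4 mu whenever the domain
contains the slice ball of radius r, and by Gronwall's inequality a critical
point makes the whole slice critical (grad_sqr_le, factor_harnack).

A nonvanishing conformal map g and its image under the inversion w / |w|^2 are
both conformal, with factors mu and mu / |g|^4. The gradient bounds of both
factors give r mu^(1/2) <= 2 |g| (nonvanishing_factor_le). This single estimate
bounds the derivative of g by g, and it is also a Harnack inequality for |g|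
(nonvanishing_harnack).

Let c be the centre of a ball that the family omits. The maps
g = inv (f - c), with inv the inversion, are bounded and vanish nowhere. Their
first derivatives and their pure second derivatives in the coordinate directions
are then locally bounded, and comparison with difference quotients makes the
first derivatives equicontinuous (bounded_conformal_estimates,
equicontinuous_derivatives). Given a sequence, choose an ultrafilter on the indices that
refines the Frechet filter; the maps g converge along it, locally uniformly with
their first derivatives (ultra_C1cvg). The Harnack inequality passes to the
limit, whose zeros therefore form an open and closed subset of U
(hurwitz_dichotomy). If the limit g vanishes nowhere, then f = c + inv g
converges to c + inv of the limit; if it vanishes identically, then f tends to
infinity (C1cvg_sphere_inv, rho_infinity). Members of the ultrafilter are
infinite, which turns convergence along it into convergence of a subsequence
(frequent_subsequence). *)

Local Open Scope classical_set_scope.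
Local Open Scope ring_scope.

(** * Scalar functions of class C^k on normed spaces *)

Section FrechetEps.
Context {R : realType} {V W : normedModType R}.

(** Derivatives of limits and of sums of series are certified in this form. *)
Lemma differentiable_eps (f : V -> W) (x : V) (L : {linear V -> W}) :
  continuous L ->
  (forall e, 0 < e -> \forall h \near (0 : V),
     `|f (x + h) - f x - L h| <= e * `|h|) ->
  differentiable f x /\ 'd f x = L :> (V -> W).
Proof.
move=> Lc Lf.
have H : f \o shift x = cst (f x) + L +o_ 0 id.
  apply/eqaddoP => e e0; near=> h => /=.
  rewrite [X in `|X|](_ : _ = f (x + h) - f x - L h) /=; last first.
    by rewrite !fctE /cst opprD addrA [h + x]addrC.
  by near: h; exact: Lf.
have dL := diff_unique Lc H.
by split=> //; apply/diff_locallyP; rewrite dL.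
Unshelve. all: by end_near. Qed.

Lemma differentiable_epsP (f : V -> W) (x : V) : differentiable f x ->
  forall e, 0 < e -> \forall h \near (0 : V),
     `|f (x + h) - f x - 'd f x h| <= e * `|h|.
Proof.
move=> /diff_locallyP [_ /eqaddoP H] e e0.
near=> h.
have -> : f (x + h) - f x - 'd f x h
    = (f \o shift x - (cst (f x) + 'd f x)) h.
  by rewrite !fctE /cst /= opprD addrA [h + x]addrC.
by near: h; exact: H.
Unshelve. all: by end_near. Qed.

Lemma near_eq_differentiable (f g : V -> W) (x : V) :
  (\forall y \near x, f y = g y) -> differentiable f x ->
  differentiable g x /\ 'd g x = 'd f x :> (V -> W).
Proof.
move=> fg df; have fgx := nbhs_singleton fg.
apply: differentiable_eps; first exact: diff_continuous.
move=> e e0; near=> h.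
rewrite -fgx -(_ : f (x + h) = g (x + h)).
  by near: h; exact: differentiable_epsP.
near: h; have /= := @near_shift R V 0 x (fun y => f y = g y).
rewrite subr0 => H; have : \forall y \near x, f y = g y by [].
rewrite H; apply: filterS => h /=; by rewrite addrC.
Unshelve. all: by end_near. Qed.

End FrechetEps.

Lemma ler_dist_half (R : realType) (a b z e : R) :
  `|a - z| <= e / 2 -> `|b - z| <= e / 2 -> `|a - b| <= e.
Proof. by rewrite !ler_norml => /andP[? ?] /andP[? ?]; apply/andP; split; lra. Qed.

Section LineDerivative.
Context {R : realType} {V : normedModType R}.

Lemma is_derive_line (f : V -> R) (x v : V) (t : R) :
  differentiable f (x + t *: v) ->
  is_derive t 1 (fun s : R => f (x + s *: v)) ('D_v f (x + t *: v)).
Proof.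
move=> df.
have H : (fun h : R => h^-1 *: (((fun s : R => f (x + s *: v)) \o shift t)
     (h *: (1:R)) - f (x + t *: v))) =
   (fun h : R => h^-1 *: ((f \o shift (x + t *: v)) (h *: v) - f (x + t *: v))).
  apply/funext => h /=; congr (_ *: (f _ - _)).
  by rewrite [h *: 1]mulr1 scalerDl addrCA.
have dv : derivable f (x + t *: v) v by exact: diff_derivable.
by split; rewrite /derivable /derive H.
Qed.

Lemma line_continuous (x v : V) : continuous (fun s : R => x + s *: v).
Proof.
by move=> t; apply: cvgD; [exact: cvg_cst | apply: cvgZr_tmp; exact: cvg_id].
Qed.

Lemma line_differentiable_continuous (f : V -> R) (x v : V) (A : set R) :
  (forall t, A t -> differentiable f (x + t *: v)) ->
  {within A, continuous (fun t : R => f (x + t *: v))}.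
Proof.
move=> df; apply: continuous_in_subspaceT => t; rewrite inE => At.
apply: (@continuous_comp R V R^o (fun s : R => x + s *: v) f t).
  exact: line_continuous.
exact/differentiable_continuous/df.
Qed.

(** The mean value theorem is only needed for scalar functions along segments;
vector-valued maps are treated one coordinate at a time. *)
Lemma MVT_line (f : V -> R) (x v : V) (s : R) : 0 <= s ->
  (forall t, 0 <= t <= s -> differentiable f (x + t *: v)) ->
  exists2 t, 0 <= t <= s & f (x + s *: v) - f x = 'D_v f (x + t *: v) * s.
Proof.
move=> s0 df; have [||c] := @MVT_segment R (fun s => f (x + s *: v))
    (fun s => 'D_v f (x + s *: v)) 0 s s0.
- move=> t; rewrite in_itv /= => /andP[t0 t1]; apply: is_derive_line.
  by apply: df; rewrite !ltW.
- by apply: line_differentiable_continuous => t /=; rewrite in_itv /=; exact: df.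
by rewrite in_itv /= subr0 scale0r addr0 => c01 E; exists c.
Qed.

End LineDerivative.

Section SmoothFunctions.
Context {R : realType} {V : normedModType R}.

(** Iterated directional derivatives, instead of higher Frechet differentials, keep
the class within scalar functions; its closure properties are then inductions
on k that use the rules for first derivatives. *)
Fixpoint Ck (U : set V) (k : nat) (f : V -> R) : Prop :=
  match k with
  | 0%N => forall x, U x -> {for x, continuous f}
  | k.+1 => (forall x, U x -> differentiable f x) /\
            forall v, Ck U k (fun x => 'D_v f x)
  end.

Implicit Types (U W : set V) (k : nat) (f g : V -> R).

Lemma Ck_differentiable U k f x : Ck U k.+1 f -> U x -> differentiable f x.
Proof. by move=> [H _] /H. Qed.

Lemma Ck_derive U k f v : Ck U k.+1 f -> Ck U k (fun x => 'D_v f x).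
Proof. by move=> [_ H]; exact: H. Qed.

Lemma CkS U k f : Ck U k.+1 f -> Ck U k f.
Proof.
elim: k f => [|k IH] f /= [df Df]; first by move=> x Ux; exact/differentiable_continuous/df.
by split=> // v; apply: IH; exact: Df.
Qed.

Lemma Ck_continuous U k f x : Ck U k f -> U x -> {for x, continuous f}.
Proof. by elim: k => [|k IH]; [move=> H /H | move=> /CkS/IH]. Qed.

Lemma Ck_local U k f :
  (forall x, U x -> exists2 W, W x & Ck W k f) -> Ck U k f.
Proof.
elim: k f => [|k IH] f /= H.
  by move=> x Ux; have [W Wx] := H x Ux; exact.
split=> [x Ux|v]; first by have [W Wx [df _]] := H x Ux; exact: df.
by apply: IH => x Ux; have [W Wx [_ Df]] := H x Ux; exists W.
Qed.

Lemma Ck_eq U k f g : open U -> (forall x, U x -> f x = g x) ->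
  Ck U k f -> Ck U k g.
Proof.
move=> oU; elim: k f g => [|k IH] f g fg /=.
  move=> cf x Ux; have fgx : \forall y \near x, f y = g y.
    by apply: filterS (open_nbhs_nbhs (conj oU Ux)) => y; exact: fg.
  rewrite /prop_for /continuous_at -(fg x Ux).
  exact: cvg_trans (near_eq_cvg fgx) (cf x Ux).
have fgn x : U x -> \forall y \near x, f y = g y.
  by move=> Ux; apply: filterS (open_nbhs_nbhs (conj oU Ux)) => y; exact: fg.
move=> [df Df]; split=> [x Ux|v].
  by have [] := near_eq_differentiable (fgn x Ux) (df x Ux).
apply: IH (Df v) => x Ux.
have [dg dgE] := near_eq_differentiable (fgn x Ux) (df x Ux).
exact: etrans (deriveE v (df x Ux)) (esym (etrans (deriveE v dg) (congr1 (fun h => h v) dgE))).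
Qed.

Lemma Ck_cst U k (a : R) : Ck U k (fun=> a).
Proof.
elim: k a => [|k IH] a /=; first by move=> x _; exact: cvg_cst.
split=> [x _|v]; first exact: differentiable_cst.
have -> : (fun x : V => 'D_v (fun _ : V => a) x) = (fun _ : V => 0 : R).
  by apply/funext => x; exact: derive_cst.
exact: IH.
Qed.

Lemma CkD U k f g : open U -> Ck U k f -> Ck U k g ->
  Ck U k (fun x => f x + g x).
Proof.
move=> oU; elim: k f g => [|k IH] f g /=.
  by move=> cf cg x Ux; apply: cvgD; [exact: cf|exact: cg].
move=> [df Df] [dg Dg]; split=> [x Ux|v].
  by apply: (@differentiableD _ _ _ f g); [exact: df|exact: dg].
apply: (Ck_eq oU _ (IH _ _ (Df v) (Dg v))) => x Ux.
by rewrite [RHS](@deriveD _ _ _ f g) //; apply: diff_derivable; [exact: df|exact: dg].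
Qed.

Lemma CkM U k f g : open U -> Ck U k f -> Ck U k g ->
  Ck U k (fun x => f x * g x).
Proof.
move=> oU; elim: k f g => [|k IH] f g Cf Cg /=.
  by move=> x Ux; apply: cvgM; [exact: Cf|exact: Cg].
case: (Cf) => df Df; case: (Cg) => dg Dg; split=> [x Ux|v].
  by apply: (@differentiableM _ _ f g); [exact: df|exact: dg].
apply: (Ck_eq oU _ (CkD oU (IH _ _ (CkS Cf) (Dg v)) (IH _ _ (CkS Cg) (Df v)))).
move=> x Ux.
by rewrite [RHS](@deriveM _ _ f g) //; apply: diff_derivable; [exact: df|exact: dg].
Qed.

Lemma CkV U k f : open U -> (forall x, U x -> f x != 0) -> Ck U k f ->
  Ck U k (fun x => (f x)^-1).
Proof.
move=> oU f0; elim: k => [|k IH] Cf /=.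
  by move=> x Ux; apply: cvgV; [exact: f0|exact: Cf].
case: (Cf) => df Df; split=> [x Ux|v].
  by apply: (@differentiableV _ _ f); [exact: df|exact: f0].
have CV := IH (CkS Cf).
apply: (Ck_eq oU _ (CkM oU (CkM oU (Ck_cst U k (-1)) (CkM oU CV CV)) (Df v))).
move=> x Ux; rewrite [RHS](@deriveV _ _ f) //; [|exact: f0| apply: diff_derivable; exact: df].
by rewrite mulN1r -expr2 -exprVn.
Qed.

Lemma Ck_sum U k (I : Type) (r : seq I) (F : I -> V -> R) : open U ->
  (forall i, Ck U k (F i)) -> Ck U k (fun x => \sum_(i <- r) F i x).
Proof.
move=> oU CF; elim: r => [|i r IH].
  have -> : (fun x => \sum_(i <- [::]) F i x) = (fun _ : V => 0 : R).
    by apply/funext => x; rewrite big_nil.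
  exact: Ck_cst.
have -> : (fun x => \sum_(i <- i :: r) F i x) = (fun x => F i x + \sum_(i <- r) F i x).
  by apply/funext => x; rewrite big_cons.
exact: CkD.
Qed.

(** The mean value theorem in the direction v, applied to the increment of f in the
direction w, and then in the direction w. *)
Lemma Ck2_second_difference U f (x v w : V) (s : R) :
  Ck U 2 f -> 0 <= s ->
  (forall a b, 0 <= a <= s -> 0 <= b <= s -> U (x + a *: v + b *: w)) ->
  exists a b, [/\ 0 <= a <= s, 0 <= b <= s &
    f (x + s *: v + s *: w) - f (x + s *: v) - f (x + s *: w) + f x =
    s ^+ 2 * 'D_w (fun y => 'D_v f y) (x + a *: v + b *: w)].
Proof.
move=> Cf s0 Us.
have df y : U y -> differentiable f y by exact: Ck_differentiable Cf.
have dDf y : U y -> differentiable (fun y => 'D_v f y) y.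
  exact: Ck_differentiable (Ck_derive v Cf).
have Us1 t : 0 <= t <= s -> U ((x + s *: w) + t *: v).
  by move=> ts; rewrite addrAC; apply: Us => //; rewrite s0 lexx.
have Us0 t : 0 <= t <= s -> U (x + t *: v).
  move=> ts; rewrite -[X in U X]addr0 -(scale0r w).
  by apply: Us => //; rewrite lexx.
have [||a] := @MVT_segment R
   (fun t => f ((x + s *: w) + t *: v) - f (x + t *: v))
   (fun t => 'D_v f ((x + s *: w) + t *: v) - 'D_v f (x + t *: v)) 0 s s0.
- move=> t; rewrite in_itv /= => /andP[t0 t1].
  have ts : 0 <= t <= s by rewrite !ltW.
  by apply: is_deriveB; apply: is_derive_line; apply: df; [exact: Us1|exact: Us0].
- move=> t; apply: cvgB.
    by apply: line_differentiable_continuous => r /=; rewrite in_itv => /Us1/df.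
  by apply: line_differentiable_continuous => r /=; rewrite in_itv => /Us0/df.
rewrite in_itv /= subr0 scale0r !addr0 => sa E.
have [b sb Eb] := @MVT_line _ _ (fun y => 'D_v f y) (x + a *: v) w s s0
  (fun t ts => dDf _ (Us a t sa ts)).
exists a, b; split=> //.
move: E; rewrite [x + s *: w + a *: v]addrAC Eb => E.
rewrite expr2 -mulrA [s * (s * _)]mulrA [s * s * _]mulrC mulrA -E.
rewrite [x + s *: w + s *: v]addrAC; ring.
Qed.

(** The second difference is symmetric in v and w; divided by s ^ 2 it tends to both
mixed derivatives. *)
Lemma Ck2_schwarz U f (x v w : V) : open U -> Ck U 2 f -> U x ->
  'D_w (fun y => 'D_v f y) x = 'D_v (fun y => 'D_w f y) x.
Proof.
move=> oU Cf Ux; apply/eqP; rewrite -subr_eq0 -normr_le0; apply/ler_addgt0Pr => e e0.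
have c1 : {for x, continuous (fun y => 'D_w (fun y => 'D_v f y) y)}.
  exact: Ck_continuous (Ck_derive w (Ck_derive v Cf)) Ux.
have c2 : {for x, continuous (fun y => 'D_v (fun y => 'D_w f y) y)}.
  exact: Ck_continuous (Ck_derive v (Ck_derive w Cf)) Ux.
have e2 : 0 < e / 2 by rewrite divr_gt0.
have : nbhs x [set y | [/\ U y,
   `|'D_w (fun y => 'D_v f y) x - 'D_w (fun y => 'D_v f y) y| <= e / 2 &
   `|'D_v (fun y => 'D_w f y) x - 'D_v (fun y => 'D_w f y) y| <= e / 2]].
  have n1 : \forall y \near x, 
    `|'D_w (fun y => 'D_v f y) x - 'D_w (fun y => 'D_v f y) y| <= e / 2.
    exact: (proj1 (@cvgrPdist_le _ _ _ _ (nbhs_filter x) _ _) c1).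
  have n2 : \forall y \near x, 
    `|'D_v (fun y => 'D_w f y) x - 'D_v (fun y => 'D_w f y) y| <= e / 2.
    exact: (proj1 (@cvgrPdist_le _ _ _ _ (nbhs_filter x) _ _) c2).
  apply: filterS (filterI (open_nbhs_nbhs (conj oU Ux)) (filterI n1 n2)).
  by move=> y [? [? ?]]; split.
move=> /nbhs_ballP [r r0 H].
have r0' : 0 < (r : R) by [].
pose s := r / 2 / (1 + `|v| + `|w|).
have d0 : 0 < 1 + `|v| + `|w| by rewrite -addrA ltr_wpDr// addr_ge0.
have s0 : 0 < s by rewrite !divr_gt0.
have Us (v' w' : V) : `|v'| + `|w'| <= `|v| + `|w| -> forall a b, 0 <= a <= s -> 0 <= b <= s ->
    ball x r (x + a *: v' + b *: w').
  move=> vw a b /andP[a0 sa] /andP[b0 sb].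
  rewrite -ball_normE /= -addrA opprD addrA subrr sub0r normrN.
  rewrite (le_lt_trans (ler_normD _ _))// !normrZ !ger0_norm//.
  apply: (@le_lt_trans _ _ (s * (1 + `|v| + `|w|))); last first.
    by rewrite divfK ?gt_eqF// ltr_pdivrMr// ltr_pMr// ltr1n.
  rewrite -addrA mulrDr mulr1; apply: ler_wpDl; first exact: ltW.
  apply: le_trans (ler_wpM2l (ltW s0) vw).
  by rewrite mulrDr lerD// ler_wpM2r.
have [a [b [sa sb E1]]] := Ck2_second_difference Cf (ltW s0)
  (fun a b sa sb => let: And3 u _ _ := H _ (Us v w (lexx _) a b sa sb) in u).
have wv : `|w| + `|v| <= `|v| + `|w| by rewrite addrC.
have [a' [b' [sa' sb' E2]]] := Ck2_second_difference Cf (ltW s0)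
  (fun a b sa sb => let: And3 u _ _ := H _ (Us w v wv a b sa sb) in u).
have [_ A1 _] := H _ (Us v w (lexx _) a b sa sb).
have [_ _ A2] := H _ (Us w v wv a' b' sa' sb').
have EE : 'D_w (fun y => 'D_v f y) (x + a *: v + b *: w)
        = 'D_v (fun y => 'D_w f y) (x + a' *: w + b' *: v).
  have s20 : s ^+ 2 != 0 by rewrite expf_neq0// gt_eqF.
  apply: (mulfI s20); apply: etrans (esym E1) (etrans _ E2).
  by rewrite [x + s *: w + s *: v]addrAC; congr (_ + _); rewrite [LHS]addrAC.
rewrite add0r; apply: (ler_dist_half A1).
by rewrite EE.
Qed.

End SmoothFunctions.

(** * Euclidean vectors and second-order jets of conformal maps *)

Section Euclidean.
Context {R : realType} {d : nat}.
Implicit Types x y z : 'rV[R]_d.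

Definition dot x y : R := \sum_i x 0 i * y 0 i.

Lemma dotC x y : dot x y = dot y x.
Proof. by apply: eq_bigr => i _; rewrite mulrC. Qed.

Lemma dotDl x y z : dot (x + y) z = dot x z + dot y z.
Proof. by rewrite -big_split; apply: eq_bigr => i _; rewrite mxE mulrDl. Qed.

Lemma dotZl a x y : dot (a *: x) y = a * dot x y.
Proof. by rewrite mulr_sumr; apply: eq_bigr => i _; rewrite mxE mulrA. Qed.

Lemma dotNl x y : dot (- x) y = - dot x y.
Proof. by rewrite -scaleN1r dotZl mulN1r. Qed.

Lemma dotDr x y z : dot z (x + y) = dot z x + dot z y.
Proof. by rewrite dotC dotDl !(dotC z). Qed.

Lemma dotZr a x y : dot x (a *: y) = a * dot x y.
Proof. by rewrite dotC dotZl dotC. Qed.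

Lemma dotNr x y : dot x (- y) = - dot x y.
Proof. by rewrite dotC dotNl dotC. Qed.

Lemma dotBl x y z : dot (x - y) z = dot x z - dot y z.
Proof. by rewrite dotDl dotNl. Qed.

Lemma dotBr x y z : dot z (x - y) = dot z x - dot z y.
Proof. by rewrite dotDr dotNr. Qed.

Lemma dot0l x : dot 0 x = 0.
Proof. by rewrite /dot big1// => i _; rewrite mxE mul0r. Qed.

Lemma dot_suml (I : Type) (r : seq I) (F : I -> 'rV[R]_d) x :
  dot (\sum_(i <- r) F i) x = \sum_(i <- r) dot (F i) x.
Proof.
elim: r => [|i r IH]; first by rewrite !big_nil dot0l.
by rewrite !big_cons dotDl IH.
Qed.

Lemma dotxx_ge0 x : 0 <= dot x x.
Proof. by apply: sumr_ge0 => i _; rewrite -expr2 sqr_ge0. Qed.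

Lemma dotxx_eq0 x : dot x x = 0 -> x = 0.
Proof.
move=> /eqP; rewrite psumr_eq0; last by move=> i _; rewrite -expr2 sqr_ge0.
move=> /allP H; apply/rowP => i; apply/eqP.
by have := H i; rewrite mem_index_enum mulf_eq0 orbb mxE; apply.
Qed.

Lemma dotxx_gt0 x : x != 0 -> 0 < dot x x.
Proof.
move=> x0; rewrite lt_neqAle dotxx_ge0 andbT eq_sym.
by apply: contra x0 => /eqP /dotxx_eq0 ->.
Qed.

Lemma dot_sqr_le x y : dot x y ^+ 2 <= dot x x * dot y y.
Proof.
have [/eqP ->|/dotxx_gt0 y0] := boolP (y == 0).
  by rewrite dotC !dot0l mulr0 expr0n.
have := dotxx_ge0 (dot y y *: x - dot x y *: y).
rewrite !(dotBl, dotBr, dotZl, dotZr) (dotC y x) => H.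
have : 0 <= dot y y * (dot x x * dot y y - dot x y ^+ 2).
  by apply: le_trans H _; rewrite le_eqVlt; apply/orP; left; apply/eqP; ring.
by rewrite pmulr_rge0// subr_ge0.
Qed.

Lemma dot_coord_le x i : x 0 i ^+ 2 <= dot x x.
Proof.
by rewrite /dot (bigD1 i)//= -expr2 lerDl sumr_ge0// => j _; rewrite -expr2 sqr_ge0.
Qed.

Lemma dot_delta x i : dot x (delta_mx 0 i) = x 0 i.
Proof.
rewrite /dot (bigD1 i)//= mxE !eqxx mulr1 big1 ?addr0// => j /negbTE ji.
by rewrite mxE ji andbF mulr0.
Qed.

Lemma dot_delta_delta (i j : 'I_d) :
  dot (delta_mx 0 i) (delta_mx 0 j) = (i == j)%:R.
Proof. by rewrite dot_delta mxE eqxx eq_sym. Qed.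

(** The f k are the rows of a matrix A with A A^T = mu I; hence A^T A = mu I. *)
Lemma dot_parseval (f : 'I_d -> 'rV[R]_d) (mu : R) : mu != 0 ->
  (forall i j, dot (f i) (f j) = mu * (i == j)%:R) ->
  forall v w, \sum_k dot v (f k) * dot w (f k) = mu * dot v w.
Proof.
move=> mu0 fo v w.
pose A : 'M[R]_d := \matrix_i f i.
have AE i j : A i j = f i 0 j by rewrite mxE.
have AAT : A *m (mu^-1 *: A^T) = 1%:M.
  apply/matrixP => i j; rewrite -scalemxAr !mxE.
  have -> : \sum_j0 A i j0 * A^T j0 j = mu * (i == j)%:R.
    by rewrite -fo; apply: eq_bigr => k _; rewrite !mxE.
  by rewrite mulrA mulVf ?mul1r.
have ATA : A^T *m A = mu%:M.
  have := mulmx1C AAT; rewrite -scalemxAl => /(congr1 (fun M => mu *: M)).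
  by rewrite scalerA mulfV// scale1r => ->; rewrite scalemx1.
have dE k u : dot u (f k) = (u *m A^T) 0 k.
  by rewrite mxE; apply: eq_bigr => j _; rewrite !mxE.
under eq_bigr => k _ do rewrite !dE.
transitivity ((v *m A^T *m (w *m A^T)^T) 0 0).
  by rewrite mxE; apply: eq_bigr => k _; rewrite [_^T k 0]mxE.
rewrite trmx_mul trmxK mulmxA -(mulmxA v) ATA mul_mx_scalar -scalemxAl mxE; congr (_ * _).
by rewrite mxE; apply: eq_bigr => k _; rewrite mxE.
Qed.

End Euclidean.

(** The dimension is at least three: this is what makes conformal maps rigid. *)
Lemma third_index d (b c : 'I_d) : (2 < d)%N -> exists a : 'I_d, a != b /\ a != c.
Proof.
move=> d2; have : ~~ ([set: 'I_d]%SET \subset [set b; c]%SET).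
  apply/negP => /subset_leq_card; rewrite cardsT card_ord cards2 => H.
  by have := leq_trans d2 H; case: (b != c).
move=> /subsetPn [a _]; rewrite !inE negb_or => /andP[ab ac]; by exists a.
Qed.

(** The derivatives of orders one, two and three of a conformal map at a point are
f1, f2 and f3; mu is the conformal factor, m1 and m2 are its derivatives. J2 and
J3 are what one obtains by differentiating J1 once and twice. The computation is
purely algebraic from there on. *)
Section ConformalJet.
Variables (R : realType) (d : nat) (d_gt2 : (2 < d)%N).
Variables (f1 : 'I_d -> 'rV[R]_d) (f2 : 'I_d -> 'I_d -> 'rV[R]_d).
Variables (f3 : 'I_d -> 'I_d -> 'I_d -> 'rV[R]_d).
Variables (mu : R) (m1 : 'I_d -> R) (m2 : 'I_d -> 'I_d -> R).
Hypothesis mu0 : mu != 0.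
Hypothesis f2C : forall i j, f2 i j = f2 j i.
Hypothesis f3C : forall i j k, f3 i j k = f3 j i k.
Hypothesis f3C' : forall i j k, f3 i j k = f3 i k j.
Hypothesis J1 : forall i j, dot (f1 i) (f1 j) = mu * (i == j)%:R.
Hypothesis J2 : forall i j k,
  dot (f2 i k) (f1 j) + dot (f1 i) (f2 j k) = m1 k * (i == j)%:R.
Hypothesis J3 : forall i j k l,
  dot (f3 i k l) (f1 j) + dot (f2 i k) (f2 j l)
  + (dot (f2 i l) (f2 j k) + dot (f1 i) (f3 j k l)) = m2 k l * (i == j)%:R.

Let E (i : 'I_d) : 'rV[R]_d := delta_mx 0 i.
Let grad : 'rV[R]_d := \row_k m1 k.
Let N := dot grad grad.
(* The Christoffel symbols, of the first kind, of the metric mu |dx|^2. *)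
Let gam i j : 'rV[R]_d :=
  2^-1 *: (m1 i *: E j + m1 j *: E i - (i == j)%:R *: grad).

(* Permuting the indices of J2 cyclically isolates one term. *)
Let christoffel i j k : dot (f2 i j) (f1 k) = gam i j 0 k.
Proof.
have := J2 i k j; have := J2 j k i; have := J2 i j k.
rewrite (f2C k i) (f2C k j) (f2C j i) !(dotC (f1 _)) !mxE eqxx /=.
by rewrite ![_ == k]eq_sym; lra.
Qed.

Let f2_dot i j k l : mu * dot (f2 i j) (f2 k l) = dot (gam i j) (gam k l).
Proof.
rewrite -(dot_parseval mu0 J1); apply: eq_bigr => m _.
by rewrite !christoffel.
Qed.

Let dotEE i j : dot (E i) (E j) = (i == j)%:R.
Proof. exact: dot_delta_delta. Qed.
Let dotEg i : dot (E i) grad = m1 i.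
Proof. by rewrite dotC dot_delta mxE. Qed.
Let dotgE i : dot grad (E i) = m1 i.
Proof. by rewrite dot_delta mxE. Qed.

(** In the frame f1, and up to the factor mu, the vector f2 i i has the coordinates
of m1 i E_i - grad / 2, which is the image of grad / 2 under the reflection in the axis E_i. *)
Lemma conformal_f2_norm i : 4 * mu * dot (f2 i i) (f2 i i) = N.
Proof.
rewrite -mulrA f2_dot /gam eqxx.
rewrite !(dotZl, dotZr, dotDl, dotDr, dotNl, dotNr) !dotEE !dotEg !dotgE eqxx -/N /=.
by field.
Qed.

(** Four instances of J3 eliminate the third derivatives and express m2 b c by the
Gauss equation, that is, by inner products of second derivatives. *)
Lemma conformal_factor_hess_offdiag b c : b != c ->
  4 * mu * m2 b c = 6 * m1 b * m1 c.
Proof.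
move=> bc; have [a [ab ac]] := third_index b c d_gt2.
have aa : m2 b c = 2 * (dot (f2 a b) (f2 a c) - dot (f2 a a) (f2 b c)).
  have := J3 a a b c; have := J3 a b a c; have := J3 a c a b; have := J3 b c a a.
  rewrite eqxx (negbTE ab) (negbTE ac) (negbTE bc) !mulr0 mulr1.
  rewrite (f2C b a) (f2C c a) (f2C c b) !(dotC (f1 _)).
  rewrite (dotC (f2 a c) (f2 a b)).
  rewrite (f3C b a a) (f3C c a a) (f3C b a c) (f3C c a b) (f3C' a c b).
  rewrite (f3C' a b a) (f3C' a c a); lra.
have : mu * m2 b c = 2 * (mu * dot (f2 a b) (f2 a c) - mu * dot (f2 a a) (f2 b c)).
  by rewrite aa; ring.
rewrite !f2_dot /gam eqxx (negbTE ab) (negbTE ac) (negbTE bc).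
rewrite !(dotZl, dotZr, dotDl, dotDr, dotNl, dotNr) !dotEE !dotEg !dotgE !eqxx.
rewrite ?(eq_sym b a) ?(eq_sym c a) ?(eq_sym c b).
rewrite (negbTE ab) (negbTE ac) (negbTE bc) => H.
by rewrite -mulrA H /=; field.
Qed.

(** The Gauss equation only yields the sums m2 i i + m2 j j; three distinct indices
determine each summand. *)
Lemma conformal_factor_hess_diag a : 4 * mu * m2 a a = 6 * m1 a * m1 a - N.
Proof.
have pair i j : i != j ->
    2 * mu * (m2 i i + m2 j j) = 3 * m1 i ^+ 2 + 3 * m1 j ^+ 2 - N.
  move=> ij.
  have ss : m2 i i + m2 j j = 2 * (dot (f2 i j) (f2 i j) - dot (f2 i i) (f2 j j)).
    have := J3 i i j j; have := J3 j j i i; have := J3 i j i j.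
    rewrite !eqxx (negbTE ij) !mulr0 !mulr1.
    rewrite (f2C j i) !(dotC (f1 _)).
    rewrite (f3C j i i) (f3C j i j) (f3C' i j i); lra.
  have : mu * (m2 i i + m2 j j) =
      2 * (mu * dot (f2 i j) (f2 i j) - mu * dot (f2 i i) (f2 j j)).
    by rewrite ss; ring.
  rewrite !f2_dot /gam !eqxx (negbTE ij).
  rewrite !(dotZl, dotZr, dotDl, dotDr, dotNl, dotNr) !dotEE !dotEg !dotgE !eqxx.
  rewrite ?(eq_sym j i) (negbTE ij) -/N => H.
  by rewrite -mulrA H /=; field.
have [b [ba _]] := third_index a a d_gt2.
have [c [ca cb]] := third_index a b d_gt2.
have := pair b a ba; have := pair c a ca; have := pair c b cb.
by lra.
Qed.

(** The metric mu |dx|^2 is flat, being pulled back from the Euclidean one. In terms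
of rho = mu ^ (- 1 / 2) the equation reads 2 rho rho_bc = delta_bc |grad rho|^2. *)
Lemma conformal_factor_hess b c :
  4 * mu * m2 b c = 6 * m1 b * m1 c - (b == c)%:R * N.
Proof.
have [<-|bc] := eqVneq b c; first by rewrite mul1r conformal_factor_hess_diag.
by rewrite mul0r subr0 conformal_factor_hess_offdiag.
Qed.

End ConformalJet.

(** * Functions of one real variable *)

Section OneVariable.
Context {R : realType}.
Implicit Types f g : R -> R.

Lemma is_derive1M f g t a b : is_derive (t : R) (1 : R) f a -> is_derive (t : R) (1 : R) g b ->
  is_derive (t : R) (1 : R) (fun s => f s * g s) (a * g t + f t * b).
Proof.
move=> fa gb; have H := is_deriveM fa gb.
by apply: is_derive_eq H _; rewrite /GRing.scale /= addrC (mulrC a).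
Qed.

Lemma is_derive1D f g t a b : is_derive (t : R) (1 : R) f a -> is_derive (t : R) (1 : R) g b ->
  is_derive (t : R) (1 : R) (fun s => f s + g s) (a + b).
Proof. by move=> fa gb; exact: is_deriveD fa gb. Qed.

Lemma is_derive1V f t a : f t != 0 -> is_derive (t : R) (1 : R) f a ->
  is_derive (t : R) (1 : R) (fun s => (f s)^-1) (- (a / (f t) ^+ 2)).
Proof.
move=> f0 fa; have H := is_deriveV f0 fa.
by apply: is_derive_eq H _; rewrite /GRing.scale /= mulNr mulrC.
Qed.

Lemma is_derive1_continuous f t a : is_derive (t : R) (1 : R) f a -> {for t, continuous f}.
Proof.
by move=> fa; apply: differentiable_continuous; apply/derivable1_diffP.
Qed.

(** The degenerate interval is allowed, so that users need not treat it apart. *)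
Lemma derive1_MVT f df (T : R) : 0 <= T ->
  (forall t, 0 <= t <= T -> {for t, continuous f}) ->
  (forall t, 0 < t < T -> is_derive (t : R) (1 : R) f (df t)) ->
  f T = f 0 \/ exists2 c, 0 < c < T & f T - f 0 = df c * T.
Proof.
move=> T0 cf dfT; have [T00|T0'] := eqVneq T 0; first by left; rewrite T00.
right; have {T0' T0}T0 : 0 < T by rewrite lt_neqAle eq_sym T0'.
have cf' : {within `[0, T], continuous f}.
  by apply: continuous_in_subspaceT => t; rewrite inE /= in_itv; exact: cf.
have [c] := MVT T0 (fun t (tT : t \in `]0, T[) => dfT t tT) cf'.
by rewrite in_itv subr0 => c01 E; exists c.
Qed.

Lemma derive1_const f (T : R) : 0 <= T ->
  (forall t, 0 <= t <= T -> is_derive (t : R) (1 : R) f 0) -> f T = f 0.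
Proof.
move=> T0 df.
have cf t : 0 <= t <= T -> {for t, continuous f}.
  by move=> /df; exact: is_derive1_continuous.
have df' t : 0 < t < T -> is_derive (t : R) (1 : R) f 0.
  by move=> /andP[t0 tT]; apply: df; rewrite !ltW.
have [//|[c _]] := @derive1_MVT f (fun=> 0) T T0 cf df'.
by rewrite mul0r => /eqP; rewrite subr_eq0 => /eqP.
Qed.

(** Continuous induction: at the infimum of the points where P is not positive, the
third hypothesis would make P positive. *)
Lemma continuation_gt0 (P : R -> R) (T : R) : 0 < P 0 ->
  (forall t, 0 <= t <= T -> {for t, continuous P}) ->
  (forall t, 0 < t <= T -> (forall s, 0 <= s < t -> 0 < P s) -> 0 < P t) ->
  forall t, 0 <= t <= T -> 0 < P t.
Proof.
move=> P0 cP step t1 /andP[t10 t1T]; rewrite ltNge; apply/negP => Pt1.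
pose A := [set s | [/\ 0 <= s, s <= T & P s <= 0]].
have At1 : A t1 by [].
have hA : has_inf A by split; [exists t1|exists 0 => s []].
pose ts := inf A.
have ts0 : 0 <= ts by apply: lb_le_inf; [exists t1|move=> s []].
have tst1 : ts <= t1 by apply: ge_inf => //; exact: hA.2.
have tsT : ts <= T by exact: le_trans t1T.
have below s : 0 <= s < ts -> 0 < P s.
  move=> /andP[s0 sts]; rewrite ltNge; apply/negP => Ps.
  have /(ge_inf hA.2) : A s by split=> //; rewrite ltW// (lt_le_trans sts).
  by rewrite leNgt sts.
have Pts : 0 < P ts.
  have [<-//|tsn0] := eqVneq 0 ts.
  by apply: step => //; rewrite lt_neqAle tsn0 ts0.
have c := cP ts; rewrite ts0 tsT in c; have {}c := c isT.
have : \forall s \near ts, 0 < P s by exact: (cvgr_gt (P ts) c).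
move=> /nbhs_ballP[r r0 H].
have [s As sr] := inf_adherent r0 hA.
have tss : ts <= s by apply: ge_inf => //; exact: hA.2.
have : 0 < P s.
  apply: H; rewrite -ball_normE /= ler0_norm ?subr_le0//.
  by rewrite opprB ltrBlDl.
by case: As => _ _; rewrite leNgt => /negP.
Qed.

(** The product of y and exp (- C t) is nonincreasing. *)
Lemma gronwall (y dy : R -> R) (C T : R) : 0 <= T ->
  (forall t, 0 <= t <= T -> is_derive (t : R) (1 : R) y (dy t)) ->
  (forall t, 0 <= t <= T -> dy t <= C * y t) ->
  y T <= expR (C * T) * y 0.
Proof.
move=> T0 dyP dyC.
pose g t := expR (- C * t) * y t.
have dg t : 0 <= t <= T ->
    is_derive (t : R) (1 : R) g (expR (- C * t) * (dy t - C * y t)).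
  move=> tT; have de : is_derive (t : R) (1 : R) (fun s => expR (- C * s)) (- C * expR (- C * t)).
    have d1 : is_derive (t : R) (1 : R) (fun s : R => - C * s) (- C).
      by have := is_deriveZ (- C) (is_derive_id t (1 : R)); rewrite /GRing.scale /= mulr1.
    have := is_derive1_comp (is_derive_expR (- C * t)) d1.
    by move=> H; apply: is_derive_eq H _; rewrite mulrC.
  have := is_derive1M de (dyP t tT).
  by move=> H; apply: is_derive_eq H _; ring.
have : g T <= g 0.
  have cg t : 0 <= t <= T -> {for t, continuous g}.
    by move=> /dg; exact: is_derive1_continuous.
  have dg' t : 0 < t < T -> is_derive (t : R) (1 : R) g (expR (- C * t) * (dy t - C * y t)).
    by move=> /andP[t0 tT]; apply: dg; rewrite !ltW.
  have [->//|[c c0 E]] := derive1_MVT T0 cg dg'.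
  rewrite -subr_le0 E; rewrite mulr_le0_ge0// mulr_ge0_le0 ?expR_ge0// subr_le0.
  by apply: dyC; case/andP: c0 => *; rewrite !ltW.
rewrite /g mulr0 expR0 mul1r mulNr expRN.
by rewrite mulrC ler_pdivrMr ?expR_gt0// mulrC.
Qed.

End OneVariable.

(** * Partial derivatives and the conformal factor *)

Section VectorCalculus.
Context {R : realType} {V : normedModType R} {d : nat}.
Implicit Types (U : set V) (f g : V -> 'rV[R]_d) (v : V).

Definition smooth U k f := forall c, Ck U k (fun y => f y 0 c).

(** It is the value at v of the Frechet derivative wherever the latter exists, but
it can be computed one coordinate at a time. *)
Definition pd v f (x : V) : 'rV[R]_d := \row_c 'D_v (fun y => f y 0 c) x.

Lemma derive_eq_on U (f g : V -> R) v x : open U -> U x ->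
  (forall y, U y -> f y = g y) -> 'D_v f x = 'D_v g x.
Proof.
move=> oU Ux fg.
have [->|v0] := eqVneq v 0; first by rewrite !derive0.
apply: near_eq_derive => //.
by apply: filterS (open_nbhs_nbhs (conj oU Ux)) => y; exact: fg.
Qed.

Lemma smoothS U k f : smooth U k.+1 f -> smooth U k f.
Proof. by move=> sf c; exact: CkS. Qed.

Lemma smooth_pd U k f v : smooth U k.+1 f -> smooth U k (pd v f).
Proof.
move=> sf c; have -> : (fun y => pd v f y 0 c) = (fun y => 'D_v (fun y => f y 0 c) y).
  by apply/funext => y; rewrite mxE.
exact: Ck_derive.
Qed.

Lemma pd_cst (a : 'rV[R]_d) v x : pd v (fun=> a) x = 0.
Proof. by apply/rowP => c; rewrite [LHS]mxE [RHS]mxE; exact: (derive_cst (a 0 c)).  Qed.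

Lemma pdC U f v w x : open U -> U x -> smooth U 2 f ->
  pd w (pd v f) x = pd v (pd w f) x.
Proof.
move=> oU Ux sf; apply/rowP => c; rewrite [LHS]mxE [RHS]mxE.
have E u : (fun y => pd u f y 0 c) = (fun y => 'D_u (fun y => f y 0 c) y).
  by apply/funext => y; rewrite mxE.
by rewrite !E; exact: (Ck2_schwarz v w oU (sf c) Ux).
Qed.

Lemma pd_eq_on U f g v x : open U -> U x -> (forall y, U y -> f y = g y) ->
  pd v f x = pd v g x.
Proof.
move=> oU Ux fg; apply/rowP => c; rewrite [LHS]mxE [RHS]mxE.
by apply: (derive_eq_on v oU Ux) => y /fg ->.
Qed.

Lemma Ck_dot U k f g : open U -> smooth U k f -> smooth U k g ->
  Ck U k (fun y => dot (f y) (g y)).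
Proof. by move=> oU sf sg; apply: Ck_sum => // i; exact: CkM. Qed.

Lemma is_derive_sumf (I : Type) (r : seq I) (F : I -> V -> R) (dF : I -> R) v x :
  (forall i, is_derive x v (F i) (dF i)) ->
  is_derive x v (fun y => \sum_(i <- r) F i y) (\sum_(i <- r) dF i).
Proof.
move=> H; elim: r => [|i r IH].
  rewrite big_nil; have -> : (fun y => \sum_(i <- [::]) F i y) = cst 0.
    by apply/funext => y; rewrite big_nil.
  exact: is_derive_cst.
rewrite big_cons; have -> : (fun y => \sum_(i <- i :: r) F i y)
    = (F i + (fun y => \sum_(i <- r) F i y)).
  by apply/funext => y; rewrite big_cons.
exact: is_deriveD.
Qed.

Definition vdifferentiable f x := forall c, differentiable (fun y => f y 0 c) x.

Lemma smooth_vdifferentiable U k f x : U x -> smooth U k.+1 f -> vdifferentiable f x.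
Proof. by move=> Ux sf c; exact: Ck_differentiable (sf c) Ux. Qed.

Lemma is_derive_dot f g v x : vdifferentiable f x -> vdifferentiable g x ->
  is_derive x v (fun y => dot (f y) (g y)) (dot (pd v f x) (g x) + dot (f x) (pd v g x)).
Proof.
move=> df dg.
have H : is_derive x v (fun y => dot (f y) (g y))
   (\sum_c (f x 0 c * 'D_v (fun y => g y 0 c) x + g x 0 c * 'D_v (fun y => f y 0 c) x)).
  by apply: is_derive_sumf => c; apply: is_deriveM; apply: derivableP; apply: diff_derivable;
    [exact: df|exact: dg].
apply: is_derive_eq H _; rewrite big_split /= addrC; congr (_ + _).
  by apply: eq_bigr => c _; rewrite mxE mulrC.
by apply: eq_bigr => c _; rewrite mxE.
Qed.

Lemma derive_dot U f g v x : U x -> smooth U 1 f -> smooth U 1 g ->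
  'D_v (fun y => dot (f y) (g y)) x = dot (pd v f x) (g x) + dot (f x) (pd v g x).
Proof.
move=> Ux sf sg; have H := is_derive_dot v (smooth_vdifferentiable Ux sf) (smooth_vdifferentiable Ux sg).
exact: (@derive_val _ _ _ _ _ _ _ H).
Qed.

Lemma differentiable_dot f g x : vdifferentiable f x -> vdifferentiable g x ->
  differentiable (fun y => dot (f y) (g y)) x.
Proof.
move=> df dg; have -> : (fun y => dot (f y) (g y)) =
    \sum_(c < d) ((fun y => f y 0 c) * (fun y => g y 0 c)).
  by apply/funext => y; rewrite fct_sumE.
by apply: differentiable_sum => c; apply: differentiableM; [exact: df|exact: dg].
Qed.

End VectorCalculus.

Section ConformalMaps.
Context {R : realType} {V : normedModType R} {d : nat}.
Variables (U : set V) (e : 'I_d -> V).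
Hypothesis oU : open U.
Hypothesis d_gt2 : (2 < d)%N.

(** The factor mu may vanish: the derivative in the directions e is a similarity or
zero. *)
Definition conformal_on (f : V -> 'rV[R]_d) (mu : V -> R) :=
  forall x, U x -> forall i j : 'I_d,
    dot (pd (e i) f x) (pd (e j) f x) = mu x * (i == j)%:R.

Variables (f : V -> 'rV[R]_d) (mu : V -> R).
Hypothesis f_smooth : smooth U 3 f.
Hypothesis f_conf : conformal_on f mu.

Let f1 i := pd (e i) f.
Let f2 i j := pd (e j) (f1 i).
Let f3 i j k := pd (e k) (f2 i j).

Let i0 : 'I_d := Ordinal (ltn_trans (isT : (0 < 2)%N) d_gt2).

Lemma conformal_factorE i x : U x -> mu x = dot (pd (e i) f x) (pd (e i) f x).
Proof. by move=> Ux; rewrite f_conf// eqxx mulr1. Qed.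

Lemma conformal_factor_ge0 x : U x -> 0 <= mu x.
Proof. by move=> Ux; rewrite (conformal_factorE i0 Ux) dotxx_ge0. Qed.

Lemma conformal_factor_Ck : Ck U 2 mu.
Proof.
apply: (@Ck_eq _ _ U 2 (fun x => dot (f1 i0 x) (f1 i0 x)) mu oU).
  by move=> x Ux; rewrite (conformal_factorE i0 Ux).
by apply: Ck_dot => //; exact: smooth_pd.
Qed.

Let s1 i : smooth U 2 (f1 i). Proof. exact: smooth_pd. Qed.
Let s2 i j : smooth U 1 (f2 i j). Proof. by apply: smooth_pd; exact: s1. Qed.

Let f2C i j x : U x -> f2 i j x = f2 j i x.
Proof. by move=> Ux; apply: (pdC _ _ oU Ux); exact: smoothS. Qed.

Let f3C i j k x : U x -> f3 i j k x = f3 j i k x.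
Proof. by move=> Ux; apply: (pd_eq_on _ oU Ux) => y; exact: f2C. Qed.

Let f3C' i j k x : U x -> f3 i j k x = f3 i k j x.
Proof. by move=> Ux; apply: (pdC _ _ oU Ux); exact: s1. Qed.

Let derive_mu v (a : R) x : U x -> 'D_v (fun y => mu y * a) x = 'D_v mu x * a.
Proof.
move=> Ux; have dm : derivable mu x v.
  by apply: diff_derivable; exact: Ck_differentiable conformal_factor_Ck Ux.
have H : is_derive x v (fun y => mu y * a) ('D_v mu x * a).
  have := is_deriveM (derivableP dm) (is_derive_cst a x v).
  by move=> H; apply: is_derive_eq H _; rewrite scaler0 add0r /GRing.scale /= mulrC.
by rewrite (@derive_val _ _ _ _ _ _ _ H).
Qed.

Let J2 x i j k : U x ->
  dot (f2 i k x) (f1 j x) + dot (f1 i x) (f2 j k x) = 'D_(e k) mu x * (i == j)%:R.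
Proof.
move=> Ux; rewrite -(derive_dot (e k) Ux (smoothS (@s1 i)) (smoothS (@s1 j))).
rewrite -derive_mu//; apply: (derive_eq_on (e k) oU Ux) => y Uy; exact: f_conf.
Qed.

Let J3 x i j k l : U x ->
  dot (f3 i k l x) (f1 j x) + dot (f2 i k x) (f2 j l x)
  + (dot (f2 i l x) (f2 j k x) + dot (f1 i x) (f3 j k l x))
  = 'D_(e l) (fun y => 'D_(e k) mu y) x * (i == j)%:R.
Proof.
move=> Ux.
rewrite -(derive_dot (e l) Ux (@s2 i k) (smoothS (@s1 j))).
rewrite -(derive_dot (e l) Ux (smoothS (@s1 i)) (@s2 j k)).
have c1 : Ck U 1 (fun y => dot (f2 i k y) (f1 j y)) by apply: Ck_dot => //; exact: smoothS.
have c2 : Ck U 1 (fun y => dot (f1 i y) (f2 j k y)) by apply: Ck_dot => //; exact: smoothS.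
rewrite -deriveD; [|apply: diff_derivable; exact: Ck_differentiable c1 Ux
                    |apply: diff_derivable; exact: Ck_differentiable c2 Ux].
transitivity ('D_(e l) (fun y => 'D_(e k) mu y * (i == j)%:R) x).
  by apply: (derive_eq_on (e l) oU Ux) => y Uy; exact: J2.
have dm : derivable (fun y => 'D_(e k) mu y) x (e l).
  apply: diff_derivable.
  exact: Ck_differentiable (Ck_derive (e k) conformal_factor_Ck) Ux.
have H : is_derive x (e l) (fun y => 'D_(e k) mu y * (i == j)%:R)
     ('D_(e l) (fun y => 'D_(e k) mu y) x * (i == j)%:R).
  have := is_deriveM (derivableP dm) (is_derive_cst ((i == j)%:R : R) x (e l)).
  by move=> H; apply: is_derive_eq H _; rewrite scaler0 add0r /GRing.scale /= mulrC.
by rewrite (@derive_val _ _ _ _ _ _ _ H).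
Qed.

Definition grad_sqr x := \sum_k 'D_(e k) mu x ^+ 2.

Let grad_sqrE x : grad_sqr x = dot (\row_k 'D_(e k) mu x) (\row_k 'D_(e k) mu x).
Proof. by apply: eq_bigr => k _; rewrite !mxE expr2. Qed.

Lemma conformal_hess x b c : U x -> mu x != 0 ->
  4 * mu x * 'D_(e c) (fun y => 'D_(e b) mu y) x =
  6 * 'D_(e b) mu x * 'D_(e c) mu x - (b == c)%:R * grad_sqr x.
Proof.
move=> Ux mu0; rewrite grad_sqrE.
exact: (@conformal_factor_hess R d d_gt2 (fun i => f1 i x) (fun i j => f2 i j x)
  (fun i j k => f3 i j k x) (mu x) (fun k => 'D_(e k) mu x)
  (fun k l => 'D_(e l) (fun y => 'D_(e k) mu y) x) mu0
  (fun i j => f2C i j Ux) (fun i j k => f3C i j k Ux) (fun i j k => f3C' i j k Ux)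
  (f_conf Ux) (fun i j k => J2 i j k Ux) (fun i j k l => J3 i j k l Ux)).
Qed.

Lemma conformal_second_derivative x i : U x -> mu x != 0 ->
  4 * mu x * dot (pd (e i) (pd (e i) f) x) (pd (e i) (pd (e i) f) x) = grad_sqr x.
Proof.
move=> Ux mu0; rewrite grad_sqrE.
exact: (@conformal_f2_norm R d (fun i => f1 i x) (fun i j => f2 i j x)
  (mu x) (fun k => 'D_(e k) mu x) mu0
  (fun i j => f2C i j Ux) (f_conf Ux) (fun i j k => J2 i j k Ux)).
Qed.

End ConformalMaps.

(** * The conformal factor along a gradient ray *)

Section RayODE.
Context {R : realType}.

(** Along a ray that starts in the direction of the gradient, m is the conformal
factor, p its derivative and n the square of the length of its gradient. The last
two hypotheses are the Hessian equation. It makes m p / n affine with slope - 1 / 4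
and m ^ 2 / n equal to the square of m p / n. At the time T both would vanish,
whereas m ^ 2 / n stays positive. *)
Lemma ray_blow_up (T : R) (m n p dp dn : R -> R) :
  0 < m 0 -> 0 < p 0 -> n 0 = p 0 ^+ 2 -> T = 4 * m 0 / p 0 ->
  (forall t, 0 <= t <= T -> is_derive (t : R) (1 : R) m (p t)) ->
  (forall t, 0 <= t <= T -> is_derive (t : R) (1 : R) p (dp t)) ->
  (forall t, 0 <= t <= T -> is_derive (t : R) (1 : R) n (dn t)) ->
  (forall t, 0 <= t <= T -> 0 <= m t) ->
  (forall t, 0 <= t <= T -> 0 <= n t) ->
  (forall t, 0 <= t <= T -> m t != 0 -> 4 * m t * dp t = 6 * p t ^+ 2 - n t) ->
  (forall t, 0 <= t <= T -> m t != 0 -> 2 * m t * dn t = 5 * n t * p t) ->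
  False.
Proof.
move=> m0 p0 n0p TE dm dP dnP mge nge dpE dnE.
have n0 : 0 < n 0 by rewrite n0p exprn_gt0.
have T0 : 0 < T by rewrite TE !mulr_gt0 ?invr_gt0.
have mn_gt0 t : 0 <= t <= T -> 0 < m t * n t -> 0 < m t /\ 0 < n t.
  move=> tT; have := mge _ tT; have := nge _ tT.
  rewrite !le_eqVlt => /orP[/eqP <-|?] /orP[/eqP <-|?]; rewrite ?mulr0 ?mul0r ?ltxx//.
(* These are the variables in which the differential equation is linear. *)
pose z t := m t * p t * (n t)^-1.
pose v t := m t * m t * (n t)^-1.
have dz t : 0 <= t <= T -> 0 < m t * n t -> is_derive (t : R) (1 : R) z (- 4^-1).
  move=> tT /(mn_gt0 t tT)[mt nt].
  have H := is_derive1M (is_derive1M (dm _ tT) (dP _ tT))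
     (is_derive1V (lt0r_neq0 nt) (dnP _ tT)).
  apply: is_derive_eq H _.
  have -> : dp t = (6 * p t ^+ 2 - n t) / (4 * m t).
    by rewrite -dpE ?gt_eqF//; field; rewrite gt_eqF.
  have -> : dn t = 5 * n t * p t / (2 * m t).
    by rewrite -dnE ?gt_eqF//; field; rewrite gt_eqF.
  by field; rewrite !gt_eqF.
have dv t : 0 <= t <= T -> 0 < m t * n t ->
    is_derive (t : R) (1 : R) v (- (z t / 2)).
  move=> tT /(mn_gt0 t tT)[mt nt].
  have H := is_derive1M (is_derive1M (dm _ tT) (dm _ tT))
     (is_derive1V (lt0r_neq0 nt) (dnP _ tT)).
  apply: is_derive_eq H _.
  have -> : dn t = 5 * n t * p t / (2 * m t).
    by rewrite -dnE ?gt_eqF//; field; rewrite gt_eqF.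
  by rewrite /z; field; rewrite !gt_eqF.
have did t : is_derive (t : R) (1 : R) (fun s : R => s * 4^-1) (4^-1).
  have := is_derive1M (is_derive_id (t : R) (1 : R)) (is_derive_cst (4^-1 : R) (t : R) (1 : R)).
  by move=> H; apply: is_derive_eq H _; rewrite mul1r mulr0 addr0.
have z0E : z 0 = T / 4 by rewrite /z TE n0p; field; rewrite !gt_eqF.
have zE t : 0 <= t <= T -> (forall s, 0 <= s <= t -> 0 < m s * n s) -> z t = (T - t) / 4.
  move=> /andP[t0 tT] pos.
  have : z t + t * 4^-1 = z 0 + 0 * 4^-1.
    apply: (derive1_const (f := fun s => z s + s * 4^-1) t0) => s /andP[s0 st].
    have H := is_derive1D (dz s _ _) (did s).
    apply: is_derive_eq (H _ _) _; [|by apply: pos; rewrite s0 st|by rewrite addNr].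
    by rewrite s0 (le_trans st).
  by rewrite z0E mul0r addr0; lra.
have p_ge0 t : 0 <= t <= T -> (forall s, 0 <= s <= t -> 0 < m s * n s) -> 0 <= p t.
  move=> tT pos.
  have [mt nt] : 0 < m t /\ 0 < n t.
    by apply: mn_gt0 => //; apply: pos; case/andP: tT => -> _ /=.
  have : 0 <= z t by rewrite zE// divr_ge0// subr_ge0; case/andP: tT.
  by rewrite /z pmulr_lge0 ?invr_gt0// pmulr_rge0.
(* As long as m n > 0, one has p >= 0, hence m and n increase and cannot reach 0. *)
have pos t : 0 <= t <= T -> 0 < m t * n t.
  move: t; apply: continuation_gt0; first exact: mulr_gt0.
    move=> t tT; exact: is_derive1_continuous (is_derive1M (dm _ tT) (dnP _ tT)).
  move=> t /andP[t0 tT] pos.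
  have sub s : 0 <= s <= t -> 0 <= s <= T.
    by move=> /andP[-> st]; exact: le_trans tT.
  have tt : 0 <= t <= t by rewrite lexx ltW.
  have le0 s : 0 < s < t -> 0 <= p s.
    move=> /andP[s0 st]; apply: p_ge0; first by apply: sub; rewrite !ltW.
    by move=> r /andP[r0 rs]; apply: pos; rewrite r0 (le_lt_trans rs).
  have mt : m 0 <= m t.
    have [||->//|[c ct E]] := @derive1_MVT R m p t (ltW t0).
    - by move=> s /sub/dm; exact: is_derive1_continuous.
    - by move=> s /andP[s0 st]; apply: dm; apply: sub; rewrite !ltW.
    by rewrite -subr_ge0 E mulr_ge0 ?le0// ltW.
  have nt : n 0 <= n t.
    have [||->//|[c ct E]] := @derive1_MVT R n dn t (ltW t0).
    - by move=> s /sub/dnP; exact: is_derive1_continuous.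
    - by move=> s /andP[s0 st]; apply: dnP; apply: sub; rewrite !ltW.
    rewrite -subr_ge0 E mulr_ge0 ?(ltW t0)//.
    have cT : 0 <= c <= T by case/andP: ct => c0 cT; apply: sub; rewrite !ltW.
    have [mc nc] : 0 < m c /\ 0 < n c.
      by apply: mn_gt0 => //; apply: pos; case/andP: ct => c0 ->; rewrite ltW.
    have : 0 <= 2 * m c * dn c.
      by rewrite dnE// ?gt_eqF// mulr_ge0 ?le0// mulr_ge0// ltW.
    by rewrite pmulr_rge0// mulr_gt0.
  by rewrite mulr_gt0// (lt_le_trans _ mt, lt_le_trans _ nt).
have TT : 0 <= T <= T by rewrite lexx ltW.
have posT s : 0 <= s <= T -> forall r, 0 <= r <= s -> 0 < m r * n r.
  by move=> /andP[s0 sT] r /andP[r0 rs]; apply: pos; rewrite r0 (le_trans rs).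
have vz : v T - z T * z T = v 0 - z 0 * z 0.
  apply: (derive1_const (f := fun s => v s - z s * z s) (ltW T0)) => s sT.
  have pz := pos s sT.
  have H := is_deriveB (dv s sT pz) (is_derive1M (dz s sT pz) (dz s sT pz)).
  by apply: is_derive_eq H _; field.
have zT : z T = 0 by rewrite zE// ?subrr ?mul0r//; exact: posT.
have v0 : v 0 - z 0 * z 0 = 0.
  by rewrite z0E /v TE n0p; field; rewrite !gt_eqF.
have : 0 < v T.
  have [mT nT] := mn_gt0 T TT (pos T TT).
  by rewrite /v !mulr_gt0// invr_gt0.
by move: vz; rewrite zT mulr0 subr0 v0 => ->; rewrite ltxx.
Qed.

End RayODE.

(** * Slices and the gradient bound *)

Section Slices.
Context {R : realType} {V : normedModType R} {d : nat}.
Variables (U : set V) (e : 'I_d -> V).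
Hypothesis oU : open U.
Hypothesis d_gt2 : (2 < d)%N.

Definition slice_vec (y : 'rV[R]_d) : V := \sum_i y 0 i *: e i.

Lemma slice_vecZ a y : slice_vec (a *: y) = a *: slice_vec y.
Proof. by rewrite /slice_vec scaler_sumr; apply: eq_bigr => i _; rewrite mxE scalerA. Qed.

Lemma slice_vecD y z : slice_vec (y + z) = slice_vec y + slice_vec z.
Proof. by rewrite /slice_vec -big_split; apply: eq_bigr => i _; rewrite mxE scalerDl. Qed.

Lemma slice_vec0 : slice_vec 0 = 0.
Proof. by rewrite -(scale0r 0) slice_vecZ scale0r. Qed.

Lemma slice_vec_delta i : slice_vec (delta_mx 0 i) = e i.
Proof.
rewrite /slice_vec (bigD1 i)//= mxE !eqxx scale1r big1 ?addr0// => j /negbTE ji.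
by rewrite mxE ji andbF scale0r.
Qed.

Lemma derive_slice_vec (g : V -> R) x y : differentiable g x ->
  'D_(slice_vec y) g x = \sum_i y 0 i * 'D_(e i) g x.
Proof.
move=> dg; apply: etrans (deriveE _ dg) _; rewrite linear_sum.
apply: eq_bigr => i _; rewrite linearZ /=; congr (_ * _).
exact: esym (deriveE _ dg).
Qed.

Definition slice_ball x (r : R) := forall y, dot y y < r ^+ 2 -> U (x + slice_vec y).

Variables (f : V -> 'rV[R]_d) (mu : V -> R).
Hypothesis f_smooth : smooth U 3 f.
Hypothesis f_conf : conformal_on U e f mu.

Local Notation grad_sqr := (grad_sqr e mu).

Let muC2 : Ck U 2 mu := conformal_factor_Ck oU d_gt2 f_smooth f_conf.
Let dmu x : U x -> differentiable mu x := fun Ux => Ck_differentiable muC2 Ux.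
Let ddmu k x : U x -> differentiable (fun y => 'D_(e k) mu y) x :=
  fun Ux => Ck_differentiable (Ck_derive (e k) muC2) Ux.
Let mu_ge0 x : U x -> 0 <= mu x := @conformal_factor_ge0 _ _ _ U e d_gt2 f mu f_conf x.

Let ray_in x r (u : 'rV[R]_d) t : slice_ball x r -> dot u u = 1 -> 0 < r ->
  0 <= t < r -> U (x + t *: slice_vec u).
Proof.
move=> xr u1 r0 /andP[t0 tr]; rewrite -slice_vecZ; apply: xr.
by rewrite dotZl dotZr u1 mulr1 -expr2 ltr_pXn2r// ?nnegrE// ltW.
Qed.

(** Otherwise the ray from x in the direction of the gradient stays in U up to the
time 4 mu / |grad mu|, which ray_blow_up excludes. *)
Lemma grad_sqr_noncritical x r : 0 < r -> slice_ball x r -> mu x != 0 ->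
  r ^+ 2 * grad_sqr x <= 16 * mu x ^+ 2.
Proof.
move=> r0 xr mux; rewrite leNgt; apply/negP => H.
have Ux : U x.
  by have := xr 0; rewrite dot0l slice_vec0 addr0; apply; rewrite exprn_gt0.
have mu0 : 0 < mu x by rewrite lt_neqAle eq_sym mux mu_ge0.
have N0 : 0 < grad_sqr x.
  have : 0 < r ^+ 2 * grad_sqr x by apply: le_lt_trans H; rewrite mulr_ge0// sqr_ge0.
  by rewrite pmulr_rgt0// exprn_gt0.
pose s := Num.sqrt (grad_sqr x).
have s0 : 0 < s by rewrite sqrtr_gt0.
have ss : s ^+ 2 = grad_sqr x by rewrite sqr_sqrtr// ltW.
pose u : 'rV[R]_d := \row_k ('D_(e k) mu x / s).
have u1 : dot u u = 1.
  have -> : dot u u = s ^- 2 * grad_sqr x.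
    rewrite mulr_sumr; apply: eq_bigr => k _; rewrite mxE.
    by field; rewrite gt_eqF.
  by rewrite -ss mulVf// gt_eqF// exprn_gt0.
pose T := 4 * mu x / s.
have T0 : 0 < T by rewrite !mulr_gt0// invr_gt0.
have Tr : T < r.
  rewrite -(ltr_pXn2r (n := 2))// ?nnegrE ?ltW// /T expr_div_n ss.
  rewrite ltr_pdivrMr// (le_lt_trans _ H)// exprMn; lra.
pose w := slice_vec u.
have Ug t : 0 <= t <= T -> U (x + t *: w).
  by move=> /andP[t0 tT]; apply: (ray_in xr) => //; rewrite t0 (le_lt_trans tT).
pose m t := mu (x + t *: w).
pose a k t := 'D_(e k) mu (x + t *: w).
pose p t := \sum_k u 0 k * a k t.
pose n t := grad_sqr (x + t *: w).
pose b k t := 'D_w (fun y => 'D_(e k) mu y) (x + t *: w).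
pose dp t := \sum_k u 0 k * b k t.
pose dn t := \sum_k (b k t * a k t + a k t * b k t).
have da k t : 0 <= t <= T -> is_derive (t : R) (1 : R) (a k) (b k t).
  by move=> /Ug Ut; apply: is_derive_line; exact: ddmu.
have bE k t : 0 <= t <= T -> m t != 0 ->
    4 * m t * b k t = 6 * a k t * p t - u 0 k * n t.
  move=> tT mt; have Ut := Ug t tT.
  rewrite /b derive_slice_vec; last exact: ddmu.
  rewrite mulr_sumr (eq_bigr (fun c => 6 * a k t * (u 0 c * a c t)
     - (k == c)%:R * (u 0 c * n t))).
    rewrite sumrB -mulr_sumr; congr (_ - _).
    rewrite (bigD1 k)//= eqxx mul1r big1 ?addr0// => c /negbTE ck.
    by rewrite eq_sym ck mul0r.
  move=> c _; rewrite mulrCA (conformal_hess oU d_gt2 f_smooth f_conf k c Ut mt).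
  by rewrite /a /n; ring.
have dM t : 0 <= t <= T -> is_derive (t : R) (1 : R) m (p t).
  move=> /Ug Ut; have := is_derive_line (dmu Ut).
  by rewrite derive_slice_vec//; exact: dmu.
have dP t : 0 <= t <= T -> is_derive (t : R) (1 : R) p (dp t).
  move=> tT; apply: is_derive_sumf => k.
  have := is_derive1M (is_derive_cst (u 0 k : R) (t : R) (1 : R)) (da k t tT).
  by move=> D; apply: is_derive_eq D _; rewrite mul0r add0r.
have dN t : 0 <= t <= T -> is_derive (t : R) (1 : R) n (dn t).
  move=> tT; have -> : n = (fun t => \sum_k a k t * a k t).
    by apply/funext => q; apply: eq_bigr => k _; rewrite expr2.
  by apply: is_derive_sumf => k; apply: is_derive1M; exact: da.
apply: (@ray_blow_up R T m n p dp dn) => //.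
- by rewrite /m scale0r addr0.
- rewrite /p (eq_bigr (fun k => s^-1 * 'D_(e k) mu x ^+ 2)).
    by rewrite -mulr_sumr mulr_gt0// invr_gt0.
  by move=> k _; rewrite /a scale0r addr0 mxE expr2 mulrCA mulrA.
- rewrite /n scale0r addr0 -ss; congr (_ ^+ 2).
  rewrite /p (eq_bigr (fun k => s^-1 * 'D_(e k) mu x ^+ 2)).
    by rewrite -mulr_sumr -[\sum_k _]ss expr2 mulrA mulVf ?mul1r// gt_eqF.
  by move=> k _; rewrite /a scale0r addr0 mxE expr2 mulrCA mulrA.
- rewrite /m scale0r addr0 /T; congr (_ / _).
  rewrite /p (eq_bigr (fun k => s^-1 * 'D_(e k) mu x ^+ 2)).
    by rewrite -mulr_sumr -[\sum_k _]ss expr2 mulrA mulVf ?mul1r// gt_eqF.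
  by move=> k _; rewrite /a scale0r addr0 mxE expr2 mulrCA mulrA.
- by move=> t /Ug/mu_ge0.
- by move=> t _; apply: sumr_ge0 => k _; exact: sqr_ge0.
- move=> t tT mt; rewrite /dp mulr_sumr.
  rewrite (eq_bigr (fun k => 6 * p t * (u 0 k * a k t) - n t * (u 0 k * u 0 k))).
    by rewrite sumrB -!mulr_sumr -/(p t) -/(dot u u) u1; ring.
  by move=> k _; rewrite mulrCA bE//; ring.
- move=> t tT mt; rewrite /dn mulr_sumr.
  rewrite (eq_bigr (fun k => 6 * p t * a k t ^+ 2 - n t * (u 0 k * a k t))).
    have nE : \sum_k a k t ^+ 2 = n t by [].
    by rewrite sumrB -!mulr_sumr nE -/(p t); ring.
  move=> k _; have : 4 * m t * b k t * a k t = (6 * a k t * p t - u 0 k * n t) * a k t.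
    by rewrite bE.
  by move=> B; transitivity (4 * m t * b k t * a k t); [ring|rewrite B; ring].
Qed.

End Slices.

(** * Inversion, nonvanishing maps and Harnack inequalities *)

Section LineGronwall.
Context {R : realType} {V : normedModType R}.

Lemma line_gronwall (y : V -> R) (x v : V) (C : R) :
  (forall t, 0 <= t <= 1 -> differentiable y (x + t *: v)) ->
  (forall t, 0 <= t <= 1 -> 'D_v y (x + t *: v) <= C * y (x + t *: v)) ->
  y (x + v) <= expR C * y x.
Proof.
move=> dy Dy.
have := @gronwall R (fun t => y (x + t *: v)) (fun t => 'D_v y (x + t *: v)) C 1 ler01
  (fun t t01 => is_derive_line (dy t t01)) Dy.
by rewrite scale1r scale0r addr0 mulr1.
Qed.

End LineGronwall.

Section Inversion.
Context {R : realType} {d : nat}.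

(** The inversion in the unit sphere, with 0 sent to 0. *)
Definition sphere_inv (w : 'rV[R]_d) : 'rV[R]_d := (dot w w)^-1 *: w.

Lemma sphere_inv_norm w : dot (sphere_inv w) (sphere_inv w) = (dot w w)^-1.
Proof.
rewrite /sphere_inv dotZl dotZr; have [->|/dotxx_gt0 w0] := eqVneq w 0.
  by rewrite dot0l invr0 !mul0r.
by field; rewrite gt_eqF.
Qed.

Lemma sphere_invK w : sphere_inv (sphere_inv w) = w.
Proof.
rewrite {1}/sphere_inv sphere_inv_norm invrK /sphere_inv scalerA.
have [->|/dotxx_gt0 w0] := eqVneq w 0; first by rewrite scaler0.
by rewrite mulfV ?scale1r// gt_eqF.
Qed.

Lemma sphere_inv_neq0 w : w != 0 -> sphere_inv w != 0.
Proof.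
by move=> w0; rewrite scaler_eq0 negb_or w0 andbT invr_neq0// gt_eqF// dotxx_gt0.
Qed.

(** The differential of the inversion at w: a reflection divided by |w| ^ 2. *)
Definition dsphere_inv (w v : 'rV[R]_d) : 'rV[R]_d :=
  (dot w w)^-1 *: v - ((dot w w) ^- 2 * (2 * dot v w)) *: w.

Lemma dsphere_inv_dot (w v v' : 'rV[R]_d) : w != 0 ->
  dot (dsphere_inv w v) (dsphere_inv w v') = (dot w w) ^- 2 * dot v v'.
Proof.
move=> /dotxx_gt0 w0; rewrite /dsphere_inv.
rewrite !(dotBl, dotBr, dotZl, dotZr) (dotC w v').
by field; rewrite gt_eqF.
Qed.

End Inversion.

Section InversionCalculus.
Context {R : realType} {V : normedModType R} {d : nat}.
Implicit Types g : V -> 'rV[R]_d.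

Let sphere_inv_coord g c : (fun y => (sphere_inv \o g) y 0 c) =
  (fun y => (dot (g y) (g y))^-1 * g y 0 c).
Proof. by apply/funext => y; rewrite /sphere_inv /= mxE. Qed.

Lemma vdifferentiable_sphere_inv g x : g x != 0 -> vdifferentiable g x ->
  vdifferentiable (sphere_inv \o g) x.
Proof.
move=> /dotxx_gt0 gx dg c; rewrite sphere_inv_coord.
apply: (@differentiableM _ _ (fun y => (dot (g y) (g y))^-1) (fun y => g y 0 c)); last exact: dg.
apply: (@differentiableV _ _ (fun y => dot (g y) (g y))); first exact: differentiable_dot.
by rewrite gt_eqF.
Qed.

Lemma pd_sphere_inv g x v : g x != 0 -> vdifferentiable g x ->
  pd v (sphere_inv \o g) x = dsphere_inv (g x) (pd v g x).
Proof.
move=> /dotxx_gt0 gx dg; pose q y := dot (g y) (g y).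
have q0 : q x != 0 by rewrite gt_eqF.
apply/rowP => c; rewrite [LHS]mxE sphere_inv_coord.
have dqE : is_derive x v q (dot (pd v g x) (g x) + dot (g x) (pd v g x)).
  exact: is_derive_dot.
have dq : derivable q x v by case: dqE.
have dgc : derivable (fun y => g y 0 c) x v by apply: diff_derivable; exact: dg.
have dV := derivableV q0 dq.
have H := is_deriveM (derivableP dV) (derivableP dgc).
rewrite (@derive_val _ _ _ _ _ _ _ H) (deriveV q0 dq).
rewrite (@derive_val _ _ _ _ _ _ _ dqE) (dotC (g x)) !mxE /GRing.scale /=.
by rewrite /q; ring.
Qed.

Variables (U : set V) (g : V -> 'rV[R]_d).
Hypothesis oU : open U.
Hypothesis g_neq0 : forall x, U x -> g x != 0.

Lemma smooth_sphere_inv k : smooth U k g -> smooth U k (sphere_inv \o g).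
Proof.
move=> sg c; rewrite sphere_inv_coord.
apply: CkM => //; apply: CkV => //; last exact: Ck_dot.
by move=> x /g_neq0/dotxx_gt0 ?; rewrite gt_eqF.
Qed.

Lemma conformal_sphere_inv (e : 'I_d -> V) mu : smooth U 1 g -> conformal_on U e g mu ->
  conformal_on U e (sphere_inv \o g) (fun x => (dot (g x) (g x)) ^- 2 * mu x).
Proof.
move=> sg cg x Ux i j; have dg := smooth_vdifferentiable Ux sg.
by rewrite !pd_sphere_inv ?g_neq0// dsphere_inv_dot ?g_neq0// cg// mulrA.
Qed.

End InversionCalculus.

Section ConformalEstimates.
Context {R : realType} {V : normedModType R} {d : nat}.
Variables (U : set V) (e : 'I_d -> V).
Hypothesis oU : open U.
Hypothesis d_gt2 : (2 < d)%N.

Let i0 : 'I_d := Ordinal (ltn_trans (isT : (0 < 2)%N) d_gt2).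
Local Notation slice_vec := (slice_vec e).
Local Notation slice_ball := (slice_ball U e).

Lemma slice_ball_center x r : 0 < r -> slice_ball x r -> U x.
Proof.
by move=> r0 xr; have := xr 0; rewrite dot0l slice_vec0 addr0; apply; rewrite exprn_gt0.
Qed.

Lemma slice_ball_shift x r y : slice_ball x r -> dot y y <= (r / 2) ^+ 2 ->
  slice_ball (x + slice_vec y) (r / 2).
Proof.
move=> xr yr z zr; rewrite -addrA -slice_vecD; apply: xr.
have := dotxx_ge0 (y - z).
rewrite !(dotBl, dotBr, dotDl, dotDr) (dotC z y).
by move: yr zr; rewrite !exprMn; lra.
Qed.

Lemma pd_slice_vec (f : V -> 'rV[R]_d) x u : U x -> smooth U 1 f ->
  pd (slice_vec u) f x = \sum_k u 0 k *: pd (e k) f x.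
Proof.
move=> Ux sf; apply/rowP => c; rewrite summxE [LHS]mxE derive_slice_vec.
  by apply: eq_bigr => k _; rewrite !mxE.
exact: Ck_differentiable (sf c) Ux.
Qed.

Lemma pd_slice_vec_norm (f : V -> 'rV[R]_d) mu x u : U x -> smooth U 1 f ->
  conformal_on U e f mu ->
  dot (pd (slice_vec u) f x) (pd (slice_vec u) f x) = mu x * dot u u.
Proof.
move=> Ux sf cf; rewrite pd_slice_vec// dot_suml mulr_sumr; apply: eq_bigr => k _.
rewrite dotZl dotC dot_suml (bigD1 k)//= big1 ?addr0.
  by rewrite dotZl cf// eqxx mulr1; ring.
by move=> j /negbTE jk; rewrite dotZl cf// jk !mulr0.
Qed.

Section OneMap.
Variables (f : V -> 'rV[R]_d) (mu : V -> R).
Hypothesis f_smooth : smooth U 3 f.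
Hypothesis f_conf : conformal_on U e f mu.

Let muC2 : Ck U 2 mu := conformal_factor_Ck oU d_gt2 f_smooth f_conf.
Let dmu x : U x -> differentiable mu x := fun Ux => Ck_differentiable muC2 Ux.
Let mu_ge0 x : U x -> 0 <= mu x := @conformal_factor_ge0 _ _ _ U e d_gt2 f mu f_conf x.
Let s1 : smooth U 1 f := smoothS (smoothS f_smooth).

Lemma pd_critical x i : U x -> mu x = 0 -> pd (e i) f x = 0.
Proof. by move=> Ux mu0; apply: dotxx_eq0; rewrite f_conf// mu0 mul0r. Qed.

(** At a critical point the gradient vanishes, since mu is a sum of squares of
functions that vanish there. *)
Lemma grad_sqr_le x r : 0 < r -> slice_ball x r ->
  r ^+ 2 * grad_sqr e mu x <= 16 * mu x ^+ 2.
Proof.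
move=> r0 xr; have [mu0|mu0] := eqVneq (mu x) 0; last first.
  exact: (grad_sqr_noncritical oU d_gt2 f_smooth f_conf r0 xr mu0).
have Ux := slice_ball_center r0 xr.
rewrite /grad_sqr mu0 expr0n mulr0 big1 ?mulr0// => k _.
rewrite (@derive_eq_on _ _ U mu (fun y => dot (pd (e i0) f y) (pd (e i0) f y)) (e k) x oU Ux).
  rewrite (derive_dot (e k) Ux (smooth_pd (e i0) (smoothS f_smooth)) (smooth_pd (e i0) (smoothS f_smooth))).
  by rewrite pd_critical// dotC !dot0l addr0 expr0n.
by move=> y Uy; rewrite f_conf// eqxx mulr1.
Qed.

Lemma derive_factor_le x r u : 0 < r -> slice_ball x r -> dot u u <= 1 ->
  `|'D_(slice_vec u) mu x| <= 4 / r * mu x.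
Proof.
move=> r0 xr u1; have Ux := slice_ball_center r0 xr.
have C0 : 0 <= 4 / r * mu x by rewrite mulr_ge0 ?mu_ge0// divr_ge0// ltW.
rewrite -(ler_pXn2r (n := 2))// ?nnegrE//.
rewrite real_normK ?num_real// derive_slice_vec; last exact: dmu.
have := dot_sqr_le u (\row_k 'D_(e k) mu x).
have -> : dot u (\row_k 'D_(e k) mu x) = \sum_i u 0 i * 'D_(e i) mu x.
  by apply: eq_bigr => k _; rewrite mxE.
have -> : dot (\row_k 'D_(e k) mu x) (\row_k 'D_(e k) mu x) = grad_sqr e mu x.
  by apply: eq_bigr => k _; rewrite !mxE expr2.
move=> /le_trans; apply; rewrite exprMn expr_div_n.
rewrite [leRHS](_ : _ = (16 * mu x ^+ 2) / r ^+ 2); last by field; rewrite gt_eqF.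
rewrite ler_pdivlMr ?exprn_gt0// mulrC; apply: le_trans (grad_sqr_le r0 xr).
rewrite ler_wpM2l ?sqr_ge0// ler_piMl//.
by apply: sumr_ge0 => k _; exact: sqr_ge0.
Qed.

(** The logarithmic derivative of mu is bounded on the concentric ball of half the
radius. *)
Lemma factor_harnack x r u : 0 < r -> slice_ball x r -> dot u u <= (r / 2) ^+ 2 ->
  dot u u <= 1 -> mu (x + slice_vec u) <= expR (8 / r) * mu x.
Proof.
move=> r0 xr ur u1; have r20 : 0 < r / 2 by rewrite divr_gt0.
have sb t : 0 <= t <= 1 -> slice_ball (x + t *: slice_vec u) (r / 2).
  move=> /andP[t0 t1]; rewrite -slice_vecZ; apply: slice_ball_shift => //.
  rewrite dotZl dotZr (le_trans _ ur)// mulrA ler_piMl ?dotxx_ge0//.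
  by rewrite mulr_ile1.
apply: line_gronwall => t t01.
  by apply: dmu; exact: slice_ball_center (sb t t01).
apply: le_trans (ler_norm _) _.
apply: le_trans (derive_factor_le r20 (sb t t01) u1) _.
by rewrite le_eqVlt; apply/orP; left; apply/eqP; field; rewrite gt_eqF.
Qed.

(** By the Harnack inequality the points near a critical one, on the line through it,
are critical; so the first derivative vanishes on a piece of this line. *)
Lemma second_derivative_critical x r i : 0 < r -> slice_ball x r -> mu x = 0 ->
  pd (e i) (pd (e i) f) x = 0.
Proof.
move=> r0 xr mu0; have Ux := slice_ball_center r0 xr.
have near0 : \forall t \near (0 : R), pd (e i) f (x + t *: e i) = 0.
  apply/nbhs_ballP; exists (Num.min (r / 2) 1); first by rewrite /= lt_min divr_gt0/=.
  move=> t; rewrite -ball_normE /= sub0r normrN lt_min => /andP[tr t1].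
  have tE : t *: e i = slice_vec (t *: delta_mx 0 i) by rewrite slice_vecZ slice_vec_delta.
  have dE : dot (t *: delta_mx 0 i : 'rV[R]_d) (t *: delta_mx 0 i) = t ^+ 2.
    by rewrite dotZl dotZr dot_delta_delta eqxx mulr1 expr2.
  have tr2 : t ^+ 2 <= (r / 2) ^+ 2.
    by rewrite -(real_normK (num_real t)) ler_pXn2r// ?nnegrE ?divr_ge0 ?(ltW r0)// ltW.
  have t12 : t ^+ 2 <= 1.
    by rewrite -(real_normK (num_real t)) exprn_ile1// ltW.
  have Ut : U (x + t *: e i).
    rewrite tE; have r20 : 0 < r / 2 by rewrite divr_gt0.
    by apply: (slice_ball_center r20); apply: slice_ball_shift => //; rewrite dE.
  apply: pd_critical => //; apply/eqP; rewrite eq_le mu_ge0// andbT tE.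
  rewrite -[leRHS](mulr0 (expR (8 / r))) -mu0.
  by apply: factor_harnack => //; rewrite dE.
apply/rowP => c; rewrite [LHS]mxE [RHS]mxE.
set g := fun y => pd (e i) f y 0 c.
have dg : differentiable g x.
  exact: Ck_differentiable (smooth_pd (e i) f_smooth c) Ux.
have H : is_derive (0 : R) (1 : R) (fun s => g (x + s *: e i)) ('D_(e i) g x).
  rewrite -[X in 'D_(e i) g X](addr0 x) -(scale0r (e i)); apply: is_derive_line.
  by rewrite scale0r addr0.
have E : \forall s \near (0 : R), g (x + s *: e i) = cst 0 s.
  by apply: filterS near0 => s E; rewrite /g E mxE.
rewrite -(@derive_val _ _ _ _ _ _ _ H).
by rewrite (near_eq_derive _ E) ?oner_neq0// derive_cst.
Qed.

(** Only the pure second derivatives in the directions of the frame are bounded; this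
suffices for Landau's inequality. *)
Lemma second_derivative_le x r i : 0 < r -> slice_ball x r ->
  r ^+ 2 * dot (pd (e i) (pd (e i) f) x) (pd (e i) (pd (e i) f) x) <= 4 * mu x.
Proof.
move=> r0 xr; have Ux := slice_ball_center r0 xr.
have [mu0|mu0] := eqVneq (mu x) 0.
  by rewrite (second_derivative_critical i r0 xr mu0) dot0l mulr0 mu0 mulr0.
have m0 : 0 < mu x by rewrite lt_neqAle eq_sym mu0 mu_ge0.
have := grad_sqr_le r0 xr.
rewrite -(conformal_second_derivative oU d_gt2 f_smooth f_conf i Ux mu0).
set D := dot _ _ => H.
have : mu x * (r ^+ 2 * D) <= mu x * (4 * mu x) by move: H; lra.
by rewrite ler_pM2l.
Qed.

End OneMap.

Section Nonvanishing.
Variables (g : V -> 'rV[R]_d) (mu : V -> R).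
Hypothesis g_smooth : smooth U 3 g.
Hypothesis g_conf : conformal_on U e g mu.
Hypothesis g_neq0 : forall x, U x -> g x != 0.

Let q y := dot (g y) (g y).
Let s1 : smooth U 1 g := smoothS (smoothS g_smooth).
Let muC2 : Ck U 2 mu := conformal_factor_Ck oU d_gt2 g_smooth g_conf.

(** The inverted map has the factor muF = mu / |g| ^ 4. The gradients of mu and of muF
obey the same bound, and their combination is, up to a factor, the vector of the
<g_k, g>, whose square length is mu |g| ^ 2. *)
Lemma nonvanishing_factor_le x r : 0 < r -> slice_ball x r ->
  r ^+ 2 * mu x <= 4 * dot (g x) (g x).
Proof.
move=> r0 xr; have Ux := slice_ball_center r0 xr.
have [->|mu0] := eqVneq (mu x) 0; first by rewrite mulr0 mulr_ge0 ?dotxx_ge0.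
have m0 : 0 < mu x.
  by rewrite lt_neqAle eq_sym mu0 (conformal_factor_ge0 d_gt2 g_conf Ux).
have q0 : 0 < q x by exact/dotxx_gt0/g_neq0.
have F_smooth := smooth_sphere_inv oU g_neq0 g_smooth.
have F_conf := conformal_sphere_inv g_neq0 s1 g_conf.
have N1 := grad_sqr_le g_smooth g_conf r0 xr.
have N2 := grad_sqr_le F_smooth F_conf r0 xr.
set muF := fun y => _ in N2.
have {}N2 : r ^+ 2 * grad_sqr e muF x <= 16 * muF x ^+ 2 by exact: N2.
pose b k := dot (pd (e k) g x) (g x).
have dq : differentiable q x by exact: Ck_differentiable (Ck_dot oU s1 s1) Ux.
have dmu : differentiable mu x by exact: Ck_differentiable muC2 Ux.
have DqE k : 'D_(e k) q x = 2 * b k.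
  by rewrite (derive_dot (e k) Ux s1 s1) (dotC (g x)) /b; ring.
have DF k : 'D_(e k) muF x = (q x) ^- 2 * 'D_(e k) mu x - 4 * (q x) ^- 3 * mu x * b k.
  have dq2 : derivable (q ^+ 2) x (e k) by apply: derivableX; exact: diff_derivable.
  have q20 : (q ^+ 2) x != 0 by rewrite fctE expf_neq0// gt_eqF.
  have dV := derivableV q20 dq2.
  have H := is_deriveM (derivableP dV) (derivableP (diff_derivable (v := e k) dmu)).
  have -> : muF = (fun y => ((q ^+ 2) y)^-1) * mu by apply/funext => y; rewrite !fctE.
  rewrite (@derive_val _ _ _ _ _ _ _ H) (deriveV q20 dq2) deriveX; last exact: diff_derivable.
  by rewrite DqE !fctE /GRing.scale /=; field; rewrite gt_eqF.
have S : \sum_k b k ^+ 2 = mu x * q x.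
  rewrite -(dot_parseval mu0 (g_conf Ux)); apply: eq_bigr => k _.
  by rewrite /b dotC expr2.
(* The gradient of muF is a difference; (a - b)^2 <= 2 a^2 + 2 b^2 separates it. *)
have key : 16 * (q x) ^- 6 * mu x ^+ 2 * (mu x * q x)
    <= 2 * ((q x) ^- 4 * grad_sqr e mu x) + 2 * grad_sqr e muF x.
  rewrite -S !mulr_sumr -big_split; apply: ler_sum => k _ /=.
  have := sqr_ge0 ((q x) ^- 2 * 'D_(e k) mu x + 'D_(e k) muF x).
  rewrite -subr_ge0 => P; rewrite -subr_ge0; apply: le_trans P _.
  by rewrite le_eqVlt; apply/orP; left; apply/eqP; rewrite DF; field; rewrite gt_eqF.
have : r ^+ 2 * (16 * (q x) ^- 6 * mu x ^+ 2 * (mu x * q x)) <= 64 * (q x) ^- 4 * mu x ^+ 2.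
  apply: le_trans (ler_wpM2l (sqr_ge0 r) key) _.
  have q4 : 0 <= (q x) ^- 4 by rewrite invr_ge0 exprn_ge0// ltW.
  have := ler_wpM2l q4 N1 => H1.
  have -> : 64 * q x ^- 4 * mu x ^+ 2 = 2 * (q x ^- 4 * (16 * mu x ^+ 2)) + 2 * (16 * muF x ^+ 2).
    by rewrite /muF -/(q x); field; rewrite gt_eqF.
  move: H1 N2; rewrite mulrDr; move: (q x ^- 4) (grad_sqr _ _ x) (grad_sqr _ _ x) (muF x).
  by move=> Q G G1 M; lra.
have c0 : 0 < 16 * (q x) ^- 5 * mu x ^+ 2.
  by rewrite !mulr_gt0 ?invr_gt0 ?exprn_gt0.
move=> H; rewrite -(ler_pM2l c0); move: H; congr (_ <= _).
  by field; rewrite gt_eqF.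
by rewrite /q; field; rewrite gt_eqF.
Qed.

(** The derivative of |g| ^ 2 in a direction u is at most 2 |g| mu^(1/2) |u|, hence at
most a multiple of |g| ^ 2. *)
Lemma nonvanishing_harnack x r u : 0 < r -> slice_ball x r ->
  dot u u <= (r / 2) ^+ 2 -> q (x + slice_vec u) <= expR 4 * q x.
Proof.
move=> r0 xr ur; have r20 : 0 < r / 2 by rewrite divr_gt0.
have sb t : 0 <= t <= 1 -> slice_ball (x + t *: slice_vec u) (r / 2).
  move=> /andP[t0 t1]; rewrite -slice_vecZ; apply: slice_ball_shift => //.
  rewrite dotZl dotZr (le_trans _ ur)// mulrA ler_piMl ?dotxx_ge0//.
  by rewrite mulr_ile1.
apply: line_gronwall => t t01.
  have Ut := slice_ball_center r20 (sb t t01).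
  exact: Ck_differentiable (Ck_dot oU s1 s1) Ut.
have := sb t t01; move: (x + _) => y yr; have Uy := slice_ball_center r20 yr.
apply: le_trans (ler_norm _) _.
have q0 : 0 <= 4 * q y by rewrite mulr_ge0// dotxx_ge0.
rewrite -(ler_pXn2r (n := 2))// ?nnegrE// real_normK ?num_real//.
rewrite (derive_dot (slice_vec u) Uy s1 s1) (dotC (g y)) -mulr2n -mulr_natl exprMn.
have := dot_sqr_le (pd (slice_vec u) g y) (g y).
rewrite (pd_slice_vec_norm u Uy s1 g_conf) => CS.
have := nonvanishing_factor_le r20 yr; rewrite -/(q y) => F.
have : mu y * dot u u * q y <= 4 * q y * q y.
  rewrite ler_wpM2r ?dotxx_ge0//; apply: le_trans F.
  rewrite [leRHS]mulrC ler_wpM2l//; exact: (conformal_factor_ge0 d_gt2 g_conf Uy).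
by move: CS; rewrite -/(q y) exprMn (expr2 (q y)); lra.
Qed.

End Nonvanishing.
End ConformalEstimates.

(** * Equicontinuity of first derivatives *)

Section MatrixSpace.
Context {R : realType} {n d : nat}.
Local Notation V := 'M[R]_(n, d).

Lemma mx_coord_le (v : V) i j : `|v i j| <= `|v|.
Proof.
rewrite [leRHS]/Num.Def.normr/= mx_normrE.
exact: (le_bigmax _ (fun ij : 'I_n * 'I_d => `|v ij.1 ij.2|) (i, j)).
Qed.

Lemma mx_norm_le (v : V) (a : R) : 0 <= a -> (forall i j, `|v i j| <= a) -> `|v| <= a.
Proof.
by move=> a0 va; rewrite [leLHS]/Num.Def.normr/= mx_normrE bigmax_le.
Qed.

Lemma derive_mx_basis (phi : V -> R) (x v : V) : differentiable phi x ->
  'D_v phi x = \sum_i \sum_j v i j * 'D_(delta_mx i j) phi x.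
Proof.
move=> dphi; apply: etrans (deriveE v dphi) _.
rewrite [in LHS](matrix_sum_delta v) linear_sum; apply: eq_bigr => i _.
rewrite linear_sum; apply: eq_bigr => j _.
rewrite linearZ /=; congr (_ * _).
exact: esym (deriveE _ dphi).
Qed.

Lemma derive_mx_le (phi : V -> R) (x v : V) (B : R) : differentiable phi x ->
  (forall i j, `|'D_(delta_mx i j) phi x| <= B) ->
  `|'D_v phi x| <= (n * d)%:R * B * `|v|.
Proof.
move=> dphi HB; rewrite derive_mx_basis//.
apply: le_trans (ler_norm_sum _ _ _) _.
apply: (@le_trans _ _ (\sum_(i < n) \sum_(j < d) (`|v| * B))).
  apply: ler_sum => i _; apply: le_trans (ler_norm_sum _ _ _) _.
  by apply: ler_sum => j _; rewrite normrM ler_pM// mx_coord_le.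
rewrite !sumr_const !card_ord -mulrnA mulnC -mulr_natl.
by rewrite le_eqVlt; apply/orP; left; apply/eqP; ring.
Qed.

Lemma segment_in_ball (z x y : V) (r t : R) : `|x - z| < r -> `|y - z| < r ->
  0 <= t <= 1 -> `|x + t *: (y - x) - z| < r.
Proof.
move=> xr yr /andP[t0 t1].
have -> : x + t *: (y - x) - z = (1 - t) *: (x - z) + t *: (y - z).
  by apply/matrixP => i j; rewrite !mxE; ring.
rewrite (le_lt_trans (ler_normD _ _))// !normrZ (ger0_norm t0) ger0_norm ?subr_ge0//.
have [->|tn0] := eqVneq t 0; first by rewrite subr0 mul1r mul0r addr0.
have tp : 0 < t by rewrite lt_neqAle eq_sym tn0.
apply: (@lt_le_trans _ _ ((1 - t) * r + t * r)); last by rewrite -mulrDl subrK mul1r.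
by rewrite ler_ltD// ?ler_wpM2l ?subr_ge0 ?(ltW xr)// ltr_pM2l.
Qed.

Lemma mx_lipschitz (phi : V -> R) (z x y : V) (r B : R) :
  (forall w, `|w - z| < r -> differentiable phi w) ->
  (forall w i j, `|w - z| < r -> `|'D_(delta_mx i j) phi w| <= B) ->
  `|x - z| < r -> `|y - z| < r ->
  `|phi y - phi x| <= (n * d)%:R * B * `|y - x|.
Proof.
move=> dphi HB xr yr.
have [|t t01] := @MVT_line _ _ phi x (y - x) 1 ler01.
  by move=> t t01; apply: dphi; exact: segment_in_ball.
rewrite scale1r mulr1 [x + _]addrC subrK => ->; apply: derive_mx_le.
  by apply: dphi; exact: segment_in_ball.
by move=> i j; apply: HB; exact: segment_in_ball.
Qed.

(** With a bounded second derivative, the first derivative is close to the difference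
quotient. *)
Lemma derive_difference (phi : V -> R) (x : V) i j (t B : R) : 0 < t ->
  let b := delta_mx i j in
  (forall s, 0 <= s <= t -> differentiable phi (x + s *: b)) ->
  (forall s, 0 <= s <= t -> differentiable (fun w => 'D_b phi w) (x + s *: b)) ->
  (forall s, 0 <= s <= t -> `|'D_b (fun w => 'D_b phi w) (x + s *: b)| <= B) ->
  `|phi (x + t *: b) - phi x - t * 'D_b phi x| <= B * t ^+ 2.
Proof.
move=> t0 b dphi ddphi HB.
have [s st ->] := MVT_line (ltW t0) dphi.
case/andP: (st) => s0 st'.
have [q qt] := @MVT_line _ _ (fun w => 'D_b phi w) x b s s0
  (fun q (qs : 0 <= q <= s) => ddphi q (let: conj a b := andP qs in
     introT andP (conj a (le_trans b st')))).
rewrite [t * _]mulrC -mulrBl => ->; case/andP: qt => q0 qs.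
rewrite !normrM (ger0_norm s0) (ger0_norm (ltW t0)) expr2 -mulrA.
apply: ler_pM => //; last by rewrite ler_wpM2r// ltW.
  by rewrite mulr_ge0// ltW.
by apply: HB; rewrite q0 (le_trans qs).
Qed.

Lemma delta_norm_le i j : `|delta_mx i j : V| <= 1.
Proof.
by apply: mx_norm_le => // k l; rewrite mxE; case: (_ && _); rewrite ?normr1 ?normr0.
Qed.

(** Landau's inequality: difference quotients of step t inherit the Lipschitz bound
of phi divided by t, and differ from the derivatives by a multiple of t. Only pure
second derivatives occur, although phi depends on all coordinates. *)
Lemma equicontinuous_derivatives (r B eps : R) : 0 < r -> 0 <= B -> 0 < eps ->
  exists2 eta, 0 < eta & forall (phi : V -> R) (z : V),
    (forall w, `|w - z| < r -> [/\ differentiable phi w,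
       forall i j, differentiable (fun w => 'D_(delta_mx i j) phi w) w,
       forall i j, `|'D_(delta_mx i j) phi w| <= B &
       forall i j, `|'D_(delta_mx i j) (fun w => 'D_(delta_mx i j) phi w) w| <= B]) ->
    forall w, `|w - z| < eta ->
      `|phi w - phi z| <= eps /\
      forall i j, `|'D_(delta_mx i j) phi w - 'D_(delta_mx i j) phi z| <= eps.
Proof.
move=> r0 B0 e0.
pose L := (n * d)%:R * B + 1.
have L0 : 0 < L by rewrite ltr_wpDl// mulr_ge0.
(* The step t makes the error B t of the quotient at most eps / 4; eta is then chosen
   to make the variation L eta / t of the quotient at most eps / 4. *)
pose t := Num.min (r / 2) (eps / (4 * (B + 1))).
have t0 : 0 < t.
  by rewrite lt_min !divr_gt0//= mulr_gt0// ltr_wpDl.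
pose eta := Num.min (r / 2) (Num.min (eps / L) (eps * t / (4 * L))).
have eta0 : 0 < eta by rewrite !lt_min !divr_gt0 ?mulr_gt0.
exists eta => // phi z H w wz.
have [d1 d2 d3 d4] : [/\ forall w, `|w - z| < r -> differentiable phi w,
       forall w i j, `|w - z| < r -> differentiable (fun w => 'D_(delta_mx i j) phi w) w,
       forall w i j, `|w - z| < r -> `|'D_(delta_mx i j) phi w| <= B &
       forall w i j, `|w - z| < r ->
         `|'D_(delta_mx i j) (fun w => 'D_(delta_mx i j) phi w) w| <= B].
  by split=> [v /H[]|v i j /H[]|v i j /H[]|v i j /H[]].
have [wr we we'] : [/\ `|w - z| < r / 2, `|w - z| < eps / L & `|w - z| < eps * t / (4 * L)].
  by move: wz; rewrite !lt_min => /andP[? /andP[? ?]].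
have tr : t <= r / 2 by rewrite ge_min lexx.
have te : t <= eps / (4 * (B + 1)) by rewrite ge_min lexx orbT.
have near v i j s : `|v - z| < r / 2 -> 0 <= s <= t -> `|v + s *: delta_mx i j - z| < r.
  move=> vr /andP[s0 st]; rewrite addrAC (le_lt_trans (ler_normD _ _))//.
  rewrite (splitr r) ltr_leD// normrZ ger0_norm// (le_trans _ tr)// (le_trans _ st)//.
  by rewrite ler_piMr// delta_norm_le.
have z0 : `|z - z| < r / 2 by rewrite subrr normr0 divr_gt0.
have half v : `|v - z| < r / 2 -> `|v - z| < r.
  by move=> /lt_trans; apply; rewrite ltr_pdivrMr// ltr_pMr// ltr1n.
have lip x y : `|x - z| < r -> `|y - z| < r -> `|phi y - phi x| <= L * `|y - x|.
  move=> xr yr; apply: le_trans (mx_lipschitz d1 d3 xr yr) _.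
  by rewrite ler_wpM2r// lerDl.
split.
  apply: le_trans (lip _ _ (half _ z0) (half _ wr)) _.
  by rewrite mulrC -ler_pdivlMr// ltW.
move=> i j; set b := delta_mx i j.
have est v : `|v - z| < r / 2 ->
    `|phi (v + t *: b) - phi v - t * 'D_b phi v| <= B * t ^+ 2.
  move=> vr; apply: derive_difference => // s st.
  - by apply: d1; exact: near.
  - by apply: d2; exact: near.
  - by apply: d4; exact: near.
have E1 := est w wr; have E2 := est z z0.
have tt : 0 <= t <= t by rewrite lexx ltW.
have E3 := lip _ _ (half _ z0) (half _ wr).
have E4 := lip _ _ (near z i j t z0 tt) (near w i j t wr tt).
have sh : w + t *: b - (z + t *: b) = w - z by rewrite opprD addrACA subrr addr0.
rewrite sh in E4.
have key : t * `|'D_b phi w - 'D_b phi z| <= 2 * (B * t ^+ 2) + 2 * (L * `|w - z|).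
  rewrite -[X in X * _](ger0_norm (ltW t0)) -normrM.
  move: E1 E2 E3 E4.
  move: ('D_b phi w) ('D_b phi z) (phi w) (phi z) (phi (w + _)) (phi (z + _)) (B * _) (L * _).
  move=> D1 D2 p1 p2 p3 p4 bb ll; rewrite !ler_norml => /andP[? ?] /andP[? ?] /andP[? ?] /andP[? ?].
  by apply/andP; split; lra.
have k1 : B * t ^+ 2 <= eps / 4 * t.
  rewrite expr2 mulrA ler_wpM2r ?(ltW t0)//.
  move: te; rewrite ler_pdivlMr ?mulr_gt0 ?ltr_wpDl//; lra.
have k2 : L * `|w - z| <= eps / 4 * t.
  by move: we'; rewrite ltr_pdivlMr ?mulr_gt0//; lra.
rewrite -(ler_pM2l t0); apply: le_trans key _; lra.
Qed.

End MatrixSpace.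

(** * Limits along an ultrafilter *)

Section UltraLimits.
Context {R : realType} (G : set_system nat) (GU : UltraFilter G).

Let GP : ProperFilter G := ultra_proper.

Lemma ultra_bounded_cvg (a : nat -> R) (B : R) :
  (forall k, `|a k| <= B) -> a @ G --> lim (a @ G).
Proof.
move=> aB; suff : cvg (a @ G) by [].
have FA : (a @ G) `[- B, B]%classic.
  by apply: nearW => k /=; rewrite in_itv /= -ler_norml.
have [p [_ clp]] := @segment_compact R (- B) B (a @ G) _ FA.
apply/cvg_ex; exists p => A Ap.
have [//|GnA] := in_ultra_setVsetC (a @^-1` A) GU.
have [x [xnA xA]] := clp (~` A) A GnA Ap.
by case: xnA.
Qed.

Lemma cvg_abs_le (T : Type) (F : set_system T) (a : T -> R) (l c : R) :
  ProperFilter F -> a @ F --> l -> (\forall k \near F, `|a k| <= c) -> `|l| <= c.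
Proof. by move=> FP al; exact: (@cvgr_to_le T F FP R _ _ c (cvg_norm al)). Qed.

Lemma cvg_sumr (T : Type) (F : set_system T) (I : Type) (r : seq I)
    (f : I -> T -> R) (a : I -> R) : Filter F ->
  (forall i, f i @ F --> a i) ->
  (fun x => \sum_(i <- r) f i x) @ F --> \sum_(i <- r) a i.
Proof.
move=> FF fa; apply: (@cvg_big R I +%R 0 xpredT _ T F r f a FF) => //.
exact: add_continuous.
Qed.

End UltraLimits.

Section C1Limits.
Context {R : realType} {n d : nat}.
Local Notation V := 'M[R]_(n, d).

Lemma mx_lin_form_continuous (D : 'I_n -> 'I_d -> R) :
  continuous (fun v : V => \sum_i \sum_j v i j * D i j).
Proof.
move=> v; apply: (@cvg_sumr R V (nbhs v) _ _ (fun i (v : V) => \sum_j v i j * D i j)) => i.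
apply: (@cvg_sumr R V (nbhs v) _ _ (fun j (v : V) => v i j * D i j)) => j.
have c : (fun x : V => x i j) @ nbhs v --> v i j by exact: coord_continuous.
exact: cvgM c (cvg_cst _).
Qed.

Lemma differentiable_mx_eps (phi : V -> R) (z : V) (D : 'I_n -> 'I_d -> R) :
  (forall e, 0 < e -> \forall h \near (0 : V),
     `|phi (z + h) - phi z - \sum_i \sum_j h i j * D i j| <= e * `|h|) ->
  differentiable phi z /\ forall v, 'D_v phi z = \sum_i \sum_j v i j * D i j.
Proof.
move=> H; pose M := (\matrix_(j, i) D i j) : 'M[R]_(d, n).
pose L : {linear V -> R} := mxtrace \o mulmxr M.
have LE v : L v = \sum_i \sum_j v i j * D i j.
  rewrite /L /= /mxtrace; apply: eq_bigr => i _.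
  by rewrite mxE; apply: eq_bigr => j _; rewrite mxE.
have LE' : (L : V -> R) = (fun v : V => \sum_i \sum_j v i j * D i j).
  by apply/funext => v; exact: LE.
have [|e e0|dphi dE] := @differentiable_eps R V R phi z L.
- by rewrite LE'; exact: mx_lin_form_continuous.
- by apply: filterS (H e e0) => h; rewrite LE.
split=> // v; apply: etrans (deriveE v dphi) _.
by rewrite dE LE.
Qed.

(** Convergence as the index tends to G and the point to z, jointly: this is locally
uniform convergence of the functions and of their partial derivatives, to
continuous limits. *)
Definition C1cvg (G : set_system nat) (U : set V) (phi : nat -> V -> R) (psi : V -> R) :=
  forall z, U z -> [/\ differentiable psi z,
    (fun p : nat * V => phi p.1 p.2) @ filter_prod G (nbhs z) --> psi z &
    forall i j, (fun p : nat * V => 'D_(delta_mx i j) (phi p.1) p.2)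
       @ filter_prod G (nbhs z) --> 'D_(delta_mx i j) psi z].

(** An ultrafilter makes every bounded sequence of values converge, so no diagonal
extraction is needed; equicontinuity makes the convergence locally uniform and
lets the increments of phi k pass to the limit. *)
Lemma ultra_C1cvg (G : set_system nat) (U : set V) (phi : nat -> V -> R) :
  UltraFilter G -> open U ->
  (forall k z, U z -> differentiable (phi k) z) ->
  (forall z, U z -> exists B, forall k, `|phi k z| <= B /\
     forall i j, `|'D_(delta_mx i j) (phi k) z| <= B) ->
  (forall z e, U z -> 0 < e -> exists2 eta, 0 < eta & forall k w, `|w - z| < eta ->
     `|phi k w - phi k z| <= e /\
     forall i j, `|'D_(delta_mx i j) (phi k) w - 'D_(delta_mx i j) (phi k) z| <= e) ->
  exists psi, C1cvg G U phi psi.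
Proof.
move=> GU oU dphi bphi ephi.
pose psi z := lim (phi^~ z @ G).
pose D i j z := lim ((fun k => 'D_(delta_mx i j) (phi k) z) @ G).
have psiP z : U z -> phi^~ z @ G --> psi z.
  by move=> /bphi [B HB]; apply: (ultra_bounded_cvg GU (B := B)) => k; case: (HB k).
have DP i j z : U z -> (fun k => 'D_(delta_mx i j) (phi k) z) @ G --> D i j z.
  by move=> /bphi [B HB]; apply: (ultra_bounded_cvg GU (B := B)) => k; case: (HB k).
exists psi => z Uz.
have [dpsi psiE] : differentiable psi z /\
    forall v, 'D_v psi z = \sum_i \sum_j v i j * D i j z.
  apply: differentiable_mx_eps => e e0.
  pose c := (n * d)%:R + 1 : R.
  have c0 : 0 < c by rewrite ltr_wpDl.
  have [eta eta0 He] := ephi z (e / c) Uz (divr_gt0 e0 c0).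
  have [r r0 Hr] : exists2 r : R, 0 < r & forall w, `|w - z| < r -> U w.
    have /nbhs_ballP [r r0 H] := open_nbhs_nbhs (conj oU Uz).
    by exists r => // w wz; apply: H; rewrite -ball_normE /= distrC.
  apply/nbhs_ballP; exists (Num.min eta r); first by rewrite /= lt_min eta0.
  move=> h; rewrite -ball_normE /= sub0r normrN lt_min => /andP[heta hr].
  have hz t : 0 <= t <= 1 -> `|z + t *: h - z| <= `|h|.
    move=> /andP[t0 t1]; rewrite addrC addKr normrZ ger0_norm//.
    by rewrite ler_piMl.
  have Uzt t : 0 <= t <= 1 -> U (z + t *: h).
    by move=> /hz ht; apply: Hr; exact: le_lt_trans hr.
  have Uzh : U (z + h) by have := Uzt 1; rewrite scale1r; apply; rewrite ler01 lexx.
  apply: (@cvg_abs_le R nat G (fun k => phi k (z + h) - phi k z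
     - \sum_i \sum_j h i j * 'D_(delta_mx i j) (phi k) z)).
    apply: cvgB; first by apply: cvgB; exact: psiP.
    apply: cvg_sumr => i; apply: cvg_sumr => j.
    by apply: cvgM; [exact: cvg_cst|exact: DP].
  apply: nearW => k.
  have [|t t01] := @MVT_line _ _ (phi k) z h 1 ler01.
    by move=> t t01; apply: dphi; exact: Uzt.
  rewrite scale1r mulr1 => ->.
  rewrite derive_mx_basis; last by apply: dphi; exact: Uzt.
  have [_ Hd] := He k (z + t *: h) (le_lt_trans (hz t t01) heta).
  rewrite -sumrB; apply: le_trans (ler_norm_sum _ _ _) _.
  apply: (@le_trans _ _ (\sum_(i < n) \sum_(j < d) (`|h| * (e / c)))).
    apply: ler_sum => i _; rewrite -sumrB; apply: le_trans (ler_norm_sum _ _ _) _.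
    apply: ler_sum => j _; rewrite -mulrBr normrM ler_pM//; exact: mx_coord_le.
  rewrite !sumr_const !card_ord -mulrnA mulnC -mulr_natl.
  have -> : (n * d)%:R * (`|h| * (e / c)) = (n * d)%:R / c * (e * `|h|).
    by field; rewrite gt_eqF.
  by rewrite ler_piMl ?mulr_ge0 ?(ltW e0)// ler_pdivrMr// mul1r lerDl.
have cvgpair (a : nat -> V -> R) (b : R) :
    (forall e, 0 < e -> exists2 eta, 0 < eta & forall k w, `|w - z| < eta ->
       `|a k w - a k z| <= e) ->
    a^~ z @ G --> b ->
    (fun p : nat * V => a p.1 p.2) @ filter_prod G (nbhs z) --> b.
  move=> Ha Hb; apply/cvgrPdist_le => e e0.
  have e2 : 0 < e / 2 by rewrite divr_gt0.
  have [eta eta0 He] := Ha _ e2.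
  have /cvgrPdist_le/(_ _ e2) Gb := Hb.
  exists ([set k | `|b - a k z| <= e / 2], ball z eta) => /=.
    by split=> //; exact: nbhsx_ballx.
  move=> [k w] /= [kb wz]; rewrite -ball_normE /= distrC in wz.
  have := He k w wz; rewrite distrC => aw.
  rewrite (splitr e) -[X in `|X|](subrKA (a k z)) (le_trans (ler_normD _ _))//.
  by rewrite lerD// distrC.
split=> //; first apply: cvgpair; last 2 first.
- exact: psiP.
- move=> i j; have -> : 'D_(delta_mx i j) psi z = D i j z.
    rewrite psiE (bigD1 i)//= [X in _ + X]big1 ?addr0.
      rewrite (bigD1 j)//= big1 ?addr0 ?mxE ?eqxx ?mul1r// => k /negbTE kj.
      by rewrite mxE kj andbF mul0r.
    move=> k /negbTE ki; rewrite big1// => l _.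
    by rewrite mxE ki mul0r.
  apply: (cvgpair (fun k w => 'D_(delta_mx i j) (phi k) w)); last exact: DP.
  move=> e e0; have [eta eta0 He] := ephi z e Uz e0.
  by exists eta => // k w /(He k w)[_].
- move=> e e0; have [eta eta0 He] := ephi z e Uz e0.
  by exists eta => // k w /(He k w)[].
Qed.

End C1Limits.

(** * The norm of Cayley-Dickson algebras *)

Section CayleyDicksonNorm.
Context {R : realType}.

Lemma dot_blocks m (x y : 'rV[R]_(m + m)) :
  dot x y = dot (lsubmx x) (lsubmx y) + dot (rsubmx x) (rsubmx y).
Proof.
by rewrite /dot big_split_ord; congr (_ + _); apply: eq_bigr => i _; rewrite !mxE.
Qed.

Lemma cd_reD r (x y : cd R r) : cd_re (x + y) = cd_re x + cd_re y.
Proof.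
elim: r x y => [|r IH] x y; first by rewrite /= mxE.
by rewrite /= [lsubmx _]linearD IH.
Qed.

Lemma cd_reN r (x : cd R r) : cd_re (- x) = - cd_re x.
Proof.
elim: r x => [|r IH] x; first by rewrite /= mxE.
by rewrite /= [lsubmx _]linearN IH.
Qed.

Lemma cd_conjD r (x y : cd R r) : cd_conj (x + y) = cd_conj x + cd_conj y.
Proof.
elim: r x y => [|r IH] x y //.
by rewrite /= [lsubmx _]linearD IH [rsubmx _]linearD opprD add_row_mx.
Qed.

Lemma cd_conjN r (x : cd R r) : cd_conj (- x) = - cd_conj x.
Proof.
elim: r x => [|r IH] x //.
by rewrite /= [lsubmx _]linearN IH [rsubmx _]linearN opp_row_mx.
Qed.

Lemma cd_conjZ r a (x : cd R r) : cd_conj (a *: x) = a *: cd_conj x.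
Proof.
elim: r x => [|r IH] x //.
by rewrite /= [lsubmx _]linearZ IH [rsubmx _]linearZ scale_row_mx scalerN.
Qed.

Lemma cd_conjK r : involutive (@cd_conj R r).
Proof.
elim: r => [|r IH] x //=.
by rewrite row_mxKl row_mxKr IH opprK hsubmxK.
Qed.

Lemma cd_mul_linear r :
  (forall a (x y z : cd R r), cd_mul (a *: x + y) z = a *: cd_mul x z + cd_mul y z) /\
  (forall a (x y z : cd R r), cd_mul z (a *: x + y) = a *: cd_mul z x + cd_mul z y).
Proof.
elim: r => [|r [IHl IHr]].
  by split=> a x y z; apply/rowP => j; rewrite !mxE; ring.
split=> a x y z /=; rewrite !linearP /= ?cd_conjD ?cd_conjZ !(IHl, IHr).
  rewrite scale_row_mx add_row_mx; congr row_mx.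
    by rewrite scalerBr opprD addrACA.
  by rewrite scalerDr addrACA.
rewrite scale_row_mx add_row_mx; congr row_mx.
  by rewrite scalerBr opprD addrACA.
by rewrite scalerDr addrACA.
Qed.

Lemma cd_mulDl r (x y z : cd R r) : cd_mul (x + y) z = cd_mul x z + cd_mul y z.
Proof. by have := (cd_mul_linear r).1 1 x y z; rewrite !scale1r. Qed.

Lemma cd_mulDr r (x y z : cd R r) : cd_mul z (x + y) = cd_mul z x + cd_mul z y.
Proof. by have := (cd_mul_linear r).2 1 x y z; rewrite !scale1r. Qed.

Lemma cd_mul0l r (z : cd R r) : cd_mul 0 z = 0.
Proof. by apply: (addrI (cd_mul 0 z)); rewrite -cd_mulDl !addr0. Qed.

Lemma cd_mul0r r (z : cd R r) : cd_mul z 0 = 0.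
Proof. by apply: (addrI (cd_mul z 0)); rewrite -cd_mulDr !addr0. Qed.

Lemma cd_mulZl r a (x z : cd R r) : cd_mul (a *: x) z = a *: cd_mul x z.
Proof. by have := (cd_mul_linear r).1 a x 0 z; rewrite cd_mul0l !addr0. Qed.

Lemma cd_mulZr r a (x z : cd R r) : cd_mul z (a *: x) = a *: cd_mul z x.
Proof. by have := (cd_mul_linear r).2 a x 0 z; rewrite cd_mul0r !addr0. Qed.

Lemma cd_mulNl r (x z : cd R r) : cd_mul (- x) z = - cd_mul x z.
Proof. by rewrite -scaleN1r cd_mulZl scaleN1r. Qed.

Lemma cd_mulNr r (x z : cd R r) : cd_mul z (- x) = - cd_mul z x.
Proof. by rewrite -scaleN1r cd_mulZr scaleN1r. Qed.

(** The two identities need each other in the induction. *)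
Lemma cd_re_mul_conj r (x y : cd R r) :
  cd_re (cd_mul x (cd_conj y)) = dot x y /\ cd_re (cd_mul (cd_conj x) y) = dot x y.
Proof.
elim: r x y => [|r IH] x y.
  by rewrite /= mxE /dot; split; apply/esym; rewrite big_ord1.
rewrite (@dot_blocks (cdim r) x y); split=> /=; rewrite !(row_mxKl, row_mxKr).
  rewrite cd_reD cd_reN (proj1 (IH _ _)) cd_conjN cd_mulNl cd_reN opprK.
  by rewrite (proj2 (IH _ _)) [X in _ + X]dotC.
rewrite cd_reD cd_reN (proj2 (IH _ _)) cd_mulNr cd_reN opprK.
by rewrite (proj2 (IH _ _)) [X in _ + X]dotC.
Qed.

Lemma cd_absE r (x : cd R r) : cd_abs x = Num.sqrt (dot x x).
Proof. by rewrite /cd_abs (proj1 (cd_re_mul_conj _ _)). Qed.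

Lemma cd_abs_ge0 r (x : cd R r) : 0 <= cd_abs x.
Proof. exact: sqrtr_ge0. Qed.

Lemma cd_abs_sqr r (x : cd R r) : cd_abs x ^+ 2 = dot x x.
Proof. by rewrite cd_absE sqr_sqrtr// dotxx_ge0. Qed.

Lemma dot_conj r (x y : cd R r) : dot (cd_conj x) (cd_conj y) = dot x y.
Proof.
by rewrite -(proj1 (cd_re_mul_conj _ _)) cd_conjK (proj2 (cd_re_mul_conj _ _)).
Qed.

Lemma cd_abs_conj r (x : cd R r) : cd_abs (cd_conj x) = cd_abs x.
Proof. by rewrite !cd_absE dot_conj. Qed.

Lemma cd_absN r (x : cd R r) : cd_abs (- x) = cd_abs x.
Proof. by rewrite !cd_absE dotNl dotNr opprK. Qed.

Lemma cd_absD r (x y : cd R r) : cd_abs (x + y) <= cd_abs x + cd_abs y.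
Proof.
rewrite -(ler_pXn2r (n := 2))// ?nnegrE ?addr_ge0 ?cd_abs_ge0//.
rewrite sqrrD !cd_abs_sqr !(dotDl, dotDr) (dotC y x).
have : dot x y <= cd_abs x * cd_abs y.
  apply: le_trans (ler_norm _) _.
  rewrite -(ler_pXn2r (n := 2))// ?nnegrE ?mulr_ge0 ?cd_abs_ge0//.
  by rewrite real_normK ?num_real// exprMn !cd_abs_sqr dot_sqr_le.
by lra.
Qed.

Lemma cd_abs0 r : cd_abs (0 : cd R r) = 0.
Proof. by rewrite cd_absE dot0l sqrtr0. Qed.

Lemma cd_coord_le_abs r (x : cd R r) i : `|x 0 i| <= cd_abs x.
Proof.
rewrite -(ler_pXn2r (n := 2))// ?nnegrE ?cd_abs_ge0//.
by rewrite real_normK ?num_real// cd_abs_sqr dot_coord_le.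
Qed.

Lemma cd_conjM r (x y : cd R r) : cd_conj (cd_mul x y) = cd_mul (cd_conj y) (cd_conj x).
Proof.
elim: r x y => [|r IH] x y; first by apply/rowP => j; rewrite !mxE mulrC.
rewrite /= !(row_mxKl, row_mxKr) cd_conjD cd_conjN !IH !cd_conjK; congr row_mx.
  by rewrite cd_conjN cd_mulNl cd_mulNr opprK.
by rewrite !cd_mulNl opprD addrC.
Qed.

(** This holds in all Cayley-Dickson algebras, associative or not. *)
Lemma dot_adjoint r (x y z : cd R r) :
  dot (cd_mul x y) z = dot y (cd_mul (cd_conj x) z) /\
  dot (cd_mul x y) z = dot x (cd_mul z (cd_conj y)).
Proof.
have conj_dot s (u v : cd R s) : dot (cd_conj u) v = dot u (cd_conj v).
  by rewrite -[v in LHS]cd_conjK dot_conj.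
elim: r x y z => [|r IH] x y z.
  by rewrite /dot !big_ord1 !mxE /=; split; ring.
rewrite !(@dot_blocks (cdim r)) /= !(row_mxKl, row_mxKr) !cd_conjK.
rewrite !(dotDl, dotDr, dotNl, dotNr) !cd_conjN !(cd_mulNl, cd_mulNr) !(dotNl, dotNr).
split.
  rewrite (proj1 (IH (lsubmx x) _ _)) (proj2 (IH (rsubmx y) _ _)).
  rewrite (proj2 (IH (cd_conj (rsubmx y)) _ _)) conj_dot cd_conjM cd_conjK.
  rewrite (proj1 (IH (rsubmx x) _ _)) conj_dot cd_conjM cd_conjK.
  by ring.
rewrite (proj2 (IH (lsubmx x) _ _)) (proj1 (IH (rsubmx y) _ _)).
rewrite (proj1 (IH (cd_conj (rsubmx y)) _ _)) cd_conjK.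
rewrite (proj2 (IH (rsubmx x) _ _)) cd_conjK.
by ring.
Qed.

Lemma cd_mul_comm r (x y : cd R r) : (r <= 1)%N -> cd_mul x y = cd_mul y x.
Proof.
case: r x y => [|[|//]] x y _; first by apply/rowP => j; rewrite !mxE mulrC.
rewrite /=; congr row_mx; apply/rowP => j; rewrite !mxE; ring.
Qed.

Lemma cd_mul_assoc r (x y z : cd R r) : (r <= 2)%N ->
  cd_mul x (cd_mul y z) = cd_mul (cd_mul x y) z.
Proof.
elim: r x y z => [|r IH] x y z r2.
  by apply/rowP => j; rewrite !mxE mulrA.
have A (u v w : cd R r) : cd_mul u (cd_mul v w) = cd_mul (cd_mul u v) w.
  by apply: IH; exact: ltnW.
have C (u v : cd R r) : cd_mul u v = cd_mul v u by exact: cd_mul_comm.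
have CA (u v w : cd R r) : cd_mul u (cd_mul v w) = cd_mul v (cd_mul u w).
  by rewrite !A (C u v).
rewrite /= !(row_mxKl, row_mxKr) !(cd_conjD, cd_conjN, cd_conjM, cd_conjK).
rewrite !(cd_mulDl, cd_mulDr, cd_mulNl, cd_mulNr).
move: (lsubmx x) (rsubmx x) (lsubmx y) (rsubmx y) (lsubmx z) (rsubmx z).
move=> a b c d e f; congr row_mx.
  have -> : cd_mul (cd_mul (cd_conj d) b) e = cd_mul (cd_mul e (cd_conj d)) b.
    by rewrite (C (cd_mul e _) b) -A CA (C (cd_conj d) e).
  have -> : cd_mul (cd_conj f) (cd_mul d a) = cd_mul a (cd_mul (cd_conj f) d).
    by rewrite (CA a) (C d a).
  have -> : cd_mul (cd_conj f) (cd_mul b (cd_conj c))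
      = cd_mul (cd_mul (cd_conj c) (cd_conj f)) b.
    by rewrite (C (cd_mul _ _) b) (CA (cd_conj f)) (C (cd_conj f)).
  by rewrite A; apply/rowP => j; rewrite !mxE; ring.
have -> : cd_mul (cd_mul f c) a = cd_mul f (cd_mul a c) by rewrite -A (C c a).
have -> : cd_mul (cd_mul d (cd_conj e)) a = cd_mul (cd_mul d a) (cd_conj e).
  by rewrite -!A (C a).
have -> : cd_mul f (cd_mul (cd_conj d) b) = cd_mul b (cd_mul (cd_conj d) f).
  by rewrite (C _ b) CA (C f).
have -> : cd_mul b (cd_mul (cd_conj e) (cd_conj c)) = cd_mul (cd_mul b (cd_conj c)) (cd_conj e).
  by rewrite -A (C (cd_conj e)).
by apply/rowP => j; rewrite !mxE; ring.
Qed.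

(** The mixed terms in the square lengths of a c - d~ b and of d a + b c~ are opposite,
by adjointness and by associativity of the algebra to which a, b, c, d belong. *)
Lemma cd_mul_normS r : (r <= 2)%N ->
  (forall x y : cd R r, dot (cd_mul x y) (cd_mul x y) = dot x x * dot y y) ->
  (forall x y : cd R r.+1, dot (cd_mul x y) (cd_mul x y) = dot x x * dot y y).
Proof.
move=> r2 N x y; rewrite !(@dot_blocks (cdim r)) /= !(row_mxKl, row_mxKr).
move: (lsubmx x) (rsubmx x) (lsubmx y) (rsubmx y) => a b c d.
rewrite !(dotBl, dotBr, dotDl, dotDr) !N !dot_conj.
have -> : dot (cd_mul a c) (cd_mul (cd_conj d) b) = dot (cd_mul d a) (cd_mul b (cd_conj c)).
  rewrite [RHS]dotC (proj2 (dot_adjoint b _ _)) cd_conjK -cd_mul_assoc//.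
  by rewrite [LHS]dotC (proj1 (dot_adjoint _ b _)) cd_conjK.
rewrite (dotC (cd_mul (cd_conj d) b)) (dotC (cd_mul b _)).
have -> : dot (cd_mul a c) (cd_mul (cd_conj d) b) = dot (cd_mul d a) (cd_mul b (cd_conj c)).
  rewrite [RHS]dotC (proj2 (dot_adjoint b _ _)) cd_conjK -cd_mul_assoc//.
  by rewrite [LHS]dotC (proj1 (dot_adjoint _ b _)) cd_conjK.
ring.
Qed.

Lemma cd_mul_norm r (x y : cd R r) : (r <= 3)%N ->
  dot (cd_mul x y) (cd_mul x y) = dot x x * dot y y.
Proof.
elim: r x y => [|r IH] x y r3; first by rewrite /dot !big_ord1 !mxE; ring.
by apply: cd_mul_normS => // u v; apply: IH; exact: ltnW.
Qed.

Lemma cd_absM r (x y : cd R r) : (r <= 3)%N -> cd_abs (cd_mul x y) = cd_abs x * cd_abs y.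
Proof. by move=> r3; rewrite !cd_absE cd_mul_norm// sqrtrM// dotxx_ge0. Qed.

End CayleyDicksonNorm.

(** * Majorants of words *)

Section Expressions.
Variables (R : realType) (r n : nat).
Hypothesis r_le3 : (r <= 3)%N.
Local Notation K := (cd R r).
Local Notation Kn := (cdn R r n).

(** Words are not closed under differentiation; these expressions are. *)
Inductive expr : Type :=
  | EConst of K
  | EVar of 'I_n
  | EConj of 'I_n
  | EMul of expr & expr
  | EAdd of expr & expr.

Fixpoint eval (e : expr) (z : Kn) : K :=
  match e with
  | EConst c => c
  | EVar j => row j z
  | EConj j => cd_conj (row j z)
  | EMul u v => cd_mul (eval u z) (eval v z)
  | EAdd u v => eval u z + eval v z
  end.

Fixpoint ederiv (h : Kn) (e : expr) : expr :=
  match e with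
  | EConst c => EConst 0
  | EVar j => EConst (row j h)
  | EConj j => EConst (cd_conj (row j h))
  | EMul u v => EAdd (EMul (ederiv h u) v) (EMul u (ederiv h v))
  | EAdd u v => EAdd (ederiv h u) (ederiv h v)
  end.

(** The majorant at radius a: moduli of constants, a for every letter. For a word it is
the modulus of its value at any point whose coordinates all have modulus a. *)
Fixpoint emaj (e : expr) (a : R) : R :=
  match e with
  | EConst c => cd_abs c
  | EVar j => a
  | EConj j => a
  | EMul u v => emaj u a * emaj v a
  | EAdd u v => emaj u a + emaj v a
  end.

Definition rows_le (a : R) (z : Kn) := forall j, cd_abs (row j z) <= a.

Lemma emaj_mono e a b : 0 <= a -> a <= b -> 0 <= emaj e a <= emaj e b.
Proof.
move=> a0 ab; elim: e => [c|j|j|u /andP[u0 uu] v /andP[v0 vv]|u /andP[u0 uu] v /andP[v0 vv]] /=.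
- by rewrite cd_abs_ge0 lexx.
- by rewrite a0.
- by rewrite a0.
- by rewrite mulr_ge0// ler_pM.
- by rewrite addr_ge0// lerD.
Qed.

Lemma emaj_ge0 e a : 0 <= a -> 0 <= emaj e a.
Proof. by move=> a0; have /andP[] := emaj_mono e a0 (lexx a). Qed.

Lemma eval_le e z a : 0 <= a -> rows_le a z -> cd_abs (eval e z) <= emaj e a.
Proof.
move=> a0 za; elim: e => [c|j|j|u IHu v IHv|u IHu v IHv] //=.
- by rewrite cd_abs_conj.
- by rewrite cd_absM// ler_pM// cd_abs_ge0.
- by apply: le_trans (cd_absD _ _) _; rewrite lerD.
Qed.

(** A majorant P is a polynomial in a with nonnegative coefficients, so its increment
P (a + c) - P a dominates c P' a. Stated with increments, the bound is stable
under products without any mention of degrees. *)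
Lemma emaj_ederiv e h a c th : 0 <= a -> 0 <= c -> 0 <= th -> rows_le (th * c) h ->
  emaj (ederiv h e) a <= th * (emaj e (a + c) - emaj e a).
Proof.
move=> a0 c0 th0 hc; have ac : a <= a + c by rewrite lerDl.
elim: e => [k|j|j|u IHu v IHv|u IHu v IHv] /=.
- by rewrite cd_abs0 subrr mulr0.
- by rewrite addrC addKr.
- by rewrite cd_abs_conj addrC addKr.
- have /andP[u0 uu] := emaj_mono u a0 ac; have /andP[v0 vv] := emaj_mono v a0 ac.
  apply: (@le_trans _ _ (th * (emaj u (a + c) - emaj u a) * emaj v a
     + emaj u a * (th * (emaj v (a + c) - emaj v a)))).
    by rewrite lerD// ?ler_wpM2r// ler_wpM2l.
  rewrite -subr_ge0 [X in 0 <= X](_ : _ =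
    th * ((emaj u (a + c) - emaj u a) * (emaj v (a + c) - emaj v a))); last by ring.
  by rewrite !mulr_ge0// subr_ge0.
- by apply: le_trans (lerD IHu IHv) _; rewrite -mulrDr opprD addrACA.
Qed.

Lemma rows_le_add a b z h : rows_le a z -> rows_le b h -> rows_le (a + b) (z + h).
Proof.
move=> za hb j; rewrite linearD /=; apply: le_trans (cd_absD _ _) _.
by rewrite lerD.
Qed.

(** The same increments of the majorant dominate, with the factors th and th ^ 2, the
first two Taylor remainders. *)
Lemma eval_taylor e z h a c th : 0 <= a -> 0 <= c -> 0 <= th <= 1 ->
  rows_le a z -> rows_le (th * c) h ->
  cd_abs (eval e (z + h) - eval e z) <= th * (emaj e (a + c) - emaj e a) /\
  cd_abs (eval e (z + h) - eval e z - eval (ederiv h e) z)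
    <= th ^+ 2 * (emaj e (a + c) - emaj e a).
Proof.
move=> a0 c0 /andP[th0 th1] za hc; have ac : a <= a + c by rewrite lerDl.
elim: e => [k|j|j|u [IHu1 IHu2] v [IHv1 IHv2]|u [IHu1 IHu2] v [IHv1 IHv2]] /=.
- by rewrite !subrr cd_abs0 !mulr0.
- rewrite linearD /= addrC addKr subrr cd_abs0 [a + c]addrC addrK.
  by split=> //; rewrite mulr_ge0// sqr_ge0.
- rewrite linearD /= cd_conjD addrC addKr subrr cd_abs0 cd_abs_conj [a + c]addrC addrK.
  by split=> //; rewrite mulr_ge0// sqr_ge0.
- have /andP[u0 uu] := emaj_mono u a0 ac; have /andP[v0 vv] := emaj_mono v a0 ac.
  have du := emaj_ederiv u a0 c0 th0 hc.
  have Eu := eval_le u a0 za; have Ev := eval_le v a0 za.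
  have Du : cd_abs (eval u (z + h) - eval u z) <= th * (emaj u (a + c) - emaj u a) by [].
  move: IHu1 IHu2 IHv1 IHv2 Eu Ev.
  set U := emaj u (a + c) in uu *; set U0 := emaj u a in uu u0 *.
  set W := emaj v (a + c) in vv *; set W0 := emaj v a in vv v0 *.
  set x := eval u z; set x' := eval u (z + h); set y := eval v z; set y' := eval v (z + h).
  set dx := eval (ederiv h u) z; set dy := eval (ederiv h v) z.
  move=> Hu1 Hu2 Hv1 Hv2 Eu Ev.
  have E1 : cd_mul x' y' - cd_mul x y =
      cd_mul (x' - x) y + cd_mul (x' - x) (y' - y) + cd_mul x (y' - y).
    rewrite -cd_mulDr addrC [y + _]addrC subrK !(cd_mulDl, cd_mulDr, cd_mulNl, cd_mulNr).
    by apply/rowP => j; rewrite !mxE; ring.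
  have E2 : cd_mul x' y' - cd_mul x y - (cd_mul dx y + cd_mul x dy) =
      cd_mul (x' - x - dx) y + cd_mul (x' - x) (y' - y) + cd_mul x (y' - y - dy).
    rewrite E1 !(cd_mulDl, cd_mulDr, cd_mulNl, cd_mulNr).
    by apply/rowP => j; rewrite !mxE; ring.
  have th2 : 0 <= th ^+ 2 by exact: sqr_ge0.
  have th21 : th ^+ 2 <= th by rewrite expr2 ler_piMl.
  have UU : 0 <= U - U0 by rewrite subr_ge0.
  have WW : 0 <= W - W0 by rewrite subr_ge0.
  have tri (s : R) (p q t : K) A1 A2 A3 : cd_abs p <= A1 -> cd_abs q <= A2 ->
      cd_abs t <= A3 -> A1 + A2 + A3 <= s -> cd_abs (p + q + t) <= s.
    move=> p1 q1 t1; apply: le_trans; apply: le_trans (cd_absD _ _) _.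
    by rewrite lerD//; apply: le_trans (cd_absD _ _) _; rewrite lerD.
  have cross : cd_abs (cd_mul (x' - x) (y' - y)) <= th ^+ 2 * ((U - U0) * (W - W0)).
    rewrite cd_absM// expr2 [leRHS](_ : _ = th * (U - U0) * (th * (W - W0))); last by ring.
    by rewrite ler_pM// cd_abs_ge0.
  split.
    rewrite E1; apply: (tri _ _ _ _ (th * (U - U0) * W0) (th ^+ 2 * ((U - U0) * (W - W0)))
      (U0 * (th * (W - W0)))) => //.
    - by rewrite cd_absM// ler_pM// cd_abs_ge0.
    - by rewrite cd_absM// ler_pM// cd_abs_ge0.
    have : th ^+ 2 * ((U - U0) * (W - W0)) <= th * ((U - U0) * (W - W0)).
      by rewrite ler_wpM2r// mulr_ge0.
    by lra.
  rewrite E2; apply: (tri _ _ _ _ (th ^+ 2 * (U - U0) * W0) (th ^+ 2 * ((U - U0) * (W - W0)))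
      (U0 * (th ^+ 2 * (W - W0)))) => //.
  - by rewrite cd_absM// ler_pM// cd_abs_ge0.
  - by rewrite cd_absM// ler_pM// cd_abs_ge0.
  by lra.
- split.
    have -> : eval u (z + h) + eval v (z + h) - (eval u z + eval v z) =
       (eval u (z + h) - eval u z) + (eval v (z + h) - eval v z) by rewrite opprD addrACA.
    apply: le_trans (cd_absD _ _) _; apply: le_trans (lerD IHu1 IHv1) _.
    by rewrite -mulrDr opprD addrACA.
  have -> : eval u (z + h) + eval v (z + h) - (eval u z + eval v z)
       - (eval (ederiv h u) z + eval (ederiv h v) z) =
       (eval u (z + h) - eval u z - eval (ederiv h u) z)
       + (eval v (z + h) - eval v z - eval (ederiv h v) z).
    by apply/rowP => j; rewrite !mxE; ring.
  apply: le_trans (cd_absD _ _) _; apply: le_trans (lerD IHu2 IHv2) _.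
  by rewrite -mulrDr opprD addrACA.
Qed.

Lemma eval_ederivP e z a h h' :
  eval (ederiv (a *: h + h') e) z = a *: eval (ederiv h e) z + eval (ederiv h' e) z.
Proof.
elim: e => [c|j|j|u IHu v IHv|u IHu v IHv] /=.
- by rewrite scaler0 addr0.
- by rewrite linearP.
- by rewrite linearP /= cd_conjD cd_conjZ.
- rewrite IHu IHv !(cd_mulDl, cd_mulDr, cd_mulZl, cd_mulZr) scalerDr.
  by rewrite addrACA.
- by rewrite IHu IHv scalerDr addrACA.
Qed.

Lemma eval_ederiv_basis e z h :
  eval (ederiv h e) z = \sum_i \sum_j h i j *: eval (ederiv (delta_mx i j) e) z.
Proof.
pose L h := eval (ederiv h e) z.
have L0 : L 0 = 0.
  have := eval_ederivP e z 1 0 0; rewrite !scale1r addr0 -/(L 0) => H.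
  by apply: (addrI (L 0)); rewrite -H addr0.
have LD h1 h2 : L (h1 + h2) = L h1 + L h2.
  by have := eval_ederivP e z 1 h1 h2; rewrite !scale1r.
have LZ a h1 : L (a *: h1) = a *: L h1.
  by have := eval_ederivP e z a h1 0; rewrite addr0 -/(L 0) L0 addr0.
rewrite -/(L h) [in LHS](matrix_sum_delta h) (big_morph L LD L0).
apply: eq_bigr => i _; rewrite (big_morph L LD L0); apply: eq_bigr => j _.
by rewrite LZ.
Qed.

End Expressions.

(** * Real analyticity of phrases *)

Section Shift.
Context {R : realType} {V : normedModType R}.

Lemma translate_continuous (z0 : V) : continuous (fun z : V => z - z0).
Proof. by move=> z; apply: cvgB; [exact: cvg_id|exact: cvg_cst]. Qed.

Lemma derive_translate (f : V -> R) (z0 v z : V) :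
  'D_v (fun z => f (z - z0)) z = 'D_v f (z - z0).
Proof.
have E : (fun h : R => h^-1 *: (((fun z => f (z - z0)) \o shift z) (h *: v) - f (z - z0)))
    = (fun h => h^-1 *: ((f \o shift (z - z0)) (h *: v) - f (z - z0))).
  by apply/funext => h /=; rewrite addrA.
by rewrite /derive E.
Qed.

Lemma Ck_translate (U : set V) k (f : V -> R) (z0 : V) :
  Ck U k f -> Ck [set z | U (z - z0)] k (fun z => f (z - z0)).
Proof.
elim: k f => [|k IH] f /=.
  move=> cf z Uz; apply: (@continuous_comp V V R^o (fun z => z - z0) f z).
    by apply: cvgB; [exact: cvg_id|exact: cvg_cst].
  exact: cf.
move=> [df Df]; split=> [z Uz|v].
  apply: (@differentiable_comp _ _ _ _ (fun z => z - z0) f).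
    apply: (@differentiableB _ _ _ id (cst z0)) => //.
  exact: df.
have -> : (fun z => 'D_v (fun z => f (z - z0)) z) = (fun z => 'D_v f (z - z0)).
  by apply/funext => z; exact: derive_translate.
exact: IH (Df v).
Qed.

End Shift.

Section AnalyticSeries.
Variables (R : realType) (r n : nat).
Hypothesis r_le3 : (r <= 3)%N.
Local Notation K := (cd R r).
Local Notation Kn := (cdn R r n).
Implicit Types (w : nat -> expr R r n).

Definition expr_sum w (i : 'I_(cdim r)) (z : Kn) : R :=
  limn (series (fun k => eval (w k) z 0 i)).

Definition majorized w (a : R) := cvgn (series (fun k => emaj (w k) a)).

Let dd : R := (cdim r)%:R.

Lemma row_abs_le (z : Kn) j : cd_abs (row j z) <= dd * `|z|.
Proof.
rewrite -(ler_pXn2r (n := 2))// ?nnegrE ?cd_abs_ge0 ?mulr_ge0//.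
rewrite cd_abs_sqr /dot.
apply: (@le_trans _ _ (\sum_(i < cdim r) `|z| ^+ 2)).
  apply: ler_sum => i _; rewrite -expr2 mxE -(real_normK (num_real _)).
  by rewrite ler_pXn2r// ?nnegrE// mx_coord_le.
rewrite sumr_const card_ord -mulr_natl exprMn ler_wpM2r ?sqr_ge0// expr2.
rewrite ler_peMl// ?ler0n// ler1n.
by rewrite cdimE expn_gt0.
Qed.

Lemma dd_gt0 : 0 < dd.
Proof. by rewrite ltr0n cdimE expn_gt0. Qed.

Lemma expr_sum_cvg w a z i : 0 <= a -> majorized w a -> rows_le a z ->
  series (fun k => eval (w k) z 0 i) @ \oo --> expr_sum w i z.
Proof.
move=> a0 wa za; suff : cvgn (series (fun k => eval (w k) z 0 i)) by [].
apply: normed_cvg; apply: series_le_cvg wa => k //=.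
  exact: emaj_ge0.
by apply: le_trans (cd_coord_le_abs _ _) _; exact: eval_le.
Qed.

(** A smaller radius pays for the derivative. *)
Lemma majorized_ederiv w h a b : 0 <= a < b -> majorized w b ->
  majorized (fun k => ederiv h (w k)) a.
Proof.
move=> /andP[a0 ab] wb.
have c0 : 0 < b - a by rewrite subr_gt0.
pose th := dd * `|h| / (b - a).
have th0 : 0 <= th by rewrite divr_ge0 ?mulr_ge0// ltW.
have hc : rows_le (th * (b - a)) h.
  by move=> j; rewrite /th divfK ?gt_eqF//; exact: row_abs_le.
apply: (@series_le_cvg _ _ (fun k => th * emaj (w k) b)).
- by move=> k; exact: emaj_ge0.
- by move=> k; rewrite mulr_ge0// emaj_ge0// (le_trans a0)// ltW.
- move=> k; apply: le_trans (emaj_ederiv (w k) a0 (ltW c0) th0 hc) _.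
  by rewrite [a + _]addrC subrK ler_wpM2l// gerBl emaj_ge0.
have -> : (fun k => th * emaj (w k) b) = th *: (fun k => emaj (w k) b) by [].
rewrite seriesZ; apply: is_cvgZl_tmp; exact: wb.
Qed.

(** The remainders of the terms are summable, with a sum of order |h| ^ 2. *)
Lemma expr_sum_differentiable w i a b z : 0 <= a < b -> majorized w b -> rows_le a z ->
  differentiable (expr_sum w i) z /\
  forall h, 'D_h (expr_sum w i) z = expr_sum (fun k => ederiv h (w k)) i z.
Proof.
move=> /andP[a0 ab] wb za.
have c0 : 0 < b - a by rewrite subr_gt0.
have abE : a + (b - a) = b by rewrite addrC subrK.
have b0 : 0 <= b by rewrite (le_trans a0)// ltW.
pose D k l := expr_sum (fun k' => ederiv (delta_mx k l) (w k')) i z.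
have cvD h : series (fun k => eval (ederiv h (w k)) z 0 i) @ \oo -->
    expr_sum (fun k => ederiv h (w k)) i z.
  have wa : majorized (fun k => ederiv h (w k)) a.
    by apply: majorized_ederiv wb; rewrite a0.
  exact: (expr_sum_cvg a0 wa za).
have sumE h N : series (fun k => eval (ederiv h (w k)) z 0 i) N =
    \sum_k \sum_l h k l * series (fun k' => eval (ederiv (delta_mx k l) (w k')) z 0 i) N.
  rewrite /series /=; under eq_bigr => q _ do rewrite eval_ederiv_basis summxE.
  rewrite exchange_big; apply: eq_bigr => k _.
  under eq_bigr => q _ do rewrite summxE.
  rewrite exchange_big; apply: eq_bigr => l _.
  by rewrite mulr_sumr; apply: eq_bigr => q _; rewrite mxE.
have dE h : expr_sum (fun k => ederiv h (w k)) i z = \sum_k \sum_l h k l * D k l.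
  apply: (cvg_unique _ (cvD h)) => //.
  have -> : series (fun k => eval (ederiv h (w k)) z 0 i) = (fun N =>
      \sum_k \sum_l h k l * series (fun k' => eval (ederiv (delta_mx k l) (w k')) z 0 i) N).
    by apply/funext => N; exact: sumE.
  apply: cvg_sumr => k; apply: cvg_sumr => l.
  by apply: cvgM; [exact: cvg_cst|exact: cvD].
pose S := limn (series (fun k => emaj (w k) b)).
have S0 : 0 <= S.
  apply: limr_ge; first exact: wb.
  by apply: nearW => N; apply: sumr_ge0 => k _; exact: emaj_ge0.
have SN N : series (fun k => emaj (w k) b) N <= S.
  apply: nondecreasing_cvgn_le => //.
  by apply: nondecreasing_series => k _ _; exact: emaj_ge0.
have [e e0|dphi E] := @differentiable_mx_eps R n (cdim r) (expr_sum w i) z D; last first.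
  by split=> // h; rewrite E dE.
  pose q := dd / (b - a).
  have q0 : 0 < q by rewrite divr_gt0// dd_gt0.
  pose eta := Num.min (q^-1) (e / (q ^+ 2 * (S + 1))).
  have S1 : 0 < S + 1 by rewrite ltr_wpDl.
  have q2S : 0 < q ^+ 2 * (S + 1) by apply: mulr_gt0 => //; exact: exprn_gt0.
  have eta0 : 0 < eta.
    by rewrite lt_min invr_gt0 q0 divr_gt0.
  apply/nbhs_ballP; exists eta => // h; rewrite -ball_normE /= sub0r normrN.
  rewrite lt_min => /andP[h1 h2].
  pose th := q * `|h|.
  have th0 : 0 <= th by rewrite mulr_ge0// ltW.
  have th1 : th <= 1 by rewrite /th -ler_pdivlMl// mulr1 ltW.
  have hc : rows_le (th * (b - a)) h.
    move=> j; apply: le_trans (row_abs_le h j) _.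
    by rewrite /th /q mulrAC divfK ?gt_eqF.
  have zh : rows_le b (z + h).
    rewrite -abE; apply: rows_le_add => // j; apply: le_trans (hc j) _.
    by rewrite ler_piMl// ltW.
  have zb : rows_le b z by move=> j; apply: le_trans (za j) _; exact: ltW.
  rewrite -dE.
  apply: (@le_trans _ _ (th ^+ 2 * S)); last first.
    have -> : th ^+ 2 * S = `|h| * (q ^+ 2 * S) * `|h| by rewrite /th; ring.
    rewrite ler_wpM2r//.
    move: h2; rewrite ltr_pdivlMr// => /ltW; apply: le_trans.
    by rewrite ler_wpM2l// ler_wpM2l ?sqr_ge0// lerDl.
  apply: (@cvg_abs_le R nat \oo (fun N => series (fun k => eval (w k) (z + h) 0 i) N
     - series (fun k => eval (w k) z 0 i) N - series (fun k => eval (ederiv h (w k)) z 0 i) N)).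
    apply: cvgB; last exact: cvD.
    by apply: cvgB; apply: (expr_sum_cvg b0 wb).
  apply: nearW => N.
  rewrite /series /= -!sumrB; apply: le_trans (ler_norm_sum _ _ _) _.
  apply: (@le_trans _ _ (\sum_(0 <= k < N) th ^+ 2 * emaj (w k) b)).
    apply: ler_sum => k _.
    have := (eval_taylor r_le3 (w k) a0 (ltW c0) (introT andP (conj th0 th1)) za hc).2.
    rewrite abE => T; apply: (@le_trans _ _ (th ^+ 2 * (emaj (w k) b - emaj (w k) a))).
      apply: le_trans T; apply: le_trans (cd_coord_le_abs _ i).
      by rewrite !mxE.
    by rewrite ler_wpM2l ?sqr_ge0// gerBl emaj_ge0.
  by rewrite -mulr_sumr ler_wpM2l ?sqr_ge0//; exact: SN.
Qed.

Definition polydisc (a : R) : set Kn :=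
  [set z | exists2 b, 0 <= b < a & rows_le b z].

Lemma polydisc_open a : open (polydisc a).
Proof.
rewrite openE => z [b /andP[b0 ba] zb].
have e0 : 0 < (a - b) / 2 / dd by rewrite !divr_gt0 ?subr_gt0// dd_gt0.
apply/nbhs_ballP; exists ((a - b) / 2 / dd) => // y; rewrite -ball_normE /= => yz.
exists (b + (a - b) / 2).
  by apply/andP; split; move: b0 ba; lra.
rewrite -(subrKC z y); apply: rows_le_add => // j.
apply: le_trans (row_abs_le _ _) _; rewrite distrC in yz.
by rewrite mulrC -ler_pdivlMr ?dd_gt0// ltW.
Qed.

Lemma Ck_expr_sum k a w i : (forall b, 0 <= b < a -> majorized w b) ->
  Ck (polydisc a) k (expr_sum w i).
Proof.
have main w' z : (forall b, 0 <= b < a -> majorized w' b) -> polydisc a z ->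
    differentiable (expr_sum w' i) z /\
    forall h, 'D_h (expr_sum w' i) z = expr_sum (fun k => ederiv h (w' k)) i z.
  move=> wm [b /andP[b0 ba] zb].
  have b'1 : b < (a + b) / 2 by lra.
  have b'2 : 0 <= (a + b) / 2 < a by apply/andP; split; lra.
  by apply: (@expr_sum_differentiable w' i b ((a + b) / 2)) => //; [rewrite b0|exact: wm].
elim: k w => [|k IH] w wm /=.
  by move=> z /(main w z wm)[dz _]; exact: differentiable_continuous.
split=> [z /(main w z wm)[]//|v].
have CI : Ck (polydisc a) k (expr_sum (fun k => ederiv v (w k)) i).
  apply: IH => b /andP[b0 ba].
  have b'1 : b < (a + b) / 2 by lra.
  apply: (@majorized_ederiv w v b ((a + b) / 2)); first by rewrite b0.
  by apply: wm; apply/andP; split; lra.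
apply: (Ck_eq (@polydisc_open a) _ CI).
by move=> z /(main w z wm)[_ ->].
Qed.

Fixpoint word_expr (w : word R r n) : expr R r n :=
  match w with
  | WConst c => EConst n c
  | WVar j => EVar R r j
  | WConj j => EConj R r j
  | WMul u v => EMul (word_expr u) (word_expr v)
  end.

Lemma eval_word (w : word R r n) z : eval (word_expr w) z = word_val w z.
Proof. by elim: w => //= u -> v ->. Qed.

Lemma emaj_word (w : word R r n) z a : (forall j, cd_abs (row j z) = a) ->
  emaj (word_expr w) a = cd_abs (word_val w z).
Proof.
move=> za; elim: w => [c|j|j|u IHu v IHv] //=.
- by rewrite cd_abs_conj za.
- by rewrite cd_absM// IHu IHv.
Qed.

Lemma cdn_abs_le (z : Kn) b : 0 <= b -> rows_le b z -> cdn_abs z <= n%:R * b.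
Proof.
move=> b0 zb; rewrite -(ler_pXn2r (n := 2))// ?nnegrE ?sqrtr_ge0 ?mulr_ge0//.
rewrite sqr_sqrtr; last by apply: sumr_ge0 => j _; exact: sqr_ge0.
apply: (@le_trans _ _ (\sum_(j < n) b ^+ 2)).
  by apply: ler_sum => j _; rewrite ler_pXn2r// nnegrE cd_abs_ge0.
rewrite sumr_const card_ord exprMn -[leLHS]mulr_natl ler_wpM2r ?sqr_ge0//.
by rewrite -natrX ler_nat; case: (n) => // m; rewrite expnS expn1 leq_pmulr.
Qed.

Let i0 : 'I_(cdim r) := cast_ord (esym (cdimE r)) (Ordinal (expn_gt0 2 r)).

(** Absolute convergence at a point whose coordinates all have modulus b is the
convergence of the series of majorants at radius b. *)
Lemma represents_Ck (p : phrase R r n) z0 e f k c : represents p z0 e f ->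
  exists2 W : set Kn, W z0 & Ck W k (fun z => f z 0 c).
Proof.
move=> [e0 Hp]; pose a := e / (n%:R + 1).
have n1 : 0 < n%:R + 1 :> R by rewrite ltr_wpDl.
have a0 : 0 < a by rewrite divr_gt0.
have in_ball z : polydisc a z -> cdn_abs z < e.
  move=> [b /andP[b0 ba] zb]; apply: le_lt_trans (cdn_abs_le b0 zb) _.
  apply: (@le_lt_trans _ _ ((n%:R + 1) * b)); first by rewrite ler_wpM2r// lerDl.
  by rewrite mulrC -ltr_pdivlMr.
pose w k := word_expr (p k).
have wm b : 0 <= b < a -> majorized w b.
  move=> /andP[b0 ba]; pose x : Kn := \matrix_(i, j) (b * (j == i0)%:R).
  have xb j : cd_abs (row j x) = b.
    rewrite cd_absE; have -> : row j x = b *: delta_mx 0 i0.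
      by apply/rowP => l; rewrite !mxE eqxx.
    by rewrite dotZl dotZr dot_delta_delta eqxx mulr1 -expr2 sqrtr_sqr ger0_norm.
  have xd : polydisc a x by exists b; [rewrite b0|move=> j; rewrite xb].
  have := Hp (z0 + x); rewrite [z0 + x]addrC addrK => /(_ (in_ball _ xd))[cv _ _ _].
  rewrite /majorized; have -> // : (fun k => emaj (w k) b) = (fun k => cd_abs (word_val (p k) x)).
  by apply/funext => q; rewrite (@emaj_word _ x).
have oP := @polydisc_open a.
have oW : open [set z | polydisc a (z - z0)].
  by apply: open_comp oP => z _; exact: translate_continuous.
exists [set z | polydisc a (z - z0)].
  by rewrite /= subrr; exists 0; [rewrite lexx|move=> j; rewrite linear0 cd_abs0].
apply: (Ck_eq oW _ (Ck_translate z0 (Ck_expr_sum k c wm))) => z /= Wz.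
have [_ cf _ _] := Hp z (in_ball _ Wz).
have [b /andP[b0 ba] zb] := Wz.
have bb : 0 <= b < a by rewrite b0.
have C1 := expr_sum_cvg (i := c) b0 (wm b bb) zb.
have C2 : series (fun q => eval (w q) (z - z0) 0 c) @ \oo --> f z 0 c.
  have -> : series (fun q => eval (w q) (z - z0) 0 c) =
      (fun M : K => M 0 c) \o series (fun q => word_val (p q) (z - z0)).
    apply/funext => N; rewrite /series /= summxE.
    by apply: eq_bigr => q _; rewrite eval_word.
  exact: (cvg_comp _ _ cf (@coord_continuous R 1 (cdim r) 0 c (f z))).
exact: (cvg_unique _ C1 C2).
Qed.

Lemma holomorphic_Ck (U : set Kn) f k c : holomorphic U f -> Ck U k (fun z => f z 0 c).
Proof.
move=> hf; apply: Ck_local => z0 Uz0; have [p [e [rp _]]] := hf z0 Uz0.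
by have [W Wz CW] := represents_Ck k c rp; exists W.
Qed.

End AnalyticSeries.

(** * Pseudoconformal functions are conformal or critical on slices *)

Section PseudoconformalSlices.
Variables (R : realType) (r n : nat).
Local Notation K := (cd R r).
Local Notation Kn := (cdn R r n).

Lemma pd_diff (f : Kn -> K) x v : differentiable f x -> pd v f x = 'd f x v.
Proof.
move=> df; have dv := diff_derivable (v := v) df.
apply: etrans _ (deriveE v df); rewrite (derive_mx dv).
by apply/rowP => c; rewrite !mxE.
Qed.

Lemma derive_slice (f : Kn -> K) xi j (h : K) :
  'D_h (slice f xi j) (row j xi) = 'D_(slice_vec (delta_mx j) h) f xi.
Proof.
have E : (fun t : R => t^-1 *: ((slice f xi j \o shift (row j xi)) (t *: h) - slice f xi j (row j xi)))
  = (fun t : R => t^-1 *: ((f \o shift xi) (t *: slice_vec (delta_mx j) h) - f xi)).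
  apply/funext => t /=; rewrite /slice; congr (_ *: (f _ - f _)).
    rewrite -slice_vecZ; apply/matrixP => i k; rewrite !mxE /slice_vec summxE.
    rewrite (bigD1 k)//= big1 ?addr0.
      by rewrite !mxE eqxx andbT; case: eqP => [->|]; rewrite !mxE ?mulr1 // mulr0 add0r.
    by move=> l /negbTE lk; rewrite !mxE [k == l]eq_sym lk andbF mulr0.
  by apply/matrixP => i k; rewrite !mxE; case: eqP => [->|]; rewrite mxE.
by rewrite /derive E.
Qed.

Lemma superderiv_pd (f : Kn -> K) xi j A : differentiable f xi ->
  has_superderiv (slice f xi j) (row j xi) A ->
  [/\ forall h, A h = pd (slice_vec (delta_mx j) h) f xi,
      forall h h', A (h + h') = A h + A h' & forall h, A (- h) = - A h].
Proof.
move=> df [p [e [[e0 rp] dzc dz]]].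
have c0 : cdn_abs (row j xi - row j xi : cdn R r 1) < e.
  rewrite subrr /cdn_abs big1 ?sqrtr0// => i _.
  by rewrite linear0 cd_abs0 expr0n.
have [_ _ ds Es] := rp _ c0.
have AE h : A h = 'd (slice f xi j) (row j xi) h.
  rewrite Es big_ord1 subrr dzc dz addr0; congr A.
  by apply/rowP => k; rewrite mxE.
split=> [h|h h'|h].
- rewrite AE -(deriveE h ds) derive_slice (pd_diff _ df).
  exact: deriveE.
- by rewrite !AE linearD.
- by rewrite !AE linearN.
Qed.

(** The vectors e_l + e_m and e_l - e_m are orthogonal; so are their images, which
therefore are the sum and the difference of two vectors of the same length. *)
Lemma pseudoconformal_dot (f : Kn -> K) xi j : differentiable f xi ->
  pseudoconformal_or_critical f xi j ->
  forall i k i0 : 'I_(cdim r),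
    dot (pd (delta_mx j i) f xi) (pd (delta_mx j k) f xi) =
    dot (pd (delta_mx j i0) f xi) (pd (delta_mx j i0) f xi) * (i == k)%:R.
Proof.
move=> df; have slice_vecE i : slice_vec (delta_mx j) (delta_mx 0 i) = delta_mx j i :> Kn.
  exact: slice_vec_delta.
case=> [[A [sA cA _ _]]|sA] i k i0; have [AE AD AN] := superderiv_pd df sA; last first.
  by rewrite -!slice_vecE -!AE !dot0l mul0r.
have cdot h h' : dot (A h) (A h') * (cd_abs h * cd_abs h') =
    cd_abs (A h) * cd_abs (A h') * dot h h'.
  by rewrite -!(proj1 (cd_re_mul_conj _ _)).
rewrite -!slice_vecE -!AE.
have d1 l : cd_abs (delta_mx 0 l : K) = 1.
  by rewrite cd_absE dot_delta_delta eqxx sqrtr1.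
have off l m : l != m -> dot (A (delta_mx 0 l)) (A (delta_mx 0 m)) = 0.
  move=> /negbTE lm; have := cdot (delta_mx 0 l) (delta_mx 0 m).
  by rewrite !d1 dot_delta_delta lm mulr0 !mulr1.
have diag l m : dot (A (delta_mx 0 l)) (A (delta_mx 0 l)) =
    dot (A (delta_mx 0 m)) (A (delta_mx 0 m)).
  have [->//|lm] := eqVneq l m.
  have ml : m != l by rewrite eq_sym.
  have H := cdot (delta_mx 0 l + delta_mx 0 m) (delta_mx 0 l - delta_mx 0 m).
  have {H} : (dot (A (delta_mx 0 l)) (A (delta_mx 0 l)) -
      dot (A (delta_mx 0 m)) (A (delta_mx 0 m))) *
      (cd_abs (delta_mx 0 l + delta_mx 0 m : K) * cd_abs (delta_mx 0 l - delta_mx 0 m : K)) = 0.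
    apply: etrans (etrans H _).
      rewrite !AD AN !(dotDl, dotDr, dotNl, dotNr) (off l m)// (off m l)//.
      by rewrite oppr0 addr0 add0r.
    rewrite [X in _ * X](_ : _ = 0) ?mulr0// !(dotDl, dotDr, dotNl, dotNr) !dot_delta_delta.
    by rewrite !eqxx (negbTE lm) (negbTE ml) /= oppr0 addr0 add0r subrr.
  move=> /eqP; rewrite mulf_eq0 => /orP[|]; first by rewrite subr_eq0 => /eqP.
  have two (s : R) : s * s = 1 -> cd_abs (delta_mx 0 l + s *: delta_mx 0 m : K) != 0.
    move=> ss; rewrite -sqrf_eq0 cd_abs_sqr !(dotDl, dotDr, dotZl, dotZr) !dot_delta_delta.
    rewrite !eqxx (negbTE lm) (negbTE ml) /= !mulr0 addr0 add0r mulr1 ss.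
    by rewrite -[1 + 1]/(2%:R) pnatr_eq0.
  rewrite mulf_eq0 => /orP[] /eqP H.
    by have /eqP[] := two 1 (mulr1 1); rewrite scale1r.
  have N1 : (-1) * (-1) = 1 :> R by rewrite mulrNN mulr1.
  by have /eqP[] := two (-1) N1; rewrite scaleN1r.
have [<-|ik] := eqVneq i k; first by rewrite mulr1; exact: diag.
by rewrite mulr0 off.
Qed.

Lemma holomorphic_differentiable (U : set Kn) (f : Kn -> K) x :
  holomorphic U f -> U x -> differentiable f x.
Proof.
move=> hf Ux; have [p [e [[e0 rp] _]]] := hf x Ux.
have c0 : cdn_abs (x - x) < e.
  rewrite subrr /cdn_abs big1 ?sqrtr0// => i _.
  by rewrite linear0 cd_abs0 expr0n.
by have [] := rp x c0.
Qed.

End PseudoconformalSlices.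

(** * Convergence relative to rho on compact sets *)

Section LocallyUniform.
Context {R : realType} {V : normedModType R}.
Variables (G : set_system nat) (U : set V).
Context {GP : ProperFilter G}.
Variables (a : nat -> V -> R) (b : V -> R).
Hypothesis ab : forall z, U z ->
  (fun p : nat * V => a p.1 p.2) @ filter_prod G (nbhs z) --> b z.

Lemma pair_cvg_pointwise z : U z -> a^~ z @ G --> b z.
Proof.
move=> /ab H; apply: cvg_trans H => A [[P Q] /= [GPP zQ] PQ].
have H : \forall k \near G, A (a k z).
  by apply: filterS GPP => k Pk; exact: (PQ (k, z) (conj Pk (nbhs_singleton zQ))).
exact: H.
Qed.

(** The limit b is continuous at x because the bound near x passes to the limit in k. *)
Lemma pair_cvg_uniform x eta : open U -> U x -> 0 < eta ->
  \forall x' \near x & k \near G, `|a k x' - b x'| <= eta.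
Proof.
move=> oU Ux e0; have e2 : 0 < eta / 2 by rewrite divr_gt0.
have /cvgrPdist_le/(_ _ e2) [[P Q] /= [GPP xQ] PQ] := ab Ux.
exists (Q `&` U, P) => /=.
  by split=> //; apply: filterI => //; exact: open_nbhs_nbhs.
move=> [y k] /= [[Qy Uy] Pk].
have H k' : P k' -> `|b x - a k' y| <= eta / 2 by move=> Pk'; exact: (PQ (k', y)).
have bxy : `|b x - b y| <= eta / 2.
  apply: (@cvg_abs_le R nat G (fun k => b x - a k y)).
    by apply: cvgB; [exact: cvg_cst|exact: pair_cvg_pointwise].
  by apply: filterS GPP => k' /H.
by apply: (@ler_dist_half R _ _ (b x)); rewrite distrC// H.
Qed.

End LocallyUniform.

Section CompactConvergence.
Variables (R : realType) (r n : nat).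
Local Notation K := (cd R r).
Local Notation Kn := (cdn R r n).

Lemma differentiable_coords (f : Kn -> K) z :
  (forall c, differentiable (fun y => f y 0 c) z) -> differentiable f z.
Proof.
move=> df; have -> : f = \sum_c (fun y => f y 0 c *: (delta_mx 0 c : K)).
  by apply/funext => y; rewrite fct_sumE; exact: row_sum_delta.
by apply: differentiable_sum => c; exact: differentiableZl.
Qed.

Lemma cd_abs_le_coord (w : K) (a : R) : 0 <= a -> (forall c, `|w 0 c| <= a) ->
  cd_abs w <= (cdim r)%:R * a.
Proof.
move=> a0 wa.
have -> : w = row ord0 (w : cdn R r 1) by apply/rowP => j; rewrite mxE.
apply: le_trans (row_abs_le (w : cdn R r 1) ord0) _.
rewrite ler_wpM2l//; apply: mx_norm_le => // i j.
by rewrite (ord1 i).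
Qed.

Lemma cdn_coord_le (h : Kn) i j : `|h i j| <= cdn_abs h.
Proof.
have -> : h i j = row i h 0 j by rewrite mxE.
apply: le_trans (cd_coord_le_abs _ _) _.
rewrite -(ler_pXn2r (n := 2))// ?nnegrE ?cd_abs_ge0 ?sqrtr_ge0//.
rewrite [leRHS]sqr_sqrtr; last by apply: sumr_ge0 => l _; exact: sqr_ge0.
by rewrite (bigD1 i)//= lerDl; apply: sumr_ge0 => l _; exact: sqr_ge0.
Qed.

Lemma rho_le (A : set Kn) (f g : Kn -> K) (eta : R) : 0 <= eta ->
  (forall z c, A z -> differentiable (fun y => f y 0 c) z /\ differentiable (fun y => g y 0 c) z) ->
  (forall z c, A z -> `|f z 0 c - g z 0 c| <= eta /\
    forall i j, `|pd (delta_mx i j) f z 0 c - pd (delta_mx i j) g z 0 c| <= eta) ->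
  (rho A f g <= ((cdim r)%:R * eta + (cdim r)%:R * ((n * cdim r)%:R * eta))%:E)%E.
Proof.
move=> e0 dfg fg; apply: ge_ereal_sup => _ [z Az <-]; rewrite EFinD; apply: leeD.
  rewrite lee_fin; apply: cd_abs_le_coord => // c.
  by rewrite !mxE; case: (fg z c Az).
apply: ge_ereal_sup => _ [h /= h1 <-]; rewrite lee_fin.
have df : differentiable f z by apply: differentiable_coords => c; case: (dfg z c Az).
have dg : differentiable g z by apply: differentiable_coords => c; case: (dfg z c Az).
have E : cd_abs ('d f z h - 'd g z h) = cd_abs (pd h f z - pd h g z).
  exact: (congr2 (fun a b => cd_abs (a - b)) (esym (pd_diff h df)) (esym (pd_diff h dg))).
apply: le_trans (eq_ind _ (fun a => _ <= a) (lexx _) _ E) _; apply: cd_abs_le_coord; first by rewrite mulr_ge0.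
move=> c; rewrite !mxE.
have [dfc dgc] := dfg z c Az.
rewrite !derive_mx_basis// -sumrB; apply: le_trans (ler_norm_sum _ _ _) _.
apply: (@le_trans _ _ (\sum_(i < n) \sum_(j < cdim r) eta)).
  apply: ler_sum => i _; rewrite -sumrB; apply: le_trans (ler_norm_sum _ _ _) _.
  apply: ler_sum => j _; rewrite -mulrBr normrM -[leRHS]mul1r ler_pM//.
    by rewrite -h1 cdn_coord_le.
  by have [_ /(_ i j)] := fg z c Az; rewrite !mxE.
by rewrite !sumr_const !card_ord -mulrnA mulnC mulr_natl.
Qed.

Definition C1cvg_vec (G : set_system nat) (U : set Kn) (u : nat -> Kn -> K) (g : Kn -> K) :=
  forall c, C1cvg G U (fun k z => u k z 0 c) (fun z => g z 0 c).

Lemma C1cvg_uniform (G : set_system nat) (U A : set Kn) (u : nat -> Kn -> K) (g : Kn -> K) :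
  ProperFilter G -> open U -> compact A -> A `<=` U -> C1cvg_vec G U u g ->
  forall eta, 0 < eta -> \forall k \near G, forall z c, A z ->
    `|u k z 0 c - g z 0 c| <= eta /\
    forall i j, `|pd (delta_mx i j) (u k) z 0 c - pd (delta_mx i j) g z 0 c| <= eta.
Proof.
move=> GP oU cA AU ug eta eta0.
move/compact_near_coveringP : cA => /(_ nat G (fun k z => forall c,
   `|u k z 0 c - g z 0 c| <= eta /\
    forall i j, `|pd (delta_mx i j) (u k) z 0 c - pd (delta_mx i j) g z 0 c| <= eta)) H.
have FG : Filter G by exact: filter_filter.
have {H} sub := H FG; apply: filterS (sub _) => [k Hk z c Az|x Ax].
  exact: (Hk z Az c).
have Ux := AU x Ax.
have FP : Filter (filter_prod (nbhs x) G) by exact: filter_prod_filter.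
apply: (@filter_forall _ _ (fun c (p : Kn * nat) =>
   `|u p.2 p.1 0 c - g p.1 0 c| <= eta /\
    forall i j, `|pd (delta_mx i j) (u p.2) p.1 0 c - pd (delta_mx i j) g p.1 0 c| <= eta)
  (filter_prod (nbhs x) G) FP) => c.
have H1 := @pair_cvg_uniform R Kn G U GP (fun k z => u k z 0 c) (fun z => g z 0 c)
  (fun z Uz => let: And3 _ h _ := ug c z Uz in h) x eta oU Ux eta0.
have H2 i j := @pair_cvg_uniform R Kn G U GP
  (fun k z => 'D_(delta_mx i j) (fun y => u k y 0 c) z)
  (fun z => 'D_(delta_mx i j) (fun y => g y 0 c) z)
  (fun z Uz => let: And3 _ _ h := ug c z Uz in h i j) x eta oU Ux eta0.
have H3 := @filter_forall _ _ (fun i (p : Kn * nat) => forall j,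
   `|'D_(delta_mx i j) (fun y => u p.2 y 0 c) p.1 - 'D_(delta_mx i j) (fun y => g y 0 c) p.1| <= eta)
  (filter_prod (nbhs x) G) FP (fun i => @filter_forall _ _ (fun j (p : Kn * nat) =>
   `|'D_(delta_mx i j) (fun y => u p.2 y 0 c) p.1 - 'D_(delta_mx i j) (fun y => g y 0 c) p.1| <= eta)
   (filter_prod (nbhs x) G) FP (H2 i)).
apply: filterS (filterI H1 H3) => -[y k] /= [h1 h2]; split=> // i j.
by rewrite !mxE; exact: h2.
Qed.

Lemma C1cvg_rho (G : set_system nat) (U A : set Kn) (u : nat -> Kn -> K) (g : Kn -> K) :
  ProperFilter G -> open U -> compact A -> A `<=` U ->
  (forall k z c, U z -> differentiable (fun y => u k y 0 c) z) ->
  C1cvg_vec G U u g ->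
  forall eps, 0 < eps -> \forall k \near G, (rho A (u k) g <= eps%:E)%E.
Proof.
move=> GP oU cA AU du ug eps eps0.
pose C : R := (cdim r)%:R + (cdim r)%:R * (n * cdim r)%:R + 1.
have C0 : 0 < C by rewrite ltr_wpDl// addr_ge0// mulr_ge0.
pose eta := eps / C.
have eta0 : 0 < eta by rewrite divr_gt0.
have H := C1cvg_uniform GP oU cA AU ug eta0.
apply: filterS H => k Hk.
apply: le_trans (rho_le (eta := eta) (ltW eta0) _ _) _.
- move=> z c Az; split; first by apply: du; exact: AU.
  by have [] := ug c z (AU z Az).
- by move=> z c Az; exact: (Hk z c Az).
rewrite lee_fin mulrA -mulrDl /eta mulrCA ler_piMr ?(ltW eps0)//.
by rewrite ler_pdivrMr// mul1r lerDl.
Qed.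

Lemma rho_ge0 (A : set Kn) (f g : Kn -> K) : (0 < n)%N -> A !=set0 -> (0 <= rho A f g)%E.
Proof.
move=> n0 [z Az].
pose i0 : 'I_(cdim r) := cast_ord (esym (cdimE r)) (Ordinal (expn_gt0 2 r)).
pose h : Kn := delta_mx (Ordinal n0) i0.
have h1 : cdn_abs h = 1.
  rewrite /cdn_abs (bigD1 (Ordinal n0))//= big1 ?addr0.
    have -> : row (Ordinal n0) h = delta_mx 0 i0.
      by apply/rowP => j; rewrite !mxE eqxx.
    by rewrite cd_abs_sqr dot_delta_delta eqxx sqrtr1.
  move=> i /negbTE i0n; have -> : row i h = 0.
    by apply/rowP => j; rewrite !mxE i0n.
  by rewrite cd_abs0 expr0n.
apply: le_ereal_sup_tmp; eexists; first by exists z.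
apply: adde_ge0; first by rewrite lee_fin cd_abs_ge0.
apply: le_ereal_sup_tmp; eexists; first by exists h.
by rewrite lee_fin cd_abs_ge0.
Qed.

Lemma rho_cvg_harmonic (A : set Kn) (u : nat -> Kn -> K) (g : Kn -> K) :
  (0 < n)%N -> A !=set0 -> (forall m, (rho A (u m) g <= (m.+1%:R^-1)%:E)%E) ->
  rho A (u k) g @[k --> \oo] --> 0%E.
Proof.
move=> n0 A0 H.
have C0 : (cst 0%E : nat -> \bar R) @ \oo --> 0%E by exact: cvg_cst.
have C1 : (fun m => (m.+1%:R^-1 : R)%:E) @ \oo --> 0%E.
  apply: cvg_EFin; first by apply: nearW.
  exact: (@cvg_harmonic R).
apply: (squeeze_cvge _ C0 C1); apply: nearW => m; apply/andP; split; last exact: H.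
exact: rho_ge0.
Qed.

End CompactConvergence.

Section Topology.
Context {R : realType}.

(** Heine-Borel for matrices follows from the case of row vectors, as vec_mx is an
isometry. *)
Lemma mx_bounded_closed_compact n d (A : set 'M[R]_(n, d)) :
  bounded_set A -> closed A -> compact A.
Proof.
move=> bA cA.
have vec_le (v : 'rV[R]_(n * d)) : `|vec_mx v| <= `|v|.
  apply: mx_norm_le => // i j; rewrite mxE; exact: mx_coord_le.
have le_vec (v : 'rV[R]_(n * d)) : `|v| <= `|vec_mx v|.
  apply: mx_norm_le => // i k; rewrite (ord1 i); case/mxvec_indexP: k => k l.
  have -> : v 0 (mxvec_index k l) = vec_mx v k l by rewrite mxE.
  exact: mx_coord_le.
have vc : continuous (vec_mx : 'rV[R]_(n * d) -> 'M[R]_(n, d)).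
  move=> v; apply: (proj2 (@cvgrPdist_le _ _ _ _ (nbhs_filter v) _ _)) => e e0.
  apply/nbhs_ballP; exists e => // w.
  rewrite -ball_normE /= => /ltW vw; rewrite -linearB; exact: le_trans (vec_le _) vw.
have <- : vec_mx @` (vec_mx @^-1` A) = A.
  apply/seteqP; split=> [_ [v Av <-]//|M AM]; exists (mxvec M); rewrite /= ?mxvecK//.
apply: continuous_compact; first exact: continuous_subspaceT.
apply: bounded_closed_compact.
  move: bA => [M [Mr HM]]; exists M; split=> // x Mx v Av.
  exact: le_trans (le_vec v) (HM x Mx _ Av).
by apply: closed_comp cA => v _; exact: vc.
Qed.

(** As G refines the Frechet filter, its members contain arbitrarily large indices. *)
Lemma frequent_subsequence (G : set_system nat) (Q : nat -> nat -> Prop) :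
  ProperFilter G -> \oo `<=` G -> (forall m, \forall k \near G, Q m k) ->
  exists2 s : nat -> nat, {homo s : k l / (k < l)%N} & forall m, Q m (s m).
Proof.
move=> GP ooG HQ.
have H (mN : nat * nat) : exists k, (mN.2 < k)%N /\ Q mN.1 k.
  have N1 : \forall k \near G, (mN.2 < k)%N by apply: ooG; exact: nbhs_infty_gt.
  exact: filter_ex (filterI N1 (HQ mN.1)).
have [h hP] := choice H.
pose fix s m := if m is m'.+1 then h (m, s m') else h (0%N, 0%N).
exists s.
  2: by case=> [|m]; [exact: (hP (0%N, 0%N)).2|exact: (hP (m.+1, s m)).2].
by apply: homo_ltn; [exact: ltn_trans|move=> m; exact: (hP (m.+1, s m)).1].
Qed.

End Topology.

(** * Bounded nonvanishing conformal families *)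

Section BoundedConformalFamilies.
Context {R : realType} {n d : nat}.
Local Notation V := 'M[R]_(n, d).
Variable U : set V.
Hypothesis oU : open U.
Hypothesis d_gt2 : (2 < d)%N.

(** What remains of a family that omits a ball, once the ball has been sent to a
neighbourhood of infinity by an inversion. *)
Record bounded_conformal (M : R) (g : V -> 'rV[R]_d) : Prop := BoundedConformal {
  bc_smooth : smooth U 3 g;
  bc_conf : forall j : 'I_n, exists mu, conformal_on U (delta_mx j) g mu;
  bc_neq0 : forall x, U x -> g x != 0;
  bc_bound : forall x, U x -> dot (g x) (g x) <= M
}.

Lemma slice_vec_row (j : 'I_n) (y : 'rV[R]_d) i k :
  slice_vec (delta_mx j : 'I_d -> V) y i k = (i == j)%:R * y 0 k.
Proof.
rewrite /slice_vec summxE (bigD1 k)//= big1 ?addr0.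
  by rewrite !mxE eqxx andbT mulrC.
by move=> l /negbTE lk; rewrite !mxE [k == l]eq_sym lk andbF mulr0.
Qed.

Lemma slice_vec_row_norm (j : 'I_n) (y : 'rV[R]_d) (r : R) : 0 < r -> dot y y < r ^+ 2 ->
  `|slice_vec (delta_mx j : 'I_d -> V) y| < r.
Proof.
move=> r0 yr; apply: (@le_lt_trans _ _ (Num.sqrt (dot y y))); last first.
  by rewrite -(ltr_pXn2r (n := 2))// ?nnegrE ?sqrtr_ge0 ?(ltW r0)// sqr_sqrtr// dotxx_ge0.
apply: mx_norm_le => [|i k]; first exact: sqrtr_ge0.
rewrite -(ler_pXn2r (n := 2))// ?nnegrE ?sqrtr_ge0//.
rewrite sqr_sqrtr ?dotxx_ge0// real_normK ?num_real// slice_vec_row.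
case: (i == j); rewrite ?mul1r ?mul0r ?expr0n ?dotxx_ge0//.
exact: dot_coord_le.
Qed.

Lemma slice_ball_in (j : 'I_n) (x z : V) (r s : R) : 0 < r ->
  (forall w, `|w - z| < s + r -> U w) -> `|x - z| <= s ->
  slice_ball U (delta_mx j) x r.
Proof.
move=> r0 Uz xz y yr; apply: Uz; rewrite addrAC (le_lt_trans (ler_normD _ _))//.
by rewrite ler_ltD// slice_vec_row_norm.
Qed.

(** The bound B depends on M and r alone, which makes the family equicontinuous. *)
Lemma bounded_conformal_estimates (M r : R) : 0 <= M -> 0 < r ->
  exists2 B, 0 <= B & forall g z, bounded_conformal M g ->
    (forall w, `|w - z| < r + r -> U w) ->
    forall c w, `|w - z| < r -> [/\ differentiable (fun y => g y 0 c) w,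
       forall i j, differentiable (fun w => 'D_(delta_mx i j) (fun y => g y 0 c) w) w,
       forall i j, `|'D_(delta_mx i j) (fun y => g y 0 c) w| <= B &
       forall i j, `|'D_(delta_mx i j) (fun w => 'D_(delta_mx i j) (fun y => g y 0 c) w) w| <= B].
Proof.
move=> M0 r0; have r20 : 0 < r ^+ 2 by rewrite exprn_gt0.
pose A := 4 * M / r ^+ 2; pose A' := 4 * A / r ^+ 2.
have A0 : 0 <= A by apply: divr_ge0; [exact: mulr_ge0|exact: ltW].
have A'0 : 0 <= A' by apply: divr_ge0; [exact: mulr_ge0|exact: ltW].
exists (1 + A + A'); first by rewrite !addr_ge0.
move=> g z [sg cg ng bg] Uz c w wz.
have Uw : U w by apply: Uz; rewrite (lt_trans wz)// ltrDl.
have sq_le (x y : R) : 0 <= y -> x ^+ 2 <= y -> `|x| <= 1 + y.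
  move=> y0 xy; rewrite -(ler_pXn2r (n := 2))// ?nnegrE ?addr_ge0//.
  rewrite real_normK ?num_real// (le_trans xy)// sqrrD expr1n mul1r.
  by have := sqr_ge0 y; lra.
have sgc := sg c.
split.
- exact: Ck_differentiable sgc Uw.
- by move=> i j; exact: Ck_differentiable (Ck_derive (delta_mx i j) sgc) Uw.
- move=> i j; have [mu cmu] := cg i.
  have sb := slice_ball_in i r0 Uz (ltW wz).
  have mA : mu w <= A.
    rewrite ler_pdivlMr// mulrC.
    apply: le_trans (nonvanishing_factor_le oU d_gt2 sg cmu ng r0 sb) _.
    by rewrite ler_wpM2l// bg.
  have : `|pd (delta_mx i j) g w 0 c| <= 1 + A.
    apply: sq_le => //; apply: le_trans (dot_coord_le _ c) _.
    by rewrite cmu// eqxx mulr1.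
  by rewrite mxE => /le_trans; apply; rewrite lerDl.
- move=> i j; have [mu cmu] := cg i.
  have sb := slice_ball_in i r0 Uz (ltW wz).
  have mA : mu w <= A.
    rewrite ler_pdivlMr// mulrC.
    apply: le_trans (nonvanishing_factor_le oU d_gt2 sg cmu ng r0 sb) _.
    by rewrite ler_wpM2l// bg.
  have : `|pd (delta_mx i j) (pd (delta_mx i j) g) w 0 c| <= 1 + A'.
    apply: sq_le => //; apply: le_trans (dot_coord_le _ c) _.
    rewrite ler_pdivlMr// mulrC.
    apply: le_trans (second_derivative_le oU d_gt2 sg cmu j r0 sb) _.
    by rewrite ler_wpM2l.
  have E : (fun y => pd (delta_mx i j) g y 0 c) = (fun w => 'D_(delta_mx i j) (fun y => g y 0 c) w).
    by apply/funext => y; rewrite mxE.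
  by rewrite mxE E => /le_trans; apply; rewrite lerD2r lerDl.
Qed.

Lemma open_radius (z : V) : U z -> exists2 r : R, 0 < r & forall w, `|w - z| < r -> U w.
Proof.
move=> Uz; have /nbhs_ballP [r r0 H] := open_nbhs_nbhs (conj oU Uz).
by exists r => // w wz; apply: H; rewrite -ball_normE /= distrC.
Qed.

Lemma bounded_conformal_ultra_limit (M : R) (G : set_system nat) (u : nat -> V -> 'rV[R]_d) :
  0 <= M -> UltraFilter G -> (forall k, bounded_conformal M (u k)) ->
  exists g : V -> 'rV[R]_d, forall c, C1cvg G U (fun k z => u k z 0 c) (fun z => g z 0 c).
Proof.
move=> M0 GU bu.
have main c : exists psi, C1cvg G U (fun k z => u k z 0 c) psi.
  apply: ultra_C1cvg => //.
  - by move=> k z Uz; exact: Ck_differentiable (bc_smooth (bu k) c) Uz.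
  - move=> z Uz; have [r r0 Hr] := open_radius Uz.
    have r20 : 0 < r / 2 by rewrite divr_gt0.
    have [B B0 HB] := bounded_conformal_estimates M0 r20.
    exists (B + (1 + M)) => k.
    have Hr2 w : `|w - z| < r / 2 + r / 2 -> U w by rewrite -splitr; exact: Hr.
    have zz : `|z - z| < r / 2 by rewrite subrr normr0.
    have [_ _ h _] := HB (u k) z (bu k) Hr2 c z zz.
    split; last by move=> i j; rewrite (le_trans (h i j))// lerDl addr_ge0.
    apply: (@le_trans _ _ (1 + M)); last by rewrite lerDr.
    rewrite -(ler_pXn2r (n := 2))// ?nnegrE ?addr_ge0// real_normK ?num_real//.
    apply: le_trans (dot_coord_le _ c) _; apply: le_trans (bc_bound (bu k) Uz) _.
    by rewrite sqrrD expr1n mul1r; have := sqr_ge0 M; lra.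
  - move=> z e Uz e0; have [r r0 Hr] := open_radius Uz.
    have r20 : 0 < r / 2 by rewrite divr_gt0.
    have [B B0 HB] := bounded_conformal_estimates M0 r20.
    have [eta eta0 He] := @equicontinuous_derivatives R n d (r / 2) B e r20 B0 e0.
    exists eta => // k; apply: He => w wz.
    by apply: (HB (u k) z (bu k)) wz; rewrite -splitr; exact: Hr.
have [psi Hpsi] := choice main.
exists (fun z => \row_c psi c z) => c.
have -> // : (fun z => (\row_c psi c z) 0 c) = psi c by apply/funext => z; rewrite mxE.
Qed.

End BoundedConformalFamilies.

(** * A Hurwitz theorem *)

Section Hurwitz.
Context {R : realType} {n d : nat}.
Local Notation V := 'M[R]_(n, d).
Variable U : set V.
Hypothesis oU : open U.
Hypothesis d_gt2 : (2 < d)%N.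

(* A path from z0 to z that changes one variable at a time. *)
Let mixed (z0 z : V) (m : nat) : V := \matrix_(i, k) if (i < m)%N then z i k else z0 i k.

Let mixed0 z0 z : mixed z0 z 0 = z0.
Proof. by apply/matrixP => i k; rewrite mxE. Qed.

Let mixedn z0 z : mixed z0 z n = z.
Proof. by apply/matrixP => i k; rewrite mxE ltn_ord. Qed.

Let mixedS z0 z m (mn : (m < n)%N) :
  mixed z0 z m.+1 = mixed z0 z m + slice_vec (delta_mx (Ordinal mn) : 'I_d -> V) (row (Ordinal mn) (z - z0)).
Proof.
apply/matrixP => i k; rewrite [RHS]mxE slice_vec_row !mxE ltnS leq_eqVlt.
have [E|im] := eqVneq i (Ordinal mn).
  by rewrite E /= eqxx ltnn mul1r addrC subrK.
have -> : (i == m :> nat) = false by apply/negbTE; apply: contra im => /eqP E; apply/eqP/val_inj.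
by rewrite mul0r addr0.
Qed.

Let mixed_near z0 z m : `|mixed z0 z m - z0| <= `|z - z0|.
Proof.
apply: mx_norm_le => // i k; rewrite !mxE; case: ifP => _; last by rewrite subrr normr0.
by have := mx_coord_le (z - z0) i k; rewrite !mxE.
Qed.

(** One factor exp 4 for each variable in which z and z0 differ. *)
Lemma bounded_conformal_harnack M (g : V -> 'rV[R]_d) (z0 z : V) (r : R) :
  bounded_conformal U M g -> 0 < r -> (forall w, `|w - z0| < r + r -> U w) ->
  (d%:R + 1) * `|z - z0| <= r / 2 ->
  dot (g z) (g z) <= expR 4 ^+ n * dot (g z0) (g z0).
Proof.
move=> [sg cg ng _] r0 Uz zz0.
have z0r : `|z - z0| <= r.
  apply: (@le_trans _ _ (r / 2)); last by rewrite ler_pdivrMr// ler_pMr// ler1n.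
  by apply: le_trans zz0; rewrite ler_peMl// lerDr.
suff H m : (m <= n)%N -> dot (g (mixed z0 z m)) (g (mixed z0 z m))
    <= expR 4 ^+ m * dot (g z0) (g z0).
  by have := H n (leqnn n); rewrite mixedn.
elim: m => [_|m IH mn]; first by rewrite mixed0 expr0 mul1r.
rewrite (mixedS _ _ mn); have [mu cmu] := cg (Ordinal mn).
have sb := slice_ball_in (Ordinal mn) r0 Uz (le_trans (mixed_near z0 z m) z0r).
apply: le_trans (nonvanishing_harnack oU d_gt2 sg cmu ng r0 sb _) _.
  apply: (@le_trans _ _ (\sum_(k < d) `|z - z0| ^+ 2)).
    apply: ler_sum => k _; rewrite -expr2 -(real_normK (num_real _)).
    by rewrite ler_pXn2r// ?nnegrE// mxE mx_coord_le.
  rewrite sumr_const card_ord -[leLHS]mulr_natl.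
  apply: (@le_trans _ _ (((d%:R + 1) * `|z - z0|) ^+ 2)); last first.
    by rewrite ler_pXn2r// ?nnegrE ?mulr_ge0 ?addr_ge0 ?divr_ge0 ?(ltW r0).
  rewrite exprMn ler_wpM2r ?sqr_ge0// sqrrD expr1n mulr1.
  by have := sqr_ge0 (d%:R : R); have : 0 <= d%:R :> R by []; lra.
rewrite exprS -mulrA ler_wpM2l ?expR_ge0//.
by apply: IH; exact: ltnW.
Qed.

(** The Harnack inequality holds for the limit, so the limit vanishes in a
neighbourhood of each of its zeros. *)
Lemma hurwitz_dichotomy (M : R) (G : set_system nat) (u : nat -> V -> 'rV[R]_d)
    (g : V -> 'rV[R]_d) :
  connected U -> ProperFilter G -> (forall k, bounded_conformal U M (u k)) ->
  (forall c, C1cvg G U (fun k z => u k z 0 c) (fun z => g z 0 c)) ->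
  (forall z, U z -> g z = 0) \/ (forall z, U z -> g z != 0).
Proof.
move=> cU GP bu ug.
have lim_dot z : U z -> (fun k => dot (u k z) (u k z)) @ G --> dot (g z) (g z).
  move=> Uz; apply: cvg_sumr => c.
  have H : (fun k => u k z 0 c) @ G --> g z 0 c.
    apply: (@pair_cvg_pointwise R V G U GP (fun k z => u k z 0 c) (fun z => g z 0 c)) => //.
    by move=> y Uy; have [] := ug c y Uy.
  exact: (cvgM H H).
pose Z := [set z | U z /\ g z = 0].
have gd z : U z -> vdifferentiable g z by move=> Uz c; have [] := ug c z Uz.
have [Z0|/set0P Zn0] := eqVneq Z set0.
  right=> z Uz; apply/eqP => gz; have : Z z by [].
  by rewrite Z0.
left; suff ZU : Z = U by move=> z; rewrite -{1}ZU => -[].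
apply: cU => //.
- exists Z; last by apply/seteqP; split=> [z Zz|z []//]; split=> //; case: Zz.
  rewrite openE => z0 [Uz0 gz0].
  have [r' r'0 Hr'] := open_radius oU Uz0.
  pose r := r' / 2; have r0 : 0 < r by rewrite divr_gt0.
  have Hr w : `|w - z0| < r + r -> U w by rewrite -splitr; exact: Hr'.
  have d1 : 0 < d%:R + 1 :> R by rewrite ltr_wpDl.
  pose s := Num.min r (r / 2 / (d%:R + 1)).
  have s0 : 0 < s by rewrite lt_min r0 !divr_gt0.
  apply/nbhs_ballP; exists s => // z; rewrite -ball_normE /= distrC lt_min => /andP[zr zs].
  have Uz : U z by apply: Hr; rewrite (lt_trans zr)// ltrDl.
  split=> //; apply: dotxx_eq0; apply/eqP; rewrite eq_le dotxx_ge0 andbT.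
  have C : (fun k => dot (u k z) (u k z) - expR 4 ^+ n * dot (u k z0) (u k z0)) @ G
      --> dot (g z) (g z) - expR 4 ^+ n * dot (g z0) (g z0).
    apply: cvgB; first exact: lim_dot.
    by apply: cvgM; [exact: cvg_cst|exact: lim_dot].
  rewrite gz0 dot0l mulr0 subr0 in C.
  apply: (@cvgr_to_le nat G GP R _ _ 0 C); apply: nearW => k.
  rewrite subr_le0; apply: (bounded_conformal_harnack (bu k) r0 Hr).
  by rewrite mulrC -ler_pdivlMr// ltW.
- pose N := [set z | U z /\ dot (g z) (g z) != 0].
  exists (~` N).
    apply: open_closedC; rewrite openE => z [Uz gz].
    have dc : {for z, continuous (fun y => dot (g y) (g y))}.
      by apply: differentiable_continuous; apply: differentiable_dot; exact: gd.
    have N1 : \forall y \near z, dot (g y) (g y) != 0 by exact: (cvgr_neq0 _ dc).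
    by apply: filterS (filterI (open_nbhs_nbhs (conj oU Uz)) N1) => y [].
  apply/seteqP; split=> z [Uz].
    by move=> gz; split=> //; case=> _; rewrite gz dot0l eqxx.
  move=> nN; split=> //; apply: dotxx_eq0; apply/eqP; apply: contrapT => gz.
  by apply: nN; split=> //; apply/negP.
Qed.

End Hurwitz.

(** * Convergence after an inversion, and the limit infinity *)

Section InversionLimits.
Context {R : realType} {n d : nat}.
Local Notation V := 'M[R]_(n, d).
Variables (U : set V) (G : set_system nat).
Hypothesis oU : open U.
Context {GP : ProperFilter G}.

Lemma cvg_dot (T : Type) (F : set_system T) (FF : Filter F) (x y : T -> 'rV[R]_d)
    (a b : 'rV[R]_d) :
  (forall c, (fun p => x p 0 c) @ F --> a 0 c) ->
  (forall c, (fun p => y p 0 c) @ F --> b 0 c) ->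
  (fun p => dot (x p) (y p)) @ F --> dot a b.
Proof.
move=> xa yb; apply: cvg_sumr => c.
by apply: cvgM; [exact: xa|exact: yb].
Qed.

Lemma C1cvg_sphere_inv (u : nat -> V -> 'rV[R]_d) (g : V -> 'rV[R]_d) :
  (forall k z, U z -> vdifferentiable (u k) z /\ u k z != 0) ->
  (forall z, U z -> g z != 0) ->
  (forall c, C1cvg G U (fun k z => u k z 0 c) (fun z => g z 0 c)) ->
  forall c, C1cvg G U (fun k z => (sphere_inv \o u k) z 0 c) (fun z => (sphere_inv \o g) z 0 c).
Proof.
move=> du g0 ug c z Uz.
pose F := filter_prod G (nbhs z).
have FF : Filter F by exact: filter_prod_filter.
have gd : vdifferentiable g z by move=> i; have [] := ug i z Uz.
have X i : (fun p : nat * V => u p.1 p.2 0 i) @ F --> g z 0 i.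
  by have [_ h _] := ug i z Uz; exact: h.
have q0 : dot (g z) (g z) != 0 by rewrite gt_eqF// dotxx_gt0// g0.
have Q := cvg_dot FF X X.
have Qi : (fun p : nat * V => (dot (u p.1 p.2) (u p.1 p.2))^-1) @ F --> (dot (g z) (g z))^-1.
  by apply: cvgV.
split.
- exact: (vdifferentiable_sphere_inv (g0 z Uz) gd c).
- have -> : (sphere_inv \o g) z 0 c = (dot (g z) (g z))^-1 * g z 0 c by rewrite /= mxE.
  have -> : (fun p : nat * V => (sphere_inv \o u p.1) p.2 0 c) =
     (fun p => (dot (u p.1 p.2) (u p.1 p.2))^-1 * u p.1 p.2 0 c).
    by apply/funext => p; rewrite /= mxE.
  exact: cvgM Qi (X c).
move=> i j; set b := delta_mx i j.
have dE (h : V -> 'rV[R]_d) y : h y != 0 -> vdifferentiable h y ->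
    'D_b (fun y => (sphere_inv \o h) y 0 c) y =
    (dot (h y) (h y))^-1 * pd b h y 0 c
    - (dot (h y) (h y))^-1 * (dot (h y) (h y))^-1 * (2 * dot (pd b h y) (h y)) * h y 0 c.
  move=> h0 dh; have := congr1 (fun M : 'rV[R]_d => M 0 c) (pd_sphere_inv b h0 dh).
  by rewrite mxE => ->; rewrite /dsphere_inv !mxE expr2 invfM.
rewrite (dE g z (g0 z Uz) gd).
have Y l : (fun p : nat * V => pd b (u p.1) p.2 0 l) @ F --> pd b g z 0 l.
  have [_ _ /(_ i j) h] := ug l z Uz.
  have -> : (fun p : nat * V => pd b (u p.1) p.2 0 l) =
     (fun p => 'D_b (fun y => u p.1 y 0 l) p.2) by apply/funext => p; rewrite mxE.
  by rewrite mxE; exact: h.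
have P := cvg_dot FF Y X.
have nearU : \forall p \near F, (dot (u p.1 p.2) (u p.1 p.2))^-1 * pd b (u p.1) p.2 0 c
    - (dot (u p.1 p.2) (u p.1 p.2))^-1 * (dot (u p.1 p.2) (u p.1 p.2))^-1
      * (2 * dot (pd b (u p.1) p.2) (u p.1 p.2)) * u p.1 p.2 0 c
    = 'D_b (fun y => (sphere_inv \o u p.1) y 0 c) p.2.
  exists (setT, U) => /=; first by split; [exact: filterT|exact: open_nbhs_nbhs].
  move=> [k y] /= [_ Uy]; have [dk k0] := du k y Uy.
  by rewrite (dE (u k) y k0 dk).
apply: cvg_trans (near_eq_cvg nearU) _.
apply: cvgB; first exact: cvgM Qi (Y c).
apply: cvgM; last exact: X.
by apply: cvgM; [exact: (cvgM Qi Qi)|apply: cvgM => //; exact: cvg_cst].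
Qed.

Lemma derive_addc (phi : V -> R) (a : R) v z :
  'D_v (fun y => phi y + a) z = 'D_v phi z.
Proof.
have E : (fun h : R => h^-1 *: (((fun y => phi y + a) \o shift z) (h *: v) - (phi z + a)))
    = (fun h => h^-1 *: ((phi \o shift z) (h *: v) - phi z)).
  by apply/funext => h /=; congr (_ *: _); rewrite opprD addrACA subrr addr0.
by rewrite /derive E.
Qed.

Lemma C1cvg_addc (phi : nat -> V -> R) (psi : V -> R) (a : R) :
  C1cvg G U phi psi -> C1cvg G U (fun k z => phi k z + a) (fun z => psi z + a).
Proof.
move=> H z Uz; have [d1 v1 D1] := H z Uz; split.
- by apply: (@differentiableD _ _ _ psi (cst a)) => //.
- by apply: cvgD => //; exact: cvg_cst.
move=> i j; rewrite derive_addc.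
have -> : (fun p : nat * V => 'D_(delta_mx i j) (fun z => phi p.1 z + a) p.2) =
  (fun p => 'D_(delta_mx i j) (phi p.1) p.2) by apply/funext => p; exact: derive_addc.
exact: D1.
Qed.

End InversionLimits.

Section Infinity.
Variables (R : realType) (r n : nat).
Local Notation K := (cd R r).
Local Notation Kn := (cdn R r n).

Lemma cd_inv_sphere_inv (z : K) : cd_inv z = cd_conj (sphere_inv z).
Proof. by rewrite /cd_inv /sphere_inv cd_conjZ cd_abs_sqr. Qed.

(** Conjugation only changes signs of coordinates; therefore it does not affect bounds
on coordinates and on their derivatives. *)
Lemma cd_conj_diag : exists2 s : 'I_(cdim r) -> R, (forall c, s c ^+ 2 = 1) &
  forall (x : K) c, cd_conj x 0 c = s c * x 0 c.
Proof.
elim: r => [|m [s s2 sE]].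
  by exists (fun=> 1) => [c|x c]; rewrite ?expr1n ?mul1r.
exists (fun c : 'I_(cdim m + cdim m) => match fintype.split c with inl j => s j | inr _ => -1 end).
  by move=> c; case: (fintype.split c) => // _; rewrite sqrrN expr1n.
move=> x c; rewrite /= mxE; case: (splitP c) => j cj.
  by rewrite sE mxE; congr (_ * x _ _); apply: val_inj.
by rewrite !mxE mulN1r; congr (- x _ _); apply: val_inj.
Qed.

Lemma pd_subc (f : Kn -> K) (c : K) v z : pd v (fun y => f y - c) z = pd v f z.
Proof.
apply/rowP => l; rewrite !mxE.
have -> : (fun y => (f y - c) 0 l) = (fun y => f y 0 l + (- c 0 l)).
  by apply/funext => y; rewrite !mxE.
exact: derive_addc.
Qed.

(** The moduli of inv f and of its derivative are those of inv (f - c), multiplied by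
|f - c| / |f| and by its square. This quotient is at most 2 where f is large. *)
Lemma rho_infinity (A : set Kn) (f : Kn -> K) (c : K) (eta : R) :
  (0 < n)%N -> 0 < eta -> 2 * eta * cd_abs c <= 1 ->
  (forall z, A z -> vdifferentiable f z) ->
  (forall z, A z -> f z != c) ->
  (forall z, A z -> dot (sphere_inv (f z - c)) (sphere_inv (f z - c)) <= eta ^+ 2 /\
     forall i j, dot (pd (delta_mx i j) (sphere_inv \o (fun y => f y - c)) z)
                     (pd (delta_mx i j) (sphere_inv \o (fun y => f y - c)) z) <= eta ^+ 2) ->
  (forall z, A z -> (2 * eta)^-1 <= cd_abs (f z)) /\
  (rho A (fun z => cd_inv (f z)) (fun=> 0%R) <=
    ((cdim r)%:R * (4 * eta) + (cdim r)%:R * ((n * cdim r)%:R * (4 * eta)))%:E)%E.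
Proof.
move=> n0 e0 ec df fc Hf.
have far z : A z -> eta^-1 <= cd_abs (f z - c).
  move=> Az; have [H _] := Hf z Az; move: H; rewrite sphere_inv_norm => H.
  have w0 : 0 < dot (f z - c) (f z - c) by rewrite dotxx_gt0// subr_eq0 fc.
  rewrite -(ler_pXn2r (n := 2))// ?nnegrE ?cd_abs_ge0 ?invr_ge0 ?(ltW e0)//.
  by rewrite cd_abs_sqr exprVn invf_ple// posrE exprn_gt0.
have half z : A z -> cd_abs (f z - c) <= 2 * cd_abs (f z).
  move=> Az; have := cd_absD (f z) (- c); rewrite cd_absN => T.
  have : 2 * cd_abs c <= eta^-1 by rewrite -[leRHS]mul1r ler_pdivlMr// mulrAC.
  by have := far z Az; lra.
have fz z : A z -> 0 < cd_abs (f z).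
  move=> Az; have : 0 < eta^-1 by rewrite invr_gt0.
  by have := far z Az; have := half z Az; lra.
split.
  move=> z Az; rewrite invfM; have := far z Az; have := half z Az; lra.
have [s s2 sE] := cd_conj_diag.
have e4 : 0 <= 4 * eta by rewrite mulr_ge0// ltW.
have fn0 z : A z -> f z != 0.
  by move=> Az; apply/eqP => fz0; have := fz z Az; rewrite fz0 cd_abs0 ltxx.
have dF z : A z -> vdifferentiable (sphere_inv \o f) z.
  by move=> Az; apply: vdifferentiable_sphere_inv; [exact: fn0|exact: df].
have FE k : (fun y => cd_inv (f y) 0 k) = (fun y => s k * (sphere_inv \o f) y 0 k).
  by apply/funext => y; rewrite cd_inv_sphere_inv sE.
have s1 k : `|s k| = 1.
  by have := s2 k; rewrite -(real_normK (num_real (s k))) => /eqP; rewrite sqrp_eq1// => /eqP.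
have le_of_sq (w : K) (b : R) k : 0 <= b -> dot w w <= b ^+ 2 -> `|w 0 k| <= b.
  move=> b0 wb; apply: le_trans (cd_coord_le_abs _ _) _.
  by rewrite -(ler_pXn2r (n := 2))// ?nnegrE ?cd_abs_ge0// cd_abs_sqr.
apply: rho_le => //.
  move=> z k Az; split; last first.
    have -> : (fun y : Kn => (0 : K) 0 k) = cst 0 by apply/funext => y; rewrite mxE.
    exact: differentiable_cst.
  rewrite FE; apply: (@differentiableM _ _ (cst (s k)) (fun y => (sphere_inv \o f) y 0 k)) => //.
  exact: dF.
move=> z k Az.
have f2 : 0 < cd_abs (f z) ^+ 2 by rewrite exprn_gt0// fz.
have h2 : 0 < cd_abs (f z - c) ^+ 2.
  by rewrite exprn_gt0// (lt_le_trans _ (far z Az))// invr_gt0.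
have hf : cd_abs (f z - c) ^+ 2 <= 4 * cd_abs (f z) ^+ 2.
  have -> : 4 * cd_abs (f z) ^+ 2 = (2 * cd_abs (f z)) ^+ 2 by ring.
  by rewrite ler_pXn2r// ?nnegrE ?mulr_ge0 ?cd_abs_ge0// half.
have [Hv HD] := Hf z Az.
split.
  rewrite [X in _ - X]mxE subr0 (congr1 (fun h => h z) (FE k)) normrM s1 mul1r.
  apply: le_of_sq => //=; rewrite sphere_inv_norm -cd_abs_sqr.
  move: Hv; rewrite sphere_inv_norm -cd_abs_sqr => Hv.
  apply: (@le_trans _ _ (4 * (cd_abs (f z - c) ^+ 2)^-1)).
    rewrite -[X in _ <= 4 * X]div1r mulrA mulr1 ler_pdivlMr// mulrC ler_pdivrMr//.
  apply: (@le_trans _ _ (4 * eta ^+ 2)); first by rewrite ler_wpM2l.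
  by rewrite exprMn ler_wpM2r ?sqr_ge0//; lra.
move=> i j; set b := delta_mx i j.
have -> : pd b (fun z => cd_inv (f z)) z 0 k = s k * pd b (sphere_inv \o f) z 0 k.
  rewrite !mxE FE.
  have dd : derivable (fun y => (sphere_inv \o f) y 0 k) z b.
    by apply: diff_derivable; exact: dF.
  have H := is_deriveM (is_derive_cst (s k) z b) (derivableP dd).
  by rewrite (@derive_val _ _ _ _ _ _ _ H) scaler0 addr0.
rewrite pd_cst [X in _ - X]mxE.
rewrite subr0 normrM s1 mul1r; apply: le_of_sq => //.
rewrite pd_sphere_inv ?fn0//; last exact: df.
rewrite dsphere_inv_dot ?fn0//.
have fcd : vdifferentiable (fun y => f y - c) z.
  move=> l; have -> : (fun y => (f y - c) 0 l) = (fun y => f y 0 l + (- c 0 l)).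
    by apply/funext => y; rewrite !mxE.
  by apply: (@differentiableD _ _ _ (fun y => f y 0 l) (cst (- c 0 l))) => //; exact: df.
have := HD i j; rewrite -/b pd_sphere_inv ?subr_eq0 ?fc//.
rewrite dsphere_inv_dot ?subr_eq0 ?fc//.
rewrite pd_subc.
rewrite -!cd_abs_sqr.
move: (dotxx_ge0 (pd b f z)); rewrite -cd_abs_sqr.
move: f2 h2 hf; move: (cd_abs (f z) ^+ 2) (cd_abs (f z - c) ^+ 2) (cd_abs (pd b f z) ^+ 2).
move=> x y D x0 y0 yx D0 H.
have DH : D <= eta ^+ 2 * y ^+ 2.
  by move: H; rewrite mulrC ler_pdivrMr// exprn_gt0.
rewrite mulrC ler_pdivrMr ?exprn_gt0//; apply: le_trans DH _.
have -> : (4 * eta) ^+ 2 * x ^+ 2 = eta ^+ 2 * (4 * x) ^+ 2 by ring.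
by rewrite ler_wpM2l ?sqr_ge0// ler_pXn2r// ?nnegrE ?mulr_ge0 ?(ltW x0) ?(ltW y0).
Qed.

End Infinity.

(** * Families omitting a ball *)

Section OmittedBall.
Variables (R : realType) (r n : nat).
Hypothesis r_le3 : (r <= 3)%N.
Hypothesis d_gt2 : (2 < cdim r)%N.
Local Notation K := (cd R r).
Local Notation Kn := (cdn R r n).
Variable U : set Kn.
Hypothesis oU : open U.

Lemma sup_norm_le_abs (w : K) : `|w| <= cd_abs w.
Proof.
apply: mx_norm_le; first exact: cd_abs_ge0.
by move=> i j; rewrite (ord1 i); exact: cd_coord_le_abs.
Qed.

Lemma omitting_bounded_conformal (f : Kn -> K) (c : K) (eps : R) : 0 < eps ->
  holomorphic U f ->
  (forall xi j, U xi -> pseudoconformal_or_critical f xi j) ->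
  (forall z, U z -> eps <= cd_abs (f z - c)) ->
  bounded_conformal U (eps ^- 2) (sphere_inv \o (fun z => f z - c)).
Proof.
move=> e0 hf cf low.
have i0 : 'I_(cdim r) := Ordinal (ltn_trans (isT : (0 < 2)%N) d_gt2).
have sh : smooth U 3 (fun z => f z - c).
  move=> l; have -> : (fun y => (f y - c) 0 l) = (fun y => f y 0 l + (- c 0 l)).
    by apply/funext => y; rewrite !mxE.
  by apply: CkD => //; [exact: holomorphic_Ck|exact: Ck_cst].
have ch j : conformal_on U (delta_mx j) (fun z => f z - c)
    (fun x => dot (pd (delta_mx j i0) f x) (pd (delta_mx j i0) f x)).
  move=> x Ux i k; rewrite !pd_subc.
  by apply: pseudoconformal_dot; [exact: holomorphic_differentiable Ux|exact: cf].
have nh x : U x -> f x - c != 0.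
  move=> Ux; apply/eqP => E; have := low x Ux.
  by rewrite E cd_abs0 leNgt e0.
split.
- exact: smooth_sphere_inv.
- move=> j; exact: (ex_intro _ _ (conformal_sphere_inv nh (smoothS (smoothS sh)) (ch j))).
- by move=> x Ux; apply: sphere_inv_neq0; exact: nh.
- move=> x Ux; rewrite /= sphere_inv_norm -cd_abs_sqr lef_pV2 ?posrE ?exprn_gt0//.
    by rewrite ler_pXn2r// ?nnegrE ?(ltW e0) ?cd_abs_ge0// low.
  by rewrite (lt_le_trans e0)// low.
Qed.

End OmittedBall.

Theorem theorem27 (R : realType) (r n : nat) (hr : r = 2%N \/ r = 3%N)
  (hn : (0 < n)%N) (U : set (cdn R r n)) (F : set (cdn R r n -> cd R r))
  (Uopen : open U) (Uconn : connected U) (UD : domain_condition U)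
  (Fhol : forall f, F f -> holomorphic U f)
  (Fconf : forall f xi j, F f -> interior U xi ->
     pseudoconformal_or_critical f xi j)
  (Fomit : interior (~` \bigcup_(f in F) (f @` U)) !=set0) :
  normal_family U F.
Proof.
have r3 : (r <= 3)%N by case: hr => ->.
have d2 : (2 < cdim r)%N by case: hr => ->.
have Fconf' f xi j : F f -> U xi -> pseudoconformal_or_critical f xi j.
  by move=> Ff Uxi; apply: Fconf => //; rewrite ((interior_id U).1 Uopen).
split=> // u Fu V V0 clV bV _ VU.
have [c /nbhs_ballP [eps eps0 omit]] := Fomit.
have {}eps0 : 0 < (eps : R) by [].
have low k z : U z -> eps <= cd_abs (u k z - c).
  move=> Uz; rewrite leNgt; apply/negP => lt.
  have : ball c eps (u k z).
    by rewrite -ball_normE /= distrC (le_lt_trans (sup_norm_le_abs _)).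
  move=> /omit; apply; exists (u k); first exact: Fu.
  by exists z.
have bg k : bounded_conformal U (eps ^- 2) (sphere_inv \o (fun z => u k z - c)).
  apply: omitting_bounded_conformal => //; first exact: Fhol.
    by move=> xi j; exact: Fconf'.
  by move=> z; exact: low.
(* The ultrafilter that replaces the extraction of subsequences. *)
have [G [GU ooG]] := ultraFilterLemma eventually_filter.
have GP : ProperFilter G by exact: (@ultra_proper _ _ GU).
have M0 : 0 <= eps ^- 2 by rewrite invr_ge0 sqr_ge0.
have [g ug] := bounded_conformal_ultra_limit Uopen d2 M0 GU bg.
have cV := mx_bounded_closed_compact bV clV.
have ud k z : U z -> vdifferentiable (u k) z.
  by move=> Uz l; exact: Ck_differentiable (holomorphic_Ck r3 1 l (Fhol _ (Fu k))) Uz.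
have [g0|gn0] := hurwitz_dichotomy Uopen d2 Uconn GP bg ug.
  pose Q (m k : nat) := (forall z, V z -> m%:R < cd_abs (u k z)) /\
    (rho V (fun z => cd_inv (u k z)) (fun=> 0%R) <= (m.+1%:R^-1)%:E)%E.
  have HQ m : \forall k \near G, Q m k.
    pose dd : R := (cdim r)%:R.
    have dd0 : 0 < dd by rewrite ltr0n (ltn_trans _ d2).
    pose C := dd + dd * (n * cdim r)%:R.
    have C0 : 0 <= C by rewrite addr_ge0 ?mulr_ge0// ltW.
    (* Each summand of L meets one of the constraints on eta = 1 / L below: 2 eta |c| <= 1,
       m < 1 / (2 eta) and 4 C eta <= 1 / (m + 1). *)
    pose L := 2 * cd_abs c + 2 * m.+1%:R + 4 * C * m.+1%:R + 1.
    have m1 : 1 <= m.+1%:R :> R by rewrite ler1n.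
    have m0 : 0 <= m.+1%:R :> R by [].
    have Cm : 0 <= 4 * C * m.+1%:R by rewrite !mulr_ge0.
    have c0 : 0 <= 2 * cd_abs c by rewrite mulr_ge0// cd_abs_ge0.
    have L0 : 0 < L by rewrite /L; lra.
    pose eta := L^-1.
    have eta0 : 0 < eta by rewrite invr_gt0.
    have e'0 : 0 < eta / dd by rewrite divr_gt0.
    apply: filterS (C1cvg_uniform GP Uopen cV VU ug e'0) => k Hk.
    have small (w : cd R r) : (forall l, `|w 0 l| <= eta / dd) -> dot w w <= eta ^+ 2.
      move=> Hw; rewrite -cd_abs_sqr ler_pXn2r// ?nnegrE ?cd_abs_ge0 ?(ltW eta0)//.
      apply: le_trans (cd_abs_le_coord (ltW e'0) Hw) _.
      by rewrite mulrC divfK// gt_eqF.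
    have ec : 2 * eta * cd_abs c <= 1.
      by rewrite mulrAC ler_pdivrMr// mul1r /L; lra.
    have vd z : V z -> vdifferentiable (u k) z by move=> /VU; exact: ud.
    have nc z : V z -> u k z != c.
      move=> Vz; rewrite -subr_eq0; apply/eqP => E.
      by have := low k z (VU z Vz); rewrite E cd_abs0 leNgt eps0.
    have [|inf rinf] := rho_infinity hn eta0 ec vd nc.
      move=> z Vz; split.
        apply: small => l; have [+ _] := Hk z l Vz.
        by rewrite g0 ?mxE ?subr0//; exact: VU.
      move=> i j; apply: small => l; have [_ /(_ i j)] := Hk z l Vz.
      have -> : pd (delta_mx i j) g z = 0.
        rewrite (@pd_eq_on _ _ _ U g (fun=> 0) _ z Uopen (VU z Vz) g0).
        exact: pd_cst.
      by rewrite [X in _ - X]mxE subr0.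
    split.
      move=> z /inf; apply: lt_le_trans.
      rewrite /eta invfM invrK.
      have mS : m%:R < m.+1%:R :> R by rewrite ltr_nat.
      by rewrite ltr_pdivlMl// /L; lra.
    apply: le_trans rinf _; rewrite lee_fin.
    rewrite (_ : _ + _ = C * 4 / L); last by rewrite /C /eta /dd; ring.
    rewrite ler_pdivrMr// ler_pdivlMl; last by rewrite ltr0n.
    by rewrite /L; lra.
  have [s smono sQ] := frequent_subsequence GP ooG HQ.
  exists s => //; right; split.
    move=> M; near=> m => z Vz.
    have [H _] := sQ m; apply: lt_trans (H z Vz).
    by near: m; exact: nbhs_infty_gtr.
  split; first by move=> z _; exact: differentiable_cst.
  by apply: rho_cvg_harmonic => // m; have [] := sQ m.
pose f z := sphere_inv (g z) + c.
have uE k : u k = (fun z => sphere_inv ((sphere_inv \o (fun z => u k z - c)) z) + c).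
  by apply/funext => z; rewrite /= sphere_invK subrK.
have uf : C1cvg_vec G U u f.
  move=> l.
  have H := C1cvg_addc (c 0 l) (C1cvg_sphere_inv Uopen (GP := GP)
    (fun k z Uz => conj (smooth_vdifferentiable Uz (bc_smooth (bg k))) (bc_neq0 (bg k) Uz))
    gn0 ug l).
  have -> : (fun k z => u k z 0 l) = (fun k z =>
     (sphere_inv \o (sphere_inv \o (fun z => u k z - c))) z 0 l + c 0 l).
    by apply/funext => k; rewrite {1}(uE k); apply/funext => z; rewrite mxE.
  have -> : (fun z => f z 0 l) = (fun z => (sphere_inv \o g) z 0 l + c 0 l).
    by apply/funext => z; rewrite /f mxE.
  exact: H.
have HQ m : \forall k \near G, (rho V (u k) f <= (m.+1%:R^-1)%:E)%E.
  apply: (C1cvg_rho GP Uopen cV VU _ uf); last by rewrite invr_gt0 ltr0n.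
  by move=> k z l Uz; exact: ud.
have [s smono sQ] := frequent_subsequence GP ooG HQ.
exists s => //; left; exists f; split.
  move=> z Vz; apply: differentiable_coords => l.
  by have [] := uf l z (VU z Vz).
exact: rho_cvg_harmonic.
Unshelve. all: by end_near. Qed.
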